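(* For $n=1,\ldots,N-1$, let $(\boldsymbol{J}_h^{n+1},\boldsymbol{u}_h^{n+1},\phi_h^{n+1},p_h^{n+1})\in\boldsymbol{W}_h^{n+1}\times\boldsymbol{V}_h^{n+1}\times S_h^{n+1}\times Q_h^{n+1}$ be determined by the fully discrete scheme (FD) described in the context. Then the discrete current density satisfies $$\nabla\cdot\boldsymbol{J}_h^{n+1}=0\quad\text{in }\Omega_h^{n+1}.$$
   Context: Initial mesh and spaces. Fix an integer $k\ge1$. $\widehat K$ is the reference tetrahedron, $P_r(\widehat K)$ the polynomials of total degree at most $r$, $\boldsymbol{P}_r(\widehat K)=[P_r(\widehat K)]^3$, and $\mathbf{BDM}_k(\widehat K)$ the standard local Brezzi–Douglas–Marini space of order $k$ (vector polynomials of degree at most $k$). $\Omega_h^0\subset\mathbb{R}^3$ is a bounded Lipschitz domain covered by a conforming curvilinear tetrahedral mesh $\mathcal{T}_h^0$; every $K_0\in\mathcal{T}_h^0$ is the image of $\widehat K$ under an orientation-preserving polynomial diffeomorphism $\boldsymbol{F}_{K_0}\in\boldsymbol{P}_{k+1}(\widehat K)$, these maps being compatible across common faces. Write $D\boldsymbol{F}_{K_0}$ for the Jacobian matrix and $\mathcal{J}_{K_0}=\det D\boldsymbol{F}_{K_0}>0$. Define - $\boldsymbol{W}_h^0$: all $\boldsymbol{\varphi}_h\in\boldsymbol{H}(\mathrm{div};\Omega_h^0)$ such that for each $K_0$, $\boldsymbol{\varphi}_h|_{K_0}\circ\boldsymbol{F}_{K_0}=\mathcal{J}_{K_0}^{-1}D\boldsymbol{F}_{K_0}\widehat{\boldsymbol{\varphi}}$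 for some $\widehat{\boldsymbol{\varphi}}\in\mathbf{BDM}_k(\widehat K)$; - $\widetilde{\boldsymbol{V}}_h^0$: all $\boldsymbol{v}_h\in\boldsymbol{H}^1(\Omega_h^0)$ with $\boldsymbol{v}_h|_{K_0}\circ\boldsymbol{F}_{K_0}\in\boldsymbol{P}_{k+1}(\widehat K)$ for each $K_0$; $\boldsymbol{V}_h^0=\widetilde{\boldsymbol{V}}_h^0\cap\boldsymbol{H}_0^1(\Omega_h^0)$; - $S_h^0$: all $r_h\in L^2(\Omega_h^0)$ with $r_h|_{K_0}\circ\boldsymbol{F}_{K_0}\in P_{k-1}(\widehat K)$ for each $K_0$; - $Q_h^0$: all $q_h\in H^1(\Omega_h^0)$ with $q_h|_{K_0}\circ\boldsymbol{F}_{K_0}\in P_k(\widehat K)$ for each $K_0$. Moving meshes. Let $t^n=n\Delta t$, $\Delta t=T/N$, $n=0,\dots,N$. The discrete flow maps $\boldsymbol{M}_h^n\in\widetilde{\boldsymbol{V}}_h^0$ ($\boldsymbol{M}_h^0$ the identity) map $\Omega_h^0$ onto the domain $\Omega_h^n$ with mesh $\mathcal{T}_h^n=\{\boldsymbol{M}_h^n(K_0):K_0\in\mathcal{T}_h^0\}$; each $\boldsymbol{M}_h^n$ is a bi-Lipschitz bijection, restricting to an orientation-preserving diffeomorphism on each $K_0$, with $\mathcal{J}_{\boldsymbol{M}_h^n}:=\det(D\boldsymbol{M}_h^n)>0$, where $D\boldsymbol{M}_h^n$ is the Jacobian matrix. Spaces on $\Omega_h^n$: - $\boldsymbol{W}_h^n=\{\boldsymbol{\varphi}_h\in\boldsymbol{H}(\mathrm{div};\Omega_h^n):\boldsymbol{\varphi}_h\circ\boldsymbol{M}_h^n=\mathcal{J}_{\boldsymbol{M}_h^n}^{-1}D\boldsymbol{M}_h^n\,\boldsymbol{\varphi}_h^0,\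 \boldsymbol{\varphi}_h^0\in\boldsymbol{W}_h^0\}$; - $\widetilde{\boldsymbol{V}}_h^n=\{\boldsymbol{v}_h\in\boldsymbol{H}^1(\Omega_h^n):\boldsymbol{v}_h\circ\boldsymbol{M}_h^n\in\widetilde{\boldsymbol{V}}_h^0\}$, $\boldsymbol{V}_h^n=\widetilde{\boldsymbol{V}}_h^n\cap\boldsymbol{H}^1_0(\Omega_h^n)$; - $S_h^n=\{r_h\in L^2(\Omega_h^n):r_h\circ\boldsymbol{M}_h^n\in S_h^0\}$; $Q_h^n=\{q_h\in H^1(\Omega_h^n):q_h\circ\boldsymbol{M}_h^n\in Q_h^0\}$. Coefficients. $\rho_h^0,\sigma_h^0,\nu_h^0$ are given positive bounded functions on $\Omega_h^0$, and $\rho_h^n\circ\boldsymbol{M}_h^n=\rho_h^0/\mathcal{J}_{\boldsymbol{M}_h^n}$, $\sigma_h^n\circ\boldsymbol{M}_h^n=\sigma_h^0$, $\nu_h^n\circ\boldsymbol{M}_h^n=\nu_h^0$. Constants: $\mathrm{Re}>0$, $\alpha\ge0$, $\beta>0$. $\boldsymbol{B}=\boldsymbol{B}(\boldsymbol{x})$ is a prescribed bounded field, $\boldsymbol{f}_u^{n+1}=\boldsymbol{f}_u(\cdot,t^{n+1})$ a prescribed body force, $\boldsymbol{D}(\boldsymbol{u})=\frac12(\nabla\boldsymbol{u}+\nabla\boldsymbol{u}^T)$, and $(\cdot,\cdot)_{\Omega}$ is the $L^2(\Omega)$ inner product. Scheme (FD). Given $\boldsymbol{u}_h^0\in\boldsymbol{V}_h^0$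 and starting values $\boldsymbol{M}_h^1$, $\boldsymbol{u}_h^1\in\boldsymbol{V}_h^1$ (from a backward Euler step), for $n=1,\dots,N-1$ the flow map is advanced by $$\frac{\boldsymbol{M}_h^{n+1}-\boldsymbol{M}_h^n}{\Delta t}=\frac32\boldsymbol{u}_h^n\circ\boldsymbol{M}_h^n-\frac12\boldsymbol{u}_h^{n-1}\circ\boldsymbol{M}_h^{n-1}.$$ For $m<n$ set $\boldsymbol{M}_h^{m,n}=\boldsymbol{M}_h^n\circ(\boldsymbol{M}_h^m)^{-1}$, $\widetilde{\boldsymbol{u}}_h^{\,n,m}=\boldsymbol{u}_h^m\circ(\boldsymbol{M}_h^{m,n})^{-1}\in\boldsymbol{V}_h^n$, and $$\Bigl(\frac{\delta\boldsymbol{u}_h}{\delta t}\Bigr)^{n+1}=\frac{3\boldsymbol{u}_h^{n+1}-4\widetilde{\boldsymbol{u}}_h^{\,n+1,n}+\widetilde{\boldsymbol{u}}_h^{\,n+1,n-1}}{2\Delta t}.$$ Then $(\boldsymbol{J}_h^{n+1},\boldsymbol{u}_h^{n+1},\phi_h^{n+1},p_h^{n+1})\in\boldsymbol{W}_h^{n+1}\times\boldsymbol{V}_h^{n+1}\times S_h^{n+1}\times Q_h^{n+1}$ satisfies, for all $\boldsymbol{\varphi}_h\in\boldsymbol{W}_h^{n+1}$, $\boldsymbol{v}_h\in\boldsymbol{V}_h^{n+1}$, $r_h\in S_h^{n+1}$, $q_h\in Q_h^{n+1}$ (all inner products over $\Omega_h^{n+1}$), $$((\sigma_h^{n+1})^{-1}\boldsymbol{J}_h^{n+1},\boldsymbol{\varphi}_h)-(\phi_h^{n+1},\nabla\cdot\boldsymbol{\varphi}_h)-(\boldsymbol{u}_h^{n+1}\times\boldsymbol{B},\boldsymbol{\varphi}_h)=0,$$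 $$\Bigl(\rho_h^{n+1}\Bigl(\frac{\delta\boldsymbol{u}_h}{\delta t}\Bigr)^{n+1},\boldsymbol{v}_h\Bigr)+\frac1{\mathrm{Re}}(2\nu_h^{n+1}\boldsymbol{D}(\boldsymbol{u}_h^{n+1}),\boldsymbol{D}(\boldsymbol{v}_h))+\beta(\nabla\cdot\boldsymbol{u}_h^{n+1},\nabla\cdot\boldsymbol{v}_h)-(p_h^{n+1},\nabla\cdot\boldsymbol{v}_h)-\alpha(\boldsymbol{J}_h^{n+1}\times\boldsymbol{B},\boldsymbol{v}_h)=(\rho_h^{n+1}\boldsymbol{f}_u^{n+1},\boldsymbol{v}_h),$$ $$-(\nabla\cdot\boldsymbol{J}_h^{n+1},r_h)=0,\qquad-(\nabla\cdot\boldsymbol{u}_h^{n+1},q_h)=0.$$ *)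

(* Defs.v *)
From mathcomp Require Import all_boot all_order all_algebra all_fingroup.
From mathcomp Require Import all_classical all_reals all_analysis.

Set Implicit Arguments.
Unset Strict Implicit.
Unset Printing Implicit Defensive.

Import Order.TTheory GRing.Theory Num.Theory.
Import numFieldNormedType.Exports.

Local Open Scope classical_set_scope.
Local Open Scope ring_scope.

(* Points of R^3 are row vectors; Lebesgue measure lives on R * R * R and is
   transported through the coordinate map vec3. *)
Definition vec3 (R : realType) (p : R * R * R) : 'rV[R]_3 :=
  \row_(j < 3) [:: p.1.1; p.1.2; p.2]`_j.

Definition mu3 (R : realType) :=
  ((@lebesgue_measure R \x @lebesgue_measure R) \x @lebesgue_measure R)%E.

Definition int3 (R : realType) (A : set 'rV[R]_3) (f : 'rV[R]_3 -> R) : R :=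
  Rintegral (@mu3 R) (@vec3 R @^-1` A) (f \o @vec3 R).

Definition ae3 (R : realType) (A : set 'rV[R]_3) (P : 'rV[R]_3 -> Prop) : Prop :=
  {ae @mu3 R, forall p, A (vec3 p) -> P (vec3 p)}.

(* Elements of L^2, H^1, H(div) are represented by functions on the whole of
   R^3; only their values almost everywhere on A matter. *)
Definition L2 (R : realType) (A : set 'rV[R]_3) (f : 'rV[R]_3 -> R) : Prop :=
  measurable_fun (@vec3 R @^-1` A) (f \o @vec3 R) /\
  (@mu3 R).-integrable (@vec3 R @^-1` A) (fun p => (f (vec3 p) ^+ 2)%:E).

Definition comp3 (R : realType) (v : 'rV[R]_3 -> 'rV[R]_3) (i : 'I_3)
  : 'rV[R]_3 -> R := fun x => v x 0 i.

Definition dot3 (R : realType) (a b : 'rV[R]_3) : R := \sum_i a 0 i * b 0 i.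

Definition cross3 (R : realType) (a b : 'rV[R]_3) : 'rV[R]_3 :=
  \row_(i < 3) (a 0 (i + 1) * b 0 (i + 2%:R) - a 0 (i + 2%:R) * b 0 (i + 1)).

Definition frob3 (R : realType) (A B : 'M[R]_3) : R :=
  \sum_i \sum_j A i j * B i j.

Definition partial (R : realType) (i : 'I_3) (f : 'rV[R]_3 -> R)
  : 'rV[R]_3 -> R := fun x => 'D_(delta_mx 0 i : 'rV[R]_3) f x.

Fixpoint Cn (R : realType) (m : nat) (f : 'rV[R]_3 -> R) : Prop :=
  if m is m'.+1 then
    (forall x, differentiable f x) /\ (forall i, Cn m' (partial i f))
  else continuous f.

Definition test_fun (R : realType) (A : set 'rV[R]_3) (psi : 'rV[R]_3 -> R)
  : Prop :=
  (forall m, Cn m psi) /\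
  exists K, [/\ compact K, K `<=` A & forall x, ~ K x -> psi x = 0].

Definition is_weak_partial (R : realType) (A : set 'rV[R]_3) (i : 'I_3)
    (f g : 'rV[R]_3 -> R) : Prop :=
  forall psi, test_fun A psi ->
    int3 A (fun x => f x * partial i psi x) = - int3 A (fun x => g x * psi x).

Definition is_weak_div (R : realType) (A : set 'rV[R]_3)
    (v : 'rV[R]_3 -> 'rV[R]_3) (g : 'rV[R]_3 -> R) : Prop :=
  forall psi, test_fun A psi ->
    int3 A (fun x => \sum_i v x 0 i * partial i psi x)
    = - int3 A (fun x => g x * psi x).

(* Weak derivatives are unique almost everywhere; these operators pick one
   representative (and are 0 when there is none). *)
Definition wpartial (R : realType) (A : set 'rV[R]_3) (i : 'I_3)
    (f : 'rV[R]_3 -> R) : 'rV[R]_3 -> R :=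
  xget (fun=> 0) [set g | L2 A g /\ is_weak_partial A i f g].

Definition wdiv (R : realType) (A : set 'rV[R]_3) (v : 'rV[R]_3 -> 'rV[R]_3)
  : 'rV[R]_3 -> R :=
  xget (fun=> 0) [set g | L2 A g /\ is_weak_div A v g].

Definition H1 (R : realType) (A : set 'rV[R]_3) (f : 'rV[R]_3 -> R) : Prop :=
  L2 A f /\ forall i, exists g, L2 A g /\ is_weak_partial A i f g.

(* Closure of the test functions in the H^1 norm. *)
Definition H10 (R : realType) (A : set 'rV[R]_3) (f : 'rV[R]_3 -> R) : Prop :=
  H1 A f /\
  exists psi : nat -> 'rV[R]_3 -> R, (forall m, test_fun A (psi m)) /\
    (fun m => int3 A (fun x => (f x - psi m x) ^+ 2)
       + \sum_i int3 A (fun x => (wpartial A i f x - partial i (psi m) x) ^+ 2))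
      @ \oo --> (0 : R).

Definition Hdiv (R : realType) (A : set 'rV[R]_3) (v : 'rV[R]_3 -> 'rV[R]_3)
  : Prop :=
  (forall i, L2 A (comp3 v i)) /\ exists g, L2 A g /\ is_weak_div A v g.

Definition sym_grad (R : realType) (A : set 'rV[R]_3)
    (u : 'rV[R]_3 -> 'rV[R]_3) (x : 'rV[R]_3) : 'M[R]_3 :=
  \matrix_(i, j) (2^-1 * (wpartial A j (comp3 u i) x
                          + wpartial A i (comp3 u j) x)).

Definition ref_tet (R : realType) : set 'rV[R]_3 :=
  [set x | (forall i, 0 <= x 0 i) /\ \sum_i x 0 i <= 1].

Definition is_poly (R : realType) (r : nat) (f : 'rV[R]_3 -> R) : Prop :=
  exists c : nat -> nat -> nat -> R, forall x,
    f x = \sum_(a < r.+1) \sum_(b < r.+1) \sum_(d < r.+1 | (a + b + d <= r)%N)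
            c a b d * x 0 0 ^+ a * x 0 1 ^+ b * x 0 2%:R ^+ d.

Definition is_poly_vec (R : realType) (r : nat) (f : 'rV[R]_3 -> 'rV[R]_3)
  : Prop := forall i, is_poly r (comp3 f i).

Definition BDM (R : realType) (k : nat) : set ('rV[R]_3 -> 'rV[R]_3) :=
  [set f | is_poly_vec k f].

(* Vertex ord0 is the origin, vertex lift ord0 j is the j-th basis vector. *)
Definition bary (R : realType) (x : 'rV[R]_3) (a : 'I_4) : R :=
  if unlift ord0 a is Some j then x 0 j else 1 - \sum_i x 0 i.

Definition vertex (R : realType) (a : 'I_4) : 'rV[R]_3 :=
  if unlift ord0 a is Some j then delta_mx 0 j else 0.

(* The (possibly lower dimensional, possibly empty) face spanned by s. *)
Definition face (R : realType) (s : {set 'I_4}) : set 'rV[R]_3 :=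
  [set x | ref_tet x /\ forall a, a \notin s -> bary x a = 0].

(* The affine map sending vertex a to vertex (s a). *)
Definition relabel (R : realType) (s : {perm 'I_4}) (x : 'rV[R]_3)
  : 'rV[R]_3 := \sum_a bary x a *: vertex R (s a).

Definition domain3 (R : realType) (A : set 'rV[R]_3) : Prop :=
  [/\ open A, connected A & A !=set0].

(* Near each boundary point, in suitable orthonormal coordinates, A is the
   region strictly above the graph of a Lipschitz function. *)
Definition lipschitz_boundary (R : realType) (A : set 'rV[R]_3) : Prop :=
  forall x, (closure A `\` A) x ->
    exists (Q : 'M[R]_3) (r L : R) (gamma : 'rV[R]_2 -> R),
      [/\ Q *m Q^T = 1%:M, 0 < r, L.-lipschitz gamma
        & forall z, ball x r z ->
            let y := (z - x) *m Q in
            A z <-> gamma (\row_(j < 2) y 0 (lift ord_max j)) < y 0 ord_max].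

Definition C1_on (R : realType) (U : set 'rV[R]_3)
    (f : 'rV[R]_3 -> 'rV[R]_3) : Prop :=
  forall x, U x -> differentiable f x /\ {for x, continuous (jacobian f)}.

(* A is not open in general: as usual, f is a diffeomorphism on A when it is
   the restriction of a diffeomorphism between open sets. *)
Definition orient_diffeo_on (R : realType) (A : set 'rV[R]_3)
    (f : 'rV[R]_3 -> 'rV[R]_3) : Prop :=
  exists (U V : set 'rV[R]_3) (g h : 'rV[R]_3 -> 'rV[R]_3),
    [/\ [/\ open U, open V & A `<=` U],
        C1_on U g /\ C1_on V h,
        (forall x, U x -> V (g x) /\ h (g x) = x) /\
        (forall y, V y -> U (h y) /\ g (h y) = y),
        forall x, A x -> g x = f x
      & forall x, A x -> 0 < \det ('J g x)].

(* Two distinct cells meet along the image of a common face s (empty if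
   s = set0), where their parametrizations agree up to the affine relabelling
   of the vertices. *)
Definition conforming (R : realType) (I : finType)
    (F : I -> 'rV[R]_3 -> 'rV[R]_3) : Prop :=
  forall i j : I, i != j ->
    exists (s : {set 'I_4}) (pi : {perm 'I_4}),
      [/\ s != [set: 'I_4]%SET,
          (F i @` ref_tet (R := R)) `&` (F j @` ref_tet (R := R))
            = F i @` @face R s
        & forall x, @face R s x -> F i x = F j (relabel pi x)].

Record curved_mesh (R : realType) (k : nat) (Omega : set 'rV[R]_3)
    (I : finType) (F : I -> 'rV[R]_3 -> 'rV[R]_3) : Prop := {
  mesh_domain : domain3 Omega;
  mesh_bounded : bounded_set Omega;
  mesh_lipschitz : lipschitz_boundary Omega;
  mesh_cover : closure Omega = \bigcup_i (F i @` ref_tet (R := R));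
  mesh_poly : forall i, is_poly_vec k.+1 (F i);
  mesh_diffeo : forall i, orient_diffeo_on (ref_tet (R := R)) (F i);
  mesh_conforming : conforming F }.

(* The matrix 'J f x acts on row vectors: v *m 'J f x is the derivative of f
   at x in the direction v, i.e. Df(x) v. *)
Definition piola (R : realType) (f : 'rV[R]_3 -> 'rV[R]_3) (x v : 'rV[R]_3)
  : 'rV[R]_3 := (\det ('J f x))^-1 *: (v *m 'J f x).

Definition W0 (R : realType) (k : nat) (Omega : set 'rV[R]_3) (I : finType)
    (F : I -> 'rV[R]_3 -> 'rV[R]_3) (w : 'rV[R]_3 -> 'rV[R]_3) : Prop :=
  Hdiv Omega w /\
  forall i, exists2 q, BDM k q &
    ae3 (ref_tet (R := R)) (fun x => w (F i x) = piola (F i) x (q x)).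

Definition Vt0 (R : realType) (k : nat) (Omega : set 'rV[R]_3) (I : finType)
    (F : I -> 'rV[R]_3 -> 'rV[R]_3) (v : 'rV[R]_3 -> 'rV[R]_3) : Prop :=
  (forall j, H1 Omega (comp3 v j)) /\
  forall i, exists2 q, is_poly_vec k.+1 q &
    ae3 (ref_tet (R := R)) (fun x => v (F i x) = q x).

Definition V0 (R : realType) (k : nat) (Omega : set 'rV[R]_3) (I : finType)
    (F : I -> 'rV[R]_3 -> 'rV[R]_3) (v : 'rV[R]_3 -> 'rV[R]_3) : Prop :=
  Vt0 k Omega F v /\ forall j, H10 Omega (comp3 v j).

Definition S0 (R : realType) (k : nat) (Omega : set 'rV[R]_3) (I : finType)
    (F : I -> 'rV[R]_3 -> 'rV[R]_3) (r : 'rV[R]_3 -> R) : Prop :=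
  L2 Omega r /\
  forall i, exists2 q, is_poly k.-1 q &
    ae3 (ref_tet (R := R)) (fun x => r (F i x) = q x).

Definition Q0 (R : realType) (k : nat) (Omega : set 'rV[R]_3) (I : finType)
    (F : I -> 'rV[R]_3 -> 'rV[R]_3) (q : 'rV[R]_3 -> R) : Prop :=
  H1 Omega q /\
  forall i, exists2 q', is_poly k q' &
    ae3 (ref_tet (R := R)) (fun x => q (F i x) = q' x).

(* M is meaningful on closure Omega only, so that it also acts on the closed
   cells. *)
Record flow_map (R : realType) (k : nat) (Omega : set 'rV[R]_3) (I : finType)
    (F : I -> 'rV[R]_3 -> 'rV[R]_3) (M : 'rV[R]_3 -> 'rV[R]_3) : Prop := {
  flow_Vt0 : Vt0 k Omega F M;
  flow_bilip : exists L : R, L.-lipschitz_(closure Omega) M /\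
    forall x y, closure Omega x -> closure Omega y ->
      `|x - y| <= L * `|M x - M y|;
  flow_domain : domain3 (M @` Omega);
  flow_diffeo : forall i, orient_diffeo_on (F i @` ref_tet (R := R)) M }.

Definition WM (R : realType) (k : nat) (Omega : set 'rV[R]_3) (I : finType)
    (F : I -> 'rV[R]_3 -> 'rV[R]_3) (M w : 'rV[R]_3 -> 'rV[R]_3) : Prop :=
  Hdiv (M @` Omega) w /\
  exists2 w0, W0 k Omega F w0 &
    ae3 Omega (fun x => w (M x) = piola M x (w0 x)).

Definition VtM (R : realType) (k : nat) (Omega : set 'rV[R]_3) (I : finType)
    (F : I -> 'rV[R]_3 -> 'rV[R]_3) (M v : 'rV[R]_3 -> 'rV[R]_3) : Prop :=
  (forall j, H1 (M @` Omega) (comp3 v j)) /\ Vt0 k Omega F (v \o M).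

Definition VM (R : realType) (k : nat) (Omega : set 'rV[R]_3) (I : finType)
    (F : I -> 'rV[R]_3 -> 'rV[R]_3) (M v : 'rV[R]_3 -> 'rV[R]_3) : Prop :=
  VtM k Omega F M v /\ forall j, H10 (M @` Omega) (comp3 v j).

Definition SM (R : realType) (k : nat) (Omega : set 'rV[R]_3) (I : finType)
    (F : I -> 'rV[R]_3 -> 'rV[R]_3) (M : 'rV[R]_3 -> 'rV[R]_3)
    (r : 'rV[R]_3 -> R) : Prop :=
  L2 (M @` Omega) r /\ S0 k Omega F (r \o M).

Definition QM (R : realType) (k : nat) (Omega : set 'rV[R]_3) (I : finType)
    (F : I -> 'rV[R]_3 -> 'rV[R]_3) (M : 'rV[R]_3 -> 'rV[R]_3)
    (q : 'rV[R]_3 -> R) : Prop :=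
  H1 (M @` Omega) q /\ Q0 k Omega F (q \o M).

Definition coefficient (R : realType) (A : set 'rV[R]_3) (f : 'rV[R]_3 -> R)
  : Prop :=
  measurable_fun (@vec3 R @^-1` A) (f \o @vec3 R) /\
  exists C : R, forall x, A x -> 0 < f x <= C.

Definition bounded_field (R : realType) (B : 'rV[R]_3 -> 'rV[R]_3) : Prop :=
  (forall i, measurable_fun setT (comp3 B i \o @vec3 R)) /\
  exists C : R, forall x, `|B x| <= C.

(* M^{m,n} = M^n o (M^m)^-1, from M^m(Omega) to M^n(Omega). *)
Definition transition (R : realType) (Omega : set 'rV[R]_3)
    (M : nat -> 'rV[R]_3 -> 'rV[R]_3) (m n : nat) : 'rV[R]_3 -> 'rV[R]_3 :=
  M n \o pinv Omega (M m).

Definition transported (R : realType) (Omega : set 'rV[R]_3)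
    (M u : nat -> 'rV[R]_3 -> 'rV[R]_3) (n m : nat) : 'rV[R]_3 -> 'rV[R]_3 :=
  u m \o pinv (M m @` Omega) (transition Omega M m n).

(* The difference quotient at time index n.+1; used for n >= 1 only. *)
Definition bdf2 (R : realType) (Omega : set 'rV[R]_3) (dt : R)
    (M u : nat -> 'rV[R]_3 -> 'rV[R]_3) (n : nat) (x : 'rV[R]_3) : 'rV[R]_3 :=
  (2 * dt)^-1 *: (3 *: u n.+1 x - 4 *: transported Omega M u n.+1 n x
                  + transported Omega M u n.+1 n.-1 x).

Definition flow_step (R : realType) (Omega : set 'rV[R]_3) (dt : R)
    (M u : nat -> 'rV[R]_3 -> 'rV[R]_3) (n : nat) : Prop :=
  ae3 Omega (fun x => dt^-1 *: (M n.+1 x - M n x)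
    = (3 / 2) *: u n (M n x) - (1 / 2) *: u n.-1 (M n.-1 x)).

Definition ohm_eq (R : realType) (A : set 'rV[R]_3) (sigma : 'rV[R]_3 -> R)
    (B J u : 'rV[R]_3 -> 'rV[R]_3) (phi : 'rV[R]_3 -> R)
    (WA : set ('rV[R]_3 -> 'rV[R]_3)) : Prop :=
  forall w, WA w ->
    int3 A (fun x => dot3 ((sigma x)^-1 *: J x) (w x))
    - int3 A (fun x => phi x * wdiv A w x)
    - int3 A (fun x => dot3 (cross3 (u x) (B x)) (w x)) = 0.

Definition momentum_eq (R : realType) (A : set 'rV[R]_3)
    (Re alpha beta : R) (rho nu : 'rV[R]_3 -> R)
    (B f J u du : 'rV[R]_3 -> 'rV[R]_3) (p : 'rV[R]_3 -> R)
    (VA : set ('rV[R]_3 -> 'rV[R]_3)) : Prop :=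
  forall v, VA v ->
    int3 A (fun x => dot3 (rho x *: du x) (v x))
    + Re^-1 * int3 A (fun x => frob3 ((2 * nu x) *: sym_grad A u x)
                                     (sym_grad A v x))
    + beta * int3 A (fun x => wdiv A u x * wdiv A v x)
    - int3 A (fun x => p x * wdiv A v x)
    - alpha * int3 A (fun x => dot3 (cross3 (J x) (B x)) (v x))
    = int3 A (fun x => dot3 (rho x *: f x) (v x)).

Definition div_free_eq (R : realType) (A : set 'rV[R]_3)
    (v : 'rV[R]_3 -> 'rV[R]_3) (SA : set ('rV[R]_3 -> R)) : Prop :=
  forall r, SA r -> - int3 A (fun x => wdiv A v x * r x) = 0.

(* Main.v *)
Require Import Defs.
From HB Require Import structures.
From mathcomp Require Import all_boot all_order all_algebra.
From mathcomp Require Import all_classical all_reals all_analysis.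
From mathcomp Require Import measurable_realfun.
From mathcomp Require Import ring lra zify.

Set Implicit Arguments.
Unset Strict Implicit.
Unset Printing Implicit Defensive.

Import Order.TTheory GRing.Theory Num.Theory.
Import numFieldNormedType.Exports.

Local Open Scope classical_set_scope.
Local Open Scope ring_scope.

(** The weak divergence g of the current lies in L2. The equation tests it
    against all functions whose pull-back to each reference cell is a
    polynomial of degree k - 1. For each cell, such a test function r is found
    that vanishes on the other cells, makes g r nonnegative, and for which g r
    vanishes on the cell only where g does.

    On a moved cell the chart P = M \o F i is a polynomial map of the
    tetrahedron with a C1 inverse H. Piola transforms compose, hence the current
    is there the Piola transform by P of a polynomial field q of degree k. It is
    C1 on the open moved cell, and the Piola identity gives its classical
    divergence as (div q / det DP) \o H ([divergence_transported]). Integration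
    by parts and the fundamental lemma of the calculus of variations
    ([du_bois_reymond]) show that g coincides with it almost everywhere on the
    cell ([weak_div_classical]).

    Now div q has degree k - 1, so (div q) \o H on one moved cell, extended by
    zero, is an admissible test function ([cell_extension_SM]). As the integral
    of g against it is that of the nonnegative function (div q)^2 / det DP, the
    divergence vanishes almost everywhere on the cell ([wdiv_cell_eq0]). What is
    left of the domain is contained in the images of the boundary of the
    tetrahedron.

    No change of variables is performed in any integral: the charts only carry
    null sets to null sets, which every map that is differentiable at the points
    of the set does ([null3_image]). *)

(** * Coordinates, dyadic cubes and Borel sets *)

Notation T3 R := (measurableTypeR R * measurableTypeR R * measurableTypeR R)%type.

Section Coordinates.
Variable R : realType.
Implicit Types (x y : 'rV[R]_3).

Definition coords3 x : T3 R := (x 0 0, x 0 1, x 0 2%:R).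

Lemma ord3P (P : 'I_3 -> Prop) : P 0 -> P 1 -> P 2%:R -> forall i, P i.
Proof.
move=> P0 P1 P2 [[|[|[|//]]] i3].
- by rewrite (_ : Ordinal i3 = 0)//; exact: val_inj.
- by rewrite (_ : Ordinal i3 = 1)//; exact: val_inj.
- by rewrite (_ : Ordinal i3 = 2%:R)//; exact: val_inj.
Qed.

Lemma sum3E (V : zmodType) (F : 'I_3 -> V) : \sum_i F i = F 0 + F 1 + F 2%:R.
Proof.
rewrite !big_ord_recl big_ord0 addr0 addrA.
by congr (F _ + F _ + F _); exact: val_inj.
Qed.

Lemma coords3K : cancel coords3 (@vec3 R).
Proof. by move=> x; apply/rowP; apply: ord3P; rewrite mxE. Qed.

Lemma vec3E (p : T3 R) :
  (vec3 p 0 0 = p.1.1) * (vec3 p 0 1 = p.1.2) * (vec3 p 0 2%:R = p.2).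
Proof. by rewrite !mxE. Qed.

(** Induction over the Borel sets: the half-spaces give the preimages of all
    Borel sets by the coordinates, and these generate the product
    sigma-algebra. *)
Lemma halfspaces_generate_borel (S : set (set (T3 R))) : sigma_algebra setT S ->
  (forall i a, S [set p : T3 R | vec3 p 0 i < a]) ->
  forall A : set (T3 R), measurable A -> S A.
Proof.
move=> [S0 SC SU] Shalf.
have Spre (U : pointedType) (G : set (set U)) (f : T3 R -> U) : (forall B, G B -> S (f @^-1` B)) ->
    forall B, <<s G >> B -> S (f @^-1` B).
  move=> GS; apply: smallest_sub => //; split => [|B SB|F SF].
  - exact: S0.
  - exact: (SC _ SB).
  - by rewrite /= preimage_bigcup; exact: SU.
have Scoord i (B : set (measurableTypeR R)) : measurable B -> S [set p : T3 R | B (vec3 p 0 i)].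
  rewrite [X in X _ -> _]measurable_realfun.RGenInftyO.measurableE.
  apply: (@Spre (measurableTypeR R) _ (fun p : T3 R => vec3 p 0 i)) => _ [a ->].
  have -> : (fun p => vec3 p 0 i) @^-1` `]-oo, a[ = [set p : T3 R | vec3 p 0 i < a] by apply/seteqP; split => p /=; rewrite in_itv.
  exact: Shalf.
apply: smallest_sub => // _ [|] [B mB <-]; rewrite setTI.
- apply: (@Spre _ _ fst) B mB => _ [|] [B mB <-]; rewrite setTI.
  + rewrite (_ : _ @^-1` _ = [set p : T3 R | B (vec3 p 0 0)]); first exact: Scoord.
    by apply/seteqP; split => p /=; rewrite vec3E.
  + rewrite (_ : _ @^-1` _ = [set p : T3 R | B (vec3 p 0 1)]); first exact: Scoord.
    by apply/seteqP; split => p /=; rewrite vec3E.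
- rewrite (_ : _ @^-1` _ = [set p : T3 R | B (vec3 p 0 2%:R)]); first exact: Scoord.
  by apply/seteqP; split => p /=; rewrite vec3E.
Qed.

End Coordinates.

Section Dyadic.
Variable R : realType.
Implicit Types (x y : 'rV[R]_3).
Notation mu3 := (@mu3 R).
Notation vec3 := (@vec3 R).

(** The index of the half-open dyadic cube of side 2^(-n) that contains x. *)
Definition address (n : nat) x : int * int * int :=
  let f i := Num.floor (x 0 i * 2 ^+ n) in (f 0, f 1, f 2%:R).

Definition dcube n (k : int * int * int) : set 'rV[R]_3 :=
  [set x | address n x = k].

Lemma addressP n x y :
  address n x = address n y <->
  forall i, Num.floor (x 0 i * 2 ^+ n) = Num.floor (y 0 i * 2 ^+ n).
Proof.
split=> [[e0 e1 e2]|e]; first exact: ord3P.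
by rewrite /address !e.
Qed.

Lemma floor_eq_half (a b : R) :
  Num.floor (a * 2) = Num.floor (b * 2) -> Num.floor a = Num.floor b.
Proof.
have H (c : R) (k : int) : (k <= Num.floor c) = (k * 2 <= Num.floor (c * 2)).
  by rewrite !floor_ge_int intrM ler_pM2r.
by move=> e; apply: le_anti; rewrite H -e -H lexx /= H e -H lexx.
Qed.

Lemma address_coarser m n x y : (m <= n)%N ->
  address n x = address n y -> address m x = address m y.
Proof.
move=> /subnK <-; elim: (n - m)%N => [//|d IH].
rewrite addSn => /addressP e; apply: IH; apply/addressP => i.
by apply: floor_eq_half; rewrite -!mulrA -exprSr; exact: e.
Qed.

Lemma dist_address n x y i : address n x = address n y ->
  `|x 0 i - y 0 i| <= (2 ^+ n)^-1.
Proof.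
move=> /addressP/(_ i) e; set a := x 0 i * _ in e; set b := y 0 i * _ in e.
have p2 : 0 < 2 ^+ n :> R by rewrite exprn_gt0.
rewrite -(ler_pM2r p2) mulVf ?gt_eqF// -[X in _ * X](gtr0_norm p2) -normrM mulrBl.
rewrite -/a -/b; have /andP[a1 a2] := floor_itv a; have /andP[b1 b2] := floor_itv b.
rewrite intrD in a2; rewrite intrD in b2; rewrite e in a1 a2.
by rewrite ler_norml; apply/andP; split; lra.
Qed.

Lemma ball3P x y (e : R) : 0 < e ->
  ball x e y <-> forall i, `|x 0 i - y 0 i| < e.
Proof.
move=> e0; split=> [[_ H] i|H]; first exact: H.
by split => // i j; rewrite ord1; exact: H.
Qed.

Lemma normr_le3 x (e : R) : `|x| <= e <-> 0 <= e /\ forall i, `|x 0 i| <= e.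
Proof.
rewrite [X in X <= _](mx_normrE x : `|x| = _); split => [H|[e0 H]].
  split; first by rewrite (le_trans _ H)// (le_trans (normr_ge0 (x 0 0)))//; apply: (le_bigmax _ (fun ij => `|x ij.1 ij.2|) (0, 0)).
  by move=> i; apply: le_trans H; apply: (le_bigmax _ (fun ij => `|x ij.1 ij.2|) (0, i)).
by apply/bigmax_leP; split => // -[i j] _ /=; rewrite ord1.
Qed.

Lemma exists_expn2 (e : R) : 0 < e -> exists n, (2 ^+ n)^-1 < e.
Proof.
move=> e0; have [n _ H] := near_infty_natSinv_lt (PosNum e0).
exists n; apply: le_lt_trans (H n (leqnn n)).
rewrite /= lef_pV2 ?posrE ?exprn_gt0 ?ltr0Sn//.
by rewrite -natrX ler_nat ltn_expl.
Qed.

Lemma open_dcube (U : set 'rV[R]_3) x : open U -> U x ->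
  exists n0, forall n, (n0 <= n)%N -> dcube n (address n x) `<=` U.
Proof.
move=> oU Ux; have /nbhs_ballP[e /= e0 eU] := open_nbhs_nbhs (conj oU Ux).
have [n0 ne] := exists_expn2 e0; exists n0 => n n0n y ay; apply: eU.
apply/ball3P => // i; rewrite (le_lt_trans (dist_address i (esym ay)))//.
by rewrite (le_lt_trans _ ne)// lef_pV2 ?posrE ?exprn_gt0// ler_weXn2l ?ler1n.
Qed.

Definition dseg n (k : int) : set R := `[k%:~R / 2 ^+ n, (k + 1)%:~R / 2 ^+ n[%classic.

Lemma dcubeE n k : vec3 @^-1` dcube n k =
  (dseg n k.1.1 `*` dseg n k.1.2) `*` dseg n k.2.
Proof.
have H (a : R) (j : int) : Num.floor (a * 2 ^+ n) = j <-> dseg n j a.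
  have p2 : 0 < 2 ^+ n :> R by rewrite exprn_gt0.
  rewrite /dseg/= in_itv/= ler_pdivrMr// ltr_pdivlMr//; split => [<-|].
    exact: floor_itv.
  exact: floor_def.
apply/seteqP; split => -[[a b] c]; rewrite /dcube /address /= !mxE /=.
  by case: k => [[k1 k2] k3] [/H ? /H ? /H ?].
by case: k => [[k1 k2] k3] [[/= /H -> /H ->] /H ->].
Qed.

Lemma mu3_box (A B C : set (measurableTypeR R)) :
  measurable A -> measurable B -> measurable C ->
  mu3 ((A `*` B) `*` C) = (lebesgue_measure A * lebesgue_measure B * lebesgue_measure C)%E.
Proof.
move=> mA mB mC; rewrite /mu3 product_measure1E//; last exact: measurableX.
by congr (_ * _)%E; exact: product_measure1E.
Qed.

Lemma measurable_dcube n k : measurable (vec3 @^-1` dcube n k : set (T3 R)).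
Proof. by rewrite dcubeE; apply: measurableX; [apply: measurableX|]; exact: measurable_itv. Qed.

Lemma mu3_dcube n k : mu3 (vec3 @^-1` dcube n k) = (((2 ^+ n)^-1) ^+ 3)%:E.
Proof.
have p2 : 0 < 2 ^+ n :> R by rewrite exprn_gt0.
have H j : lebesgue_measure (dseg n j) = ((2 ^+ n)^-1)%:E.
  rewrite lebesgue_measure_itv/= lte_fin ltr_pM2r ?invr_gt0// ltr_int ltrDl ltr01.
  by rewrite -EFinD -mulrBl intrD addrC addKr mul1r.
rewrite dcubeE (mu3_box (measurable_itv _) (measurable_itv _) (measurable_itv _)) !H.
by rewrite -!EFinM exprSr expr2.
Qed.

(** An open set is the union of the dyadic cubes that it contains. *)
Lemma measurable_open3 (U : set 'rV[R]_3) : open U ->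
  measurable (vec3 @^-1` U : set (T3 R)).
Proof.
move=> oU; pose P (i : nat * (int * int * int)) := dcube i.1 i.2 `<=` U.
have -> : vec3 @^-1` U = \bigcup_i (if `[< P i >] then vec3 @^-1` dcube i.1 i.2 else set0).
  apply/seteqP; split => p /=.
    move=> /(open_dcube oU)[n /(_ n (leqnn n)) H].
    by exists (n, address n (vec3 p)) => //; rewrite asboolT.
  by move=> [i _]; case: asboolP => // /(_ (vec3 p)) H /H.
apply: countable_bigcupT_measurable => // i; case: asboolP => // _.
exact: measurable_dcube.
Qed.

Lemma measurable_closed3 (C : set 'rV[R]_3) : closed C ->
  measurable (vec3 @^-1` C : set (T3 R)).
Proof.
move=> cC; rewrite -[C]setCK -preimage_setC; apply: measurableC.
by apply: measurable_open3; exact: closed_openC.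
Qed.

Lemma mu3_open_gt0 (U : set 'rV[R]_3) : open U -> U !=set0 ->
  (0 < mu3 (vec3 @^-1` U))%E.
Proof.
move=> oU [x Ux]; have [n /(_ n (leqnn n)) H] := open_dcube oU Ux.
apply: (@lt_le_trans _ _ (mu3 (vec3 @^-1` dcube n (address n x)))).
  by rewrite mu3_dcube lte_fin exprn_gt0// invr_gt0 exprn_gt0.
apply: le_measure; rewrite ?inE; [exact: measurable_dcube|exact: measurable_open3|].
by move=> p; exact: H.
Qed.

End Dyadic.

(** * Regularity of finite Borel measures *)

Lemma preimage_setD (T U : Type) (f : T -> U) (A B : set U) :
  f @^-1` (A `\` B) = f @^-1` A `\` f @^-1` B.
Proof. by []. Qed.

Section Regularity.
Variable R : realType.
Implicit Types (x y : 'rV[R]_3) (E : set (T3 R)).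
Notation vec3 := (@vec3 R).

(** Continuity from above. *)
Lemma finite_measure_vanishing (m : {measure set (T3 R) -> \bar R})
    (D : nat -> set (T3 R)) (e : R) :
  (m setT < +oo)%E -> (forall n, measurable (D n)) ->
  {homo D : n k / (n <= k)%N >-> (k <= n)%O} -> \bigcap_n D n = set0 ->
  0 < e -> exists n, (m (D n) <= e%:E)%E.
Proof.
move=> moo mD decD D0 e0.
have D0oo : (m (D 0%N) < +oo)%E.
  by apply: le_lt_trans moo; apply: le_measure => //; rewrite inE.
have mI : measurable (\bigcap_n D n) by exact: bigcap_measurable.
have := nonincreasing_cvg_mu D0oo mD mI decD.
rewrite D0 measure0 => /fine_cvgP[_ /cvgrPdist_lt /(_ _ e0)][n _ H]; exists n.
have fD : m (D n) \is a fin_num.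
  rewrite ge0_fin_numE ?measure_ge0//; apply: le_lt_trans moo.
  by apply: le_measure => //; rewrite inE.
move: (H n (leqnn n)); rewrite /= sub0r normrN => /ltW.
by rewrite ger0_norm ?fine_ge0// -lee_fin fineK.
Qed.

Let approximable (m : {measure set (T3 R) -> \bar R}) E :=
  forall e : R, 0 < e -> exists C U : set 'rV[R]_3,
    [/\ closed C, open U, vec3 @^-1` C `<=` E, E `<=` vec3 @^-1` U
      & (m (vec3 @^-1` (U `\` C)) <= e%:E)%E].

Lemma coord3_continuous (i : 'I_3) : continuous (fun x : 'rV[R]_3 => x 0 i).
Proof. exact: coord_continuous. Qed.

(** The sets that can be approximated from inside by closed and from outside by
    open sets form a sigma-algebra, and half-spaces are such sets. *)
Lemma finite_measure_regular (m : {measure set (T3 R) -> \bar R}) :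
  (m setT < +oo)%E -> forall E, measurable E -> approximable m E.
Proof.
move=> moo; apply: halfspaces_generate_borel; first split.
- move=> e e0; exists set0, set0; rewrite setD0 preimage_set0 measure0 lee_fin ltW//.
  by split => //; do [exact: open0 | exact: closed0].
- move=> A hA e e0; have [C [U [cC oU CA AU me]]] := hA e e0.
  exists (~` U), (~` C); rewrite setTD setDE setCK setIC -setDE; split => //.
  + exact: open_closedC.
  + exact: closed_openC.
  + exact: subsetC.
  + exact: subsetC.
- move=> F hF e e0.
  have e20 : 0 < e / 2 by rewrite divr_gt0.
  have /choice[C /choice[U HU]] : forall n, exists C U : set 'rV[R]_3,
      [/\ closed C, open U, vec3 @^-1` C `<=` F n, F n `<=` vec3 @^-1` U
      & (m (vec3 @^-1` (U `\` C)) <= (e / 2 / (2 ^ n.+1)%:R)%:E)%E].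
    by move=> n; apply: hF; rewrite divr_gt0// ltr0n expn_gt0.
  (* a countable union of closed sets need not be closed: it is cut at an n
     beyond which little measure is left *)
  pose D n : set (T3 R) := vec3 @^-1` (\bigcup_k C k `\` \bigcup_(k < n) C k).
  have cn n : closed (\bigcup_(k < n) C k).
    by rewrite bigcup_mkord; apply: closed_bigsetU => i _; have [] := HU i.
  have mC k : measurable (vec3 @^-1` C k : set (T3 R)).
    by apply: measurable_closed3; have [] := HU k.
  have [n mDn] : exists n, (m (D n) <= (e / 2)%:E)%E.
    apply: finite_measure_vanishing => //.
    - move=> n; rewrite /D preimage_setD; apply: measurableD.
        by rewrite preimage_bigcup; exact: bigcup_measurable.
      exact: measurable_closed3.
    - move=> n k nk; apply/subsetPset => p [[i _ Ci] nC]; split; first by exists i.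
      by move=> [j /= jn Cj]; apply: nC; exists j => //=; exact: leq_trans nk.
    - apply/seteqP; split => // p Dp; have [[i _ Ci] _] := Dp 0%N I.
      by have [_] := Dp i.+1 I; apply; exists i => /=.
  exists (\bigcup_(k < n) C k), (\bigcup_k U k); split.
  + exact: cn.
  + by apply: bigcup_open => k _; have [] := HU k.
  + by move=> p [k _ Ck]; exists k => //; have [_ _ H _ _] := HU k; exact: H.
  + by move=> p [k _ Fk]; exists k => //; have [_ _ _ H _] := HU k; exact: H.
  + have mUC k : measurable (vec3 @^-1` (U k `\` C k) : set (T3 R)).
      rewrite preimage_setD; apply: measurableD => //.
      by apply: measurable_open3; have [] := HU k.
    have mD : measurable (D n).
      rewrite /D preimage_setD; apply: measurableD.
        by rewrite preimage_bigcup; exact: bigcup_measurable.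
      exact: measurable_closed3.
    have mB : measurable (\bigcup_k (vec3 @^-1` (U k `\` C k) : set (T3 R))).
      exact: bigcup_measurable.
    apply: (@le_trans _ _ (m (D n `|` \bigcup_k (vec3 @^-1` (U k `\` C k))))).
      apply: le_measure; rewrite ?inE.
      - rewrite preimage_setD; apply: measurableD.
          rewrite preimage_bigcup; apply: bigcup_measurable => k _.
          by apply: measurable_open3; have [] := HU k.
        exact: measurable_closed3.
      - exact: measurableU.
      - move=> p [[k _ Uk] nC]; have [Cp|nCp] := pselect ((\bigcup_k C k) (vec3 p)).
          by left; split.
        by right; exists k => //; split => // Ck; apply: nCp; exists k.
    apply: (le_trans (measureU2 _ _ _)) => //.
    rewrite [e in leRHS]splitr EFinD; apply: leeD => //.
    apply: (le_trans (measure_sigma_subadditive m mUC mB (@subset_refl _ _))).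
    apply: le_trans (@epsilon_trick0 R (e / 2) xpredT _); last exact: ltW.
    by apply: lee_nneseries => // k _; have [] := HU k.
- move=> i a e e0.
  (* the closed half-spaces x_i <= a - 1 / (n + 1) exhaust the open one *)
  pose D n := [set p : T3 R | a - n.+1%:R^-1 < vec3 p 0 i < a].
  have mD n : measurable (D n).
    have -> : D n = vec3 @^-1` ([set x | a - n.+1%:R^-1 < x 0 i] `&` [set x | x 0 i < a]).
      by apply/seteqP; split => p /= => [/andP[]|[p1 p2]]; [|apply/andP].
    apply: measurable_open3; apply: openI.
    - exact: (open_comp (fun x _ => @coord3_continuous i x) (@open_gt R _)).
    - exact: (open_comp (fun x _ => @coord3_continuous i x) (@open_lt R _)).
  have [||n mn] := finite_measure_vanishing moo mD _ _ e0.
  - move=> n k nk; apply/subsetPset => p /andP[h pa]; apply/andP; split=> //.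
    by apply: le_lt_trans h; rewrite lerD2l lerN2 lef_pV2 ?posrE ?ltr0Sn// ler_nat.
  - apply/seteqP; split => // p Dp.
    have /andP[_ pa] := Dp 0%N I.
    have h : 0 < a - vec3 p 0 i by rewrite subr_gt0.
    have [n _ H] := near_infty_natSinv_lt (PosNum h).
    have {}H : n.+1%:R^-1 < a - vec3 p 0 i := H n (leqnn n).
    by have /andP[+ _] := Dp n I; rewrite ltrBlDr -ltrBlDl => /lt_trans/(_ H); rewrite ltxx.
  - exists [set x | x 0 i <= a - n.+1%:R^-1], [set x | x 0 i < a]; split.
    + exact: (closed_comp (fun x _ => @coord3_continuous i x) (@closed_le R _)).
    + exact: (open_comp (fun x _ => @coord3_continuous i x) (@open_lt R _)).
    + by move=> p /= /le_lt_trans; apply; rewrite ltrBlDr ltrDl invr_gt0 ltr0Sn.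
    + by [].
    + apply: le_trans mn; apply: le_measure => //; rewrite ?inE//.
        rewrite preimage_setD; apply: measurableD.
          apply: measurable_open3.
          exact: (open_comp (fun x _ => @coord3_continuous i x) (@open_lt R _)).
        apply: measurable_closed3.
        exact: (closed_comp (fun x _ => @coord3_continuous i x) (@closed_le R _)).
      by move=> p [/= pa /negP]; rewrite -ltNge => qa; apply/andP.
Qed.

End Regularity.

(** * Null sets and their differentiable images *)

Section NullImage.
Variable R : realType.
Implicit Types (x y : 'rV[R]_3) (E : set 'rV[R]_3).
Notation vec3 := (@vec3 R).
Notation mu3 := (@mu3 R).

Definition null3 E : Prop := mu3.-negligible (vec3 @^-1` E : set (T3 R)).

Lemma ae3P (A : set 'rV[R]_3) (P : 'rV[R]_3 -> Prop) :
  ae3 A P <-> null3 [set x | A x /\ ~ P x].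
Proof.
rewrite /ae3 /almost_everywhere /null3.
rewrite (_ : [set x | A x /\ ~ P x] = ~` (fun x => A x -> P x))//.
apply/seteqP; split => x /=; first by move=> [Ax nP] /(_ Ax).
by move=> /not_implyP.
Qed.

Lemma null3_sub E E' : null3 E -> E' `<=` E -> null3 E'.
Proof. by move=> nE sE; apply: negligibleS nE => p; exact: sE. Qed.

Lemma null3U E E' : null3 E -> null3 E' -> null3 (E `|` E').
Proof. by move=> nE nE'; exact: negligibleU. Qed.

Lemma null3_bigcup (I : countType) (E : I -> set 'rV[R]_3) :
  (forall i, null3 (E i)) -> null3 (\bigcup_i E i).
Proof.
move=> nE; pose E' n := if pickle_inv n is Some i then E i else set0.
apply: (@null3_sub (\bigcup_n E' n)).
  rewrite /null3 preimage_bigcup; apply: negligible_bigcup => n.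
  rewrite /E'; case: pickle_inv => [i|]; first exact: nE.
  by rewrite preimage_set0; exact: negligible_set0.
by move=> x [i _ Ei]; exists (pickle i) => //; rewrite /E' pickleK_inv.
Qed.

Lemma null3_small E :
  (forall e : R, 0 < e -> exists B : set (T3 R),
    [/\ measurable B, vec3 @^-1` E `<=` B & (mu3 B <= e%:E)%E]) -> null3 E.
Proof.
move=> H.
have /choice[B HB] : forall n : nat, exists B : set (T3 R),
    [/\ measurable B, vec3 @^-1` E `<=` B & (mu3 B <= (n.+1%:R^-1)%:E)%E].
  by move=> n; apply: H; rewrite invr_gt0 ltr0Sn.
have mB : measurable (\bigcap_n B n).
  by apply: bigcap_measurable => // n _; have [] := HB n.
exists (\bigcap_n B n); split => //; last first.
  by move=> p Ep n _; have [_ + _] := HB n; exact.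
apply/eqP; rewrite eq_le measure_ge0 andbT; apply/lee_addgt0Pr => e e0.
rewrite add0e; have [n _ Hn] := near_infty_natSinv_lt (PosNum e0).
have [mBn _ Bn] := HB n.
apply: (@le_trans _ _ (mu3 (B n))).
  by apply: le_measure; rewrite ?inE// => p; exact.
by apply: (le_trans Bn); rewrite lee_fin ltW//; exact: Hn n (leqnn n).
Qed.

Definition cbox x (r : R) : set 'rV[R]_3 := [set y | forall i, `|y 0 i - x 0 i| <= r].

Lemma cboxE x r : vec3 @^-1` cbox x r =
  (`[x 0 0 - r, x 0 0 + r] `*` `[x 0 1 - r, x 0 1 + r]) `*`
  `[x 0 2%:R - r, x 0 2%:R + r].
Proof.
apply/seteqP; split => p.
  move=> H; have := H 0; have := H 1; have := H 2%:R.
  by rewrite !vec3E !ler_distl => h2 h1 h0; split; [split|]; rewrite /= in_itv.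
move=> [[/= h0 h1] h2]; move: h0 h1 h2; rewrite !in_itv/= => h0 h1 h2.
by apply: ord3P; rewrite vec3E ler_distl.
Qed.

Lemma measurable_cbox x r : measurable (vec3 @^-1` cbox x r : set (T3 R)).
Proof.
by rewrite cboxE; apply: measurableX; [apply: measurableX|]; exact: measurable_itv.
Qed.

Lemma mu3_cbox x r : 0 <= r -> mu3 (vec3 @^-1` cbox x r) = ((2 * r) ^+ 3)%:E.
Proof.
move=> r0; have H (a : R) : lebesgue_measure (`[a - r, a + r]%classic : set R) = (2 * r)%:E.
  rewrite lebesgue_measure_itv/= lte_fin; case: ifPn => h.
    by rewrite -EFinD; congr EFin; lra.
  congr EFin; lra.
rewrite cboxE (mu3_box (measurable_itv _) (measurable_itv _) (measurable_itv _)).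
by rewrite !H -!EFinM exprSr expr2.
Qed.

(** Regularity is applied to the restriction of the Lebesgue measure to a ball
    that contains E, which is a finite measure. *)
Lemma null3_open_cover E (N e : R) : 0 < e -> null3 E ->
  E `<=` cbox 0 N -> exists U : set 'rV[R]_3,
  [/\ open U, E `<=` U & (mu3 (vec3 @^-1` U) <= e%:E)%E].
Proof.
move=> e0 [B [mB B0 EB]] EN.
have oQ : open (ball (0 : 'rV[R]_3) (`|N| + 1)) by exact: ball_open.
have mQ : measurable (vec3 @^-1` ball (0 : 'rV[R]_3) (`|N| + 1) : set (T3 R)).
  exact: measurable_open3.
have N0 : 0 < `|N| + 1 by rewrite ltr_wpDl.
have foo : (mrestr mu3 mQ setT < +oo)%E.
  rewrite /mrestr setTI; apply: (@le_lt_trans _ _ (mu3 (vec3 @^-1` cbox 0 (`|N| + 1)))).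
    apply: le_measure; rewrite ?inE//; first exact: measurable_cbox.
    move=> p /= /ball3P H i; rewrite ltW// distrC; exact: H.
  by rewrite mu3_cbox ?ltry// ltW.
have [C [U [cC oU CB BU mUC]]] := finite_measure_regular foo mB e0.
exists (U `&` ball 0 (`|N| + 1)); split.
- exact: openI.
- move=> x Ex; split.
    by rewrite -[x]coords3K; apply: BU; apply: EB; rewrite /= coords3K.
  apply/ball3P => // i; rewrite distrC (le_lt_trans (EN _ Ex i))//.
  by rewrite (le_lt_trans (ler_norm N))// ltrDl.
- apply: (@le_trans _ _ (mu3 (B `|` (vec3 @^-1` (U `\` C) `&` vec3 @^-1` ball 0 (`|N| + 1))))).
    apply: le_measure; rewrite ?inE.
    + by apply: measurable_open3; exact: openI.
    + apply: measurableU => //; apply: measurableI => //.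
      rewrite preimage_setD; apply: measurableD.
        exact: measurable_open3.
      exact: measurable_closed3.
    + move=> p [Up bp]; have [Cp|nCp] := pselect (C (vec3 p)); last by right.
      by left; exact: CB.
  apply: (le_trans (measureU2 _ _ _)) => //.
    apply: measurableI => //; rewrite preimage_setD; apply: measurableD.
      exact: measurable_open3.
    exact: measurable_closed3.
  by rewrite [X in (X + _)%E]B0 add0e.
Qed.

(** Whitney-type covering: the maximal dyadic cubes of side at most
    2^(-n0) that lie in U and meet E are pairwise disjoint, so their total
    volume is at most that of U; a map that is C-Lipschitz at the points of E
    sends each of them into a cube whose volume is (2 C)^3 times larger. *)
Lemma image_small_cover (f : 'rV[R]_3 -> 'rV[R]_3) E (U : set 'rV[R]_3) (C d e : R) :
  0 < d -> 0 <= C -> open U -> E `<=` U -> (mu3 (vec3 @^-1` U) <= e%:E)%E ->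
  (forall x y, E x -> ball x d y -> `|f y - f x| <= C * `|y - x|) ->
  exists B : set (T3 R), [/\ measurable B, vec3 @^-1` (f @` E) `<=` B
    & (mu3 B <= ((2 * C) ^+ 3 * e)%:E)%E].
Proof.
move=> d0 C0 oU EU mU Ef.
have [n0 n0d] := exists_expn2 d0.
have small n x y : (n0 <= n)%N -> address n x = address n y ->
    `|y - x| <= (2 ^+ n)^-1 /\ ball x d y.
  move=> nn0 a; split.
    apply/normr_le3; split; first by rewrite invr_ge0 exprn_ge0.
    by move=> i; rewrite !mxE distrC; exact: dist_address.
  apply/ball3P => // i; rewrite (le_lt_trans (dist_address i a))//.
  by rewrite (le_lt_trans _ n0d)// lef_pV2 ?posrE ?exprn_gt0// ler_weXn2l ?ler1n.
(* the level of a selected cube is the first one, from n0 on, at which the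
   dyadic cube around the point c of E lies in U *)
pose selected (i : nat * (int * int * int)) c :=
  [/\ E c, address i.1 c = i.2, (n0 <= i.1)%N, dcube i.1 i.2 `<=` U
    & forall m, (n0 <= m < i.1)%N -> ~ (dcube m (address m c) `<=` U)].
have selectedP x : E x -> exists n, selected (n, address n x) x.
  move=> Ex; have [N HN] := open_dcube oU (EU x Ex).
  pose P n := (n0 <= n)%N && `[< dcube n (address n x) `<=` U >].
  have exP : exists n, P n.
    exists (maxn n0 N); rewrite /P leq_maxl/=; apply/asboolP/HN; exact: leq_maxr.
  have [n /andP[n0n /asboolP nU] minn] := ex_minnP exP.
  exists n; split => //= m /andP[n0m mn] mU'.
  have : (n <= m)%N by apply: minn; rewrite /P n0m; exact/asboolP.
  by rewrite leqNgt mn.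
(* if two selected cubes meet, the coarser one contains the finer one and lies
   in U, so that the finer one is not of the first level *)
have disj i j (p c c' : 'rV[R]_3) : selected i c -> selected j c' ->
    dcube i.1 i.2 p -> dcube j.1 j.2 p -> i = j.
  wlog ij : i j c c' / (i.1 <= j.1)%N.
    move=> H si sj pi pj; have [ij|/ltnW ji] := leqP i.1 j.1; first exact: (H i j c c').
    by apply/esym; exact: (H j i c' c).
  case: i j ij => [n k] [m l] /= nm [/= Ec ac n0n nU _] [/= Ec' ac' n0m mlU minm].
  rewrite /dcube /= => pn pm; move: nm; rewrite leq_eqVlt => /orP[/eqP nm|nm].
    by subst m; rewrite -pn pm.
  exfalso; apply: (minm n); first by rewrite n0n.
  move=> y; rewrite /dcube/= => yc; apply: nU; rewrite /dcube/= yc -pn.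
  by apply: (address_coarser (ltnW nm)); rewrite pm.
pose sel i := exists c, selected i c.
pose center i := get (selected i).
have centerP i : sel i -> selected i (center i) by move=> [c Hc]; exact: (getI Hc).
pose F j : set (T3 R) := if pickle_inv j is Some i then
  (if `[< sel i >] then vec3 @^-1` dcube i.1 i.2 else set0) else set0.
pose G j : set (T3 R) := if pickle_inv j is Some i then
  (if `[< sel i >] then vec3 @^-1` cbox (f (center i)) (C / 2 ^+ i.1) else set0)
  else set0.
have mF j : measurable (F j).
  rewrite /F; case: pickle_inv => [i|//]; case: asboolP => // _.
  exact: measurable_dcube.
have mG j : measurable (G j).
  rewrite /G; case: pickle_inv => [i|//]; case: asboolP => // _.
  exact: measurable_cbox.
have mu30 : mu3 set0 = 0%E by exact: measure0.
have mGF j : (mu3 (G j) = ((2 * C) ^+ 3)%:E * mu3 (F j))%E.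
  rewrite /G /F; case: pickle_inv => [i|]; last by rewrite mu30 mule0.
  case: asboolP => _; last by rewrite mu30 mule0.
  have p2 : 0 < 2 ^+ i.1 :> R by rewrite exprn_gt0.
  rewrite mu3_cbox ?mu3_dcube -?EFinM; last by rewrite divr_ge0// ltW.
  by rewrite -exprMn mulrA.
have tF : trivIset setT F.
  move=> j j' _ _ [p []]; rewrite /F.
  case ij: (pickle_inv j) => [i|//]; case: asboolP => // si pi.
  case ij': (pickle_inv j') => [i'|//]; case: asboolP => // si' pi'.
  have := disj _ _ _ _ _ (centerP _ si) (centerP _ si') pi pi'.
  move=> ii'; have := @pickle_invK (nat * (int * int * int))%type j.
  have := @pickle_invK (nat * (int * int * int))%type j'.
  by rewrite ij ij' /= ii' => -> ->.
exists (\bigcup_j G j); split.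
- exact: bigcup_measurable.
- move=> p [x Ex fx]; have [n sn] := selectedP x Ex.
  pose i : nat * (int * int * int) := (n, address n x).
  have si : sel i by exists x.
  have [_ ac n0n _ _] := centerP _ si.
  exists (pickle i) => //; rewrite /G pickleK_inv asboolT//= -fx => l.
  have [sm bl] := small _ _ _ n0n ac.
  have [Ec _ _ _ _] := centerP _ si.
  have := Ef _ _ Ec bl; move=> /normr_le3[_ /(_ l)]; rewrite !mxE => /le_trans; apply.
  by rewrite ler_wpM2l.
- apply: (@le_trans _ _ (\sum_(0 <= j <oo) mu3 (G j))%E).
    by apply: measure_sigma_subadditive => //; exact: bigcup_measurable.
  rewrite (eq_eseriesr (fun j _ => mGF j)) nneseriesZl//.
  rewrite [leRHS]EFinM; apply: lee_wpmul2l; first by rewrite lee_fin exprn_ge0// mulr_ge0.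
  rewrite -[X in (X <= _)%E]measure_semi_bigcup//; last exact: bigcup_measurable.
  apply: le_trans mU; apply: le_measure; rewrite ?inE.
  + exact: bigcup_measurable.
  + exact: measurable_open3.
  + move=> p [j _]; rewrite /F; case: pickle_inv => [i|//]; case: asboolP => // si.
    by have [_ _ _ + _] := centerP _ si; exact.
Qed.

(** A single constant serves as slope and as inverse radius, so that the points
    of differentiability are exhausted by countably many values of C. *)
Definition lipschitz_point (f : 'rV[R]_3 -> 'rV[R]_3) x (C : R) :=
  forall y, ball x C^-1 y -> `|f y - f x| <= C * `|y - x|.

Lemma differentiable_lipschitz_point (f : 'rV[R]_3 -> 'rV[R]_3) x :
  differentiable f x -> exists n : nat, lipschitz_point f x n.+1%:R.
Proof.
move=> df; have /diff_locallyP[cf] := df.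
move=> /eqaddoP/(_ 1 ltr01)/nbhs_ballP[d /= d0 fd].
have [k k0 Hk] := linear_lipschitz cf.
have M0 : 0 <= Num.max (k + 1) d^-1 by rewrite le_max addr_ge0//ltW.
have [n Hn] : exists n : nat, Num.max (k + 1) d^-1 <= n.+1%:R.
  exists (Num.truncn (Num.max (k + 1) d^-1)); apply/ltW.
  by have /andP[] := truncn_itv M0.
exists n => y xy.
have {xy} /fd : ball 0 d (y - x).
  move: Hn; rewrite ge_max => /andP[_ dn].
  move: xy; rewrite -!ball_normE /= sub0r normrN distrC => /lt_le_trans; apply.
  by rewrite invf_ple ?posrE ?ltr0Sn.
rewrite /= mul1r !fctE /= subrK opprD addrA => H.
apply: (@le_trans _ _ ((k + 1) * `|y - x|)); last first.
  by rewrite ler_wpM2r//; move: Hn; rewrite ge_max => /andP[].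
rewrite -(subrK ('d f x (y - x)) (f y - f x)) mulrDl mul1r addrC.
by rewrite (le_trans (ler_normD _ _))// lerD.
Qed.

(** Lusin's property (N). A map is Lipschitz at each point where it is
    differentiable, so E is a countable union of bounded pieces with uniform
    Lipschitz constants, and each piece has open neighbourhoods of small
    volume. *)
Lemma null3_image (f : 'rV[R]_3 -> 'rV[R]_3) E :
  (forall x, E x -> differentiable f x) -> null3 E -> null3 (f @` E).
Proof.
move=> df nE.
pose En n := [set x | [/\ E x, cbox 0 n%:R x & lipschitz_point f x n.+1%:R]].
apply: (@null3_sub (\bigcup_n (f @` En n))); last first.
  move=> _ [x Ex <-]; have [n Hn] := differentiable_lipschitz_point (df x Ex).
  pose N := maxn n (Num.truncn `|x|).+1; exists N => //; exists x => //; split => //.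
    move=> i; have /andP[_ xN] := truncn_itv (normr_ge0 x).
    have /normr_le3[_ /(_ i)] := lexx `|x|; rewrite mxE subr0 => /le_trans; apply.
    by apply: (le_trans (ltW xN)); rewrite ler_nat leq_maxr.
  have nN : n.+1%:R <= N.+1%:R :> R by rewrite ler_nat ltnS leq_maxl.
  move=> y xy; apply: (@le_trans _ _ (n.+1%:R * `|y - x|)); last exact: ler_wpM2r.
  apply: Hn; apply: le_ball xy.
  by rewrite lef_pV2 ?posrE ?ltr0Sn.
apply: null3_bigcup => n; apply: null3_small => e e0.
pose K : R := (2 * n.+1%:R) ^+ 3.
have K0 : 0 < K by rewrite exprn_gt0// mulr_gt0.
have nEn : null3 (En n) by apply: null3_sub nE _ => x [].
have EnN : En n `<=` cbox 0 n%:R by move=> x [].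
have [U [oU EU mU]] := null3_open_cover (divr_gt0 e0 K0) nEn EnN.
have [|||B [mB EB mBe]] := @image_small_cover f (En n) U n.+1%:R n.+1%:R^-1 (e / K) _ _ oU EU mU.
- by rewrite invr_gt0.
- by [].
- by move=> x y [_ _]; exact.
exists B; split => //.
by rewrite (le_trans mBe)// lee_fin mulrC divfK// gt_eqF.
Qed.

End NullImage.

(** * Integrals of partial derivatives *)

Section LineIntegrals.
Variable R : realType.
Implicit Types (x y v : 'rV[R]_3).

Lemma is_derive_line (f : 'rV[R]_3 -> R) x v (t : R) :
  derivable f (x + t *: v) v ->
  is_derive t (1 : R) (fun s : R => f (x + s *: v)) ('D_v f (x + t *: v)).
Proof.
move=> df.
have E : (fun h : R => h^-1 *: (((fun s : R => f (x + s *: v)) \o shift t) (h *: (1 : R))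
             - f (x + t *: v))) =
         (fun h : R => h^-1 *: ((f \o shift (x + t *: v)) (h *: v) - f (x + t *: v))).
  apply/funext => h /=; congr (_ *: (f _ - _)).
  by rewrite /shift /= -[h *: 1]/(h * 1) mulr1 scalerDl addrCA.
by apply: DeriveDef; rewrite /derivable /derive E.
Qed.

Lemma integral_derive_eq0 (h h' : R -> R) (N : R) : 0 <= N ->
  (forall t, is_derive t (1 : R) h (h' t)) -> continuous h' ->
  (forall t, N < `|t| -> h t = 0) -> (forall t, N < `|t| -> h' t = 0) ->
  (\int[@lebesgue_measure R]_t (h' t)%:E = 0)%E.
Proof.
move=> N0 dh ch' hN h'N; set M := N + 1.
(* both end points of [- M, M] lie outside the support of h *)
have M0 : 0 < M by rewrite /M ltr_wpDl.
have ch : continuous h.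
  move=> t; apply: differentiable_continuous; apply/derivable1_diffP.
  by have [] := dh t.
have -> : (fun t => (h' t)%:E) = (fun t => (h' t)%:E) \_ `[- M, M].
  apply/funext => t; rewrite patchE; case: ifPn => // /negP tM.
  rewrite h'N//; rewrite ltNge; apply/negP => tN; apply: tM.
  rewrite inE /= in_itv/= -ler_norml (le_trans tN)// /M lerDl//.
rewrite -integral_mkcond.
rewrite (@continuous_FTC2 R h' h).
- have MN : N < `|M| by rewrite gtr0_norm// /M ltrDl.
  by rewrite !hN ?normrN// subee.
- by rewrite gtrN.
- exact: continuous_subspaceT.
- split.
  + by move=> t _; have [] := dh t.
  + by apply: cvg_at_right_filter; exact: ch.
  + by apply: cvg_at_left_filter; exact: ch.
- by move=> t _; rewrite derive1E; have [] := dh t.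
Qed.

Lemma integrable_bounded_support d (T : measurableType d)
    (mu : {measure set T -> \bar R}) (f : T -> R) (B : set T) (K : R) :
  measurable B -> (mu B < +oo)%E -> measurable_fun setT f ->
  (forall z, `|f z| <= K) -> (forall z, ~ B z -> f z = 0) ->
  mu.-integrable setT (EFin \o f).
Proof.
move=> mB Boo mf fK fB.
have -> : EFin \o f = (EFin \o f) \_ B.
  apply/funext => x; rewrite patchE; case: ifPn => //= /negP xB.
  by rewrite fB// => Bx; apply: xB; rewrite inE.
apply/(integrable_mkcond (EFin \o f) mB).
apply: (@measurable_bounded_integrable _ _ _ mu f B mB Boo).
  exact: measurable_funTS.
exists K; split; first exact: num_real.
by move=> M KM x _ /=; rewrite (le_trans (fK x))// ltW.
Qed.

End LineIntegrals.

Section PlaneMeasure.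
Variable R : realType.

(** A named copy of the product measure, to carry the structure of a
    sigma-finite measure that Fubini's theorem on R^2 x R refers to. *)
Definition plane_measure : set (measurableTypeR R * measurableTypeR R) -> \bar R :=
  (@lebesgue_measure R \x @lebesgue_measure R)%E.

HB.instance Definition _ := Measure.copy plane_measure
  (@lebesgue_measure R \x @lebesgue_measure R)%E.

Lemma plane_measure_square (N : R) :
  (plane_measure (`[(- N)%R, N] `*` `[(- N)%R, N]) < +oo)%E.
Proof.
have e := @product_measure1E _ _ (measurableTypeR R) (measurableTypeR R) R
  lebesgue_measure lebesgue_measure _ _ (measurable_itv `[- N, N]) (measurable_itv `[- N, N]).
have l := @lebesgue_measure_itv R `[- N, N].
rewrite /plane_measure [X in (X < _)%E]e [X in (X * _)%E]l [X in (_ * X)%E]l/=.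
by case: ifPn => _; rewrite ?mule0// -EFinD -EFinM ltry.
Qed.

Let plane_measure_sigma_finite : sigma_finite setT plane_measure.
Proof.
pose F (n : nat) := `[- n%:R, n%:R]%classic : set (measurableTypeR R).
exists (fun n => F n `*` F n).
  apply/esym/seteqP; split => // -[a b] _.
  pose M := Num.max `|a| `|b|.
  have M0 : 0 <= M by rewrite le_max normr_ge0.
  have /andP[_ /ltW Mn] := truncn_itv M0.
  move: Mn; rewrite ge_max => /andP[an bn].
  by exists (Num.truncn M).+1 => //; split; rewrite /F /= in_itv/= -ler_norml.
move=> n; split; first by apply: measurableX; exact: measurable_itv.
exact: plane_measure_square.
Qed.

HB.instance Definition _ := @Measure_isSigmaFinite.Build _ _ _
  plane_measure plane_measure_sigma_finite.

End PlaneMeasure.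

Section SpaceIntegrals.
Variable R : realType.
Implicit Types (x y v : 'rV[R]_3).
Notation vec3 := (@vec3 R).
Notation mu3 := (@mu3 R).

Lemma continuous_open_preimage (D : set 'rV[R]_3) (f : 'rV[R]_3 -> R) (V : set R) :
  open D -> (forall x, D x -> {for x, continuous f}) -> open V ->
  open (D `&` f @^-1` V).
Proof.
move=> oD cf oV; rewrite openE => x [Dx Vx]; apply: filterI.
  exact: (open_nbhs_nbhs (conj oD Dx)).
by apply: (cf x Dx); exact: (open_nbhs_nbhs (conj oV Vx)).
Qed.

Lemma continuous_measurable3 (D : set 'rV[R]_3) (f : 'rV[R]_3 -> R) :
  open D -> (forall x, D x -> {for x, continuous f}) ->
  measurable_fun (vec3 @^-1` D : set (T3 R)) (f \o vec3 : T3 R -> measurableTypeR R).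
Proof.
move=> oD cf; apply: (measurability _ (measurable_realfun.RGenOpens.measurableE R)).
move=> _ [_ [a [b ->]] <-].
rewrite (_ : _ `&` _ = vec3 @^-1` (D `&` f @^-1` `]a, b[))//.
by apply: measurable_open3; apply: continuous_open_preimage => //; exact: interval_open.
Qed.

Lemma closed_cbox x (N : R) : closed (cbox x N).
Proof.
rewrite (_ : cbox x N = \bigcap_i [set y | `|y 0 i - x 0 i| <= N]).
  apply: closed_bigI => i _.
  have cn : continuous (fun y : 'rV[R]_3 => `|y 0 i - x 0 i|).
    move=> y; apply: (continuous_comp (f := fun y : 'rV[R]_3 => y 0 i - x 0 i) (g := Num.norm)).
      apply: (@continuousB _ _ _ (fun y : 'rV[R]_3 => y 0 i) (cst (x 0 i))).
        exact: coord3_continuous.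
      exact: cst_continuous.
    exact: norm_continuous.
  exact: (closed_comp (fun y _ => cn y) (@closed_le R N)).
by apply/seteqP; split => [y H i _|y H i]; [exact: H|exact: (H i I)].
Qed.

Lemma compact_cbox (a : 'rV[R]_3) (r : R) : compact (cbox a r).
Proof.
apply: bounded_closed_compact; last exact: closed_cbox.
exists (`|a| + `|r|); split; first exact: num_real.
move=> M HM x xa; apply/normr_le3; split; first by rewrite (le_trans _ (ltW HM))// addr_ge0.
move=> i; rewrite (le_trans _ (ltW HM))// -(subrK (a 0 i) (x 0 i)) addrC.
rewrite (le_trans (ler_normD _ _))// lerD//.
  by have /normr_le3[_] := lexx `|a|; exact.
by rewrite (le_trans (xa i))// ler_norm.
Qed.

Lemma compact_sub_cbox0 (K : set 'rV[R]_3) : compact K ->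
  exists2 N : R, 0 <= N & K `<=` cbox 0 N.
Proof.
move=> /compact_bounded[M [Mr HM]]; exists (`|M| + 1); first by rewrite addr_ge0.
move=> x Kx; have : `|x| <= `|M| + 1.
  by apply: HM => //; rewrite (le_lt_trans (ler_norm M))// ltrDl.
by move=> /normr_le3[_ H] i; rewrite mxE subr0; exact: H.
Qed.

Lemma continuous_bounded_cbox (f : 'rV[R]_3 -> R) (N : R) : continuous f ->
  exists K : R, forall x, cbox 0 N x -> `|f x| <= K.
Proof.
move=> cf.
have /compact_bounded[M [Mr HM]] : compact (f @` cbox 0 N).
  by apply: continuous_compact (@compact_cbox 0 N); exact: continuous_subspaceT.
exists (`|M| + 1) => x xN; apply: HM; last by exists x.
by rewrite (le_lt_trans (ler_norm M))// ltrDl.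
Qed.

Lemma continuous_support_bounded (g : 'rV[R]_3 -> R) (N : R) :
  continuous g -> (forall x, ~ cbox 0 N x -> g x = 0) ->
  exists K : R, forall x, `|g x| <= K.
Proof.
move=> /(continuous_bounded_cbox N)[K gK] gN; exists (Num.max K 0) => x.
have [/gK xK|/gN ->] := pselect (cbox 0 N x); first by rewrite le_max xK.
by rewrite normr0 le_max lexx orbT.
Qed.

Lemma integrable_continuous_support (g : 'rV[R]_3 -> R) (N : R) : 0 <= N ->
  continuous g -> (forall x, ~ cbox 0 N x -> g x = 0) ->
  mu3.-integrable setT (EFin \o (g \o vec3)).
Proof.
move=> N0 cg gN; have [K gK] := continuous_support_bounded cg gN.
apply: (@integrable_bounded_support R _ (T3 R) mu3 (g \o vec3) (vec3 @^-1` cbox 0 N) K).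
- exact: measurable_cbox.
- by rewrite [X in (X < _)%E](mu3_cbox 0 N0) ltry.
- rewrite -[setT]/(vec3 @^-1` setT); apply: continuous_measurable3.
    exact: openT.
  by move=> x _; exact: cg.
- by move=> p; exact: gK.
- by move=> p; exact: gN.
Qed.

(** By Fubini's theorem the integration can start along the i-th axis, where it
    yields the difference of two values of f outside its support. *)
Lemma integral_partial_eq0 (f : 'rV[R]_3 -> R) (i : 'I_3) (N : R) : 0 <= N ->
  (forall x, derivable f x (delta_mx 0 i)) -> continuous (partial i f) ->
  (forall x, ~ cbox 0 N x -> f x = 0) ->
  (\int[mu3]_p (partial i f (vec3 p))%:E = 0)%E.
Proof.
move=> N0 df cf fN.
have gN x : ~ cbox 0 N x -> partial i f x = 0.
  move=> xN; rewrite /partial (@near_eq_derive _ _ _ _ (cst 0)) ?derive_cst//.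
  have /open_nbhs_nbhs : open_nbhs x (~` cbox 0 N).
    by split => //; apply: closed_openC; exact: closed_cbox.
  by apply: filterS => y; exact: fN.
have ig := integrable_continuous_support N0 cf gN.
have [K gK] := continuous_support_bounded cf gN.
have mg : measurable_fun setT (partial i f \o vec3 : T3 R -> measurableTypeR R).
  rewrite -[setT]/(vec3 @^-1` setT); apply: continuous_measurable3.
    exact: openT.
  by move=> x _; exact: cf.
have line x : x 0 i = 0 ->
    (\int[@lebesgue_measure R]_t (partial i f (x + t *: delta_mx 0 i))%:E = 0)%E.
  move=> xi.
  have out t : N < `|t| -> ~ cbox 0 N (x + t *: delta_mx 0 i).
    move=> Nt /(_ i); rewrite !mxE !eqxx xi mulr1 add0r subr0; lra.
  apply: (@integral_derive_eq0 _ (fun t => f (x + t *: delta_mx 0 i)) _ N) => //.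
  - by move=> t; exact: is_derive_line.
  - move=> t; apply: (@continuous_comp _ _ _ (fun t : R => x + t *: delta_mx 0 i) (partial i f)); last exact: cf.
    apply: (@continuousD _ _ _ (cst x) (fun t : R => t *: delta_mx 0 i)).
      exact: cst_continuous.
    exact: scalel_continuous.
  - by move=> t /out; exact: fN.
  - by move=> t /out; exact: gN.
move: gN ig gK mg line cf; move: (partial i f) => g gN ig gK mg line cf.
have vecE (a b c a' b' c' : R) (j : 'I_3) (t : R) :
  a' = a + t * (j == 0)%:R -> b' = b + t * (j == 1)%:R -> c' = c + t * (j == 2%:R)%:R ->
  vec3 (a', b', c') = vec3 (a, b, c) + t *: delta_mx 0 j.
  by move=> ea eb ec; apply/rowP; apply: ord3P; rewrite [LHS]mxE /= !mxE/= ?eqxx/= eq_sym.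
(* the measure is a product over (R * R) * R: the first two axes are reached
   through an integral over a plane, the third one directly *)
have plane (c : R) : i = 0 \/ i = 1 ->
  (\int[(@lebesgue_measure R \x @lebesgue_measure R)]_q (g (vec3 (q, c)))%:E = 0)%E.
  move=> i01.
  have iq : (@lebesgue_measure R \x @lebesgue_measure R)%E.-integrable setT
      (EFin \o (fun q : measurableTypeR R * measurableTypeR R => g (vec3 (q, c)))).
    apply: (@integrable_bounded_support R _ (measurableTypeR R * measurableTypeR R)%type (@lebesgue_measure R \x @lebesgue_measure R)%E (fun q => g (vec3 (q, c))) (`[- N, N] `*` `[-N, N]) K).
    - by apply: measurableX; exact: measurable_itv.
    - exact: plane_measure_square.
    - apply: (measurableT_comp mg).
      exact: pair2_measurable.
    - by move=> q; exact: gK.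
    - move=> q qN; apply: gN => H; apply: qN; have := H 0; have := H 1.
      by rewrite !vec3E !mxE !subr0 !ler_norml => h1 h0; split; rewrite /= in_itv.
  case: i01 => i0; subst i.
  - rewrite -integral21_prod_meas1// integral0_eq// => b _.
    rewrite /fubini_G -[RHS](line (vec3 (0, b, c))) ?vec3E//.
    by apply: eq_integral => t _ /=; congr (g _)%:E; apply: vecE; rewrite ?mulr1 ?mulr0 ?add0r ?addr0.
  - rewrite -integral12_prod_meas1// integral0_eq// => a _.
    rewrite /fubini_F -[RHS](line (vec3 (a, 0, c))) ?vec3E//.
    by apply: eq_integral => t _ /=; congr (g _)%:E; apply: vecE; rewrite ?mulr1 ?mulr0 ?add0r ?addr0.
pose m2 : {sigma_finite_measure set _ -> \bar R} := @plane_measure R.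
pose m1 : {sigma_finite_measure set (measurableTypeR R) -> \bar R} := @lebesgue_measure R.
pose G (p : T3 R) := (g (vec3 p))%:E.
have iG : (m2 \x m1)%E.-integrable setT G by exact: ig.
have fub1 : (\int[mu3]_p (g (vec3 p))%:E = \int[m1]_c fubini_G m2 G c)%E.
  by rewrite (integral21_prod_meas1 iG).
have fub2 : (\int[mu3]_p (g (vec3 p))%:E = \int[m2]_q fubini_F m1 G q)%E.
  by rewrite (integral12_prod_meas1 iG).
move: line plane; elim/ord3P: i {df cf} => line plane.
- rewrite fub1 integral0_eq// => c _; apply: plane; by left.
- rewrite fub1 integral0_eq// => c _; apply: plane; by right.
- rewrite fub2 integral0_eq// => -[a b] _.
  rewrite /fubini_F -[RHS](line (vec3 (a, b, 0))) ?vec3E//.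
  by apply: eq_integral => t _ /=; congr (g _)%:E; apply: vecE; rewrite ?mulr1 ?mulr0 ?add0r ?addr0.
Qed.

End SpaceIntegrals.

(** * Smooth functions *)

Section Calculus.
Variables (R : realType) (V : normedModType R).
Implicit Types (f g : V -> R).

Lemma differentiable_comp1 (phi : R -> R) f x (d : R) :
  differentiable f x -> is_derive (f x) (1 : R) phi d ->
  differentiable (phi \o f) x.
Proof.
move=> df [dphi _]; apply: differentiable_comp => //.
exact/derivable1_diffP.
Qed.

Lemma derive_comp1 (phi : R -> R) f x v (d : R) :
  differentiable f x -> is_derive (f x) (1 : R) phi d ->
  'D_v (phi \o f) x = d * 'D_v f x.
Proof.
move=> df dphi; have dc := differentiable_comp1 df dphi.
case: dphi => dphi <-; rewrite (deriveE _ dc) (deriveE _ df) diff_comp//; last exact/derivable1_diffP.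
by rewrite /= diff1E/= ?derive1E 1?mulrC//; exact/derivable1_diffP.
Qed.

Lemma derive_mul f g x v : differentiable f x -> differentiable g x ->
  'D_v (fun y => f y * g y) x = f x * 'D_v g x + 'D_v f x * g x.
Proof.
move=> /diff_derivable df /diff_derivable dg.
by rewrite [LHS](deriveM (df v) (dg v)) [X in _ + X]mulrC.
Qed.

Lemma derive_add f g x v : differentiable f x -> differentiable g x ->
  'D_v (fun y => f y + g y) x = 'D_v f x + 'D_v g x.
Proof.
by move=> /diff_derivable df /diff_derivable dg; rewrite [LHS](deriveD (df v) (dg v)).
Qed.

End Calculus.

Section FlatExponential.
Variable R : realType.

(** (s / n)^n <= (1 + s / n)^n <= exp s. *)
Lemma expn_expRN_le (n : nat) (s : R) : 0 <= s ->
  s ^+ n * expR (- s) <= n%:R ^+ n.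
Proof.
move=> s0; case: n => [|n].
  by rewrite !expr0 mul1r -expR0 ler_expR oppr_le0.
have n0 : 0 < n.+1%:R :> R by rewrite ltr0Sn.
have : (s / n.+1%:R) ^+ n.+1 <= expR s.
  rewrite -[s in leRHS](divfK (lt0r_neq0 n0)) (mulrC (s / _)) expRM_natl.
  rewrite lerXn2r ?nnegrE ?divr_ge0 ?expR_ge0//.
  by rewrite (le_trans _ (expR_ge1Dx _))// lerDr.
rewrite expr_div_n ler_pdivrMr ?exprn_gt0// => H.
by rewrite expRN ler_pdivrMr ?expR_gt0// mulrC.
Qed.

Lemma poly_expRN_bounded (P : {poly R}) :
  exists C : R, forall s, 0 <= s -> `|P.[s]| * expR (- s) <= C.
Proof.
exists (\sum_(i < size P) `|P`_i| * i%:R ^+ i) => s s0.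
rewrite horner_coef (le_trans (ler_wpM2r (expR_ge0 _) (ler_norm_sum _ _ _)))//.
rewrite mulr_suml; apply: ler_sum => i _.
by rewrite normrM -mulrA ler_wpM2l// normrX ger0_norm// expn_expRN_le.
Qed.

(** The functions P(1/t) exp(-1/t), extended by 0 for t <= 0. This family
    contains the classical flat function (P = 1) and is closed under
    differentiation. *)
Definition flat (P : {poly R}) (t : R) : R :=
  if 0 < t then P.[t^-1] * expR (- t^-1) else 0.

(** The factor X^2 is the derivative of - 1 / t, and P - P' comes from the product
    rule. *)
Definition flat_deriv (P : {poly R}) : {poly R} := 'X^2 * (P - P^`()).

(** The delicate point is 0, where the difference quotient is at most h times
    the bounded function s^2 |P(s)| exp(-s) at s = 1 / h. *)
Lemma is_derive_flat (P : {poly R}) (t : R) :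
  is_derive t (1 : R) (flat P) (flat (flat_deriv P) t).
Proof.
have [t0|t0|t0] := ltgtP t 0.
- have -> : flat (flat_deriv P) t = 0 by rewrite /flat ltNge (ltW t0).
  have H : {near t, cst 0 =1 flat P}.
    near=> s; rewrite /flat /cst ltNge (ltW (_ : s < 0))//.
    by near: s; exact: lt_nbhsl.
  exact: (near_eq_is_derive H (is_derive_cst _ _ _)).
- rewrite /flat t0.
  have tn0 : t != 0 by rewrite gt_eqF.
  have H : {near t, (fun s : R => (horner P \o GRing.inv) s * (expR \o (fun s : R => - s^-1)) s) =1 flat P}.
    near=> s; rewrite /flat ifT//=.
    by near: s; exact: lt_nbhsr.
  apply: (near_eq_is_derive H).
  have dV : is_derive t (1 : R) (fun s : R => s^-1) (- t ^- 2).
    have := @is_deriveV R id t 1 1 tn0 (is_derive_id _ _).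
    by rewrite /= -[X in is_derive _ _ _ X]/(_ * _) mulr1.
  have d1 := is_derive1_comp (is_derive_poly P t^-1) dV.
  have dN : is_derive t (1 : R) (fun s : R => - s^-1) (- - t ^- 2) := is_deriveN dV.
  have d2 := @is_derive1_comp R expR (fun s : R => - s^-1) t _ _ (is_derive_expR _) dN.
  apply: is_derive_eq (is_deriveM d1 d2) _.
  rewrite /flat_deriv !hornerE /=.
  rewrite -[_ *: _]/(_ * _) -[X in _ + X]/(_ * _) -exprVn. ring.
- subst t; have -> : flat (flat_deriv P) 0 = 0 by rewrite /flat ltxx.
  have [C HC] := poly_expRN_bounded ('X^2 * P).
  have cv : h^-1 *: ((flat P \o shift 0) (h *: (1 : R)) - flat P 0) @[h --> 0^'] --> (0 : R).
    have C0 : 0 <= C by apply: le_trans (HC 0 (lexx _)); rewrite mulr_ge0// expR_ge0.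
    apply/cvgr0Pnorm_lt => e e0.
    near=> h.
    have hn0 : h != 0 by near: h; exact: nbhs_dnbhs_neq.
    have he : `|h| < e / (C + 1).
      near: h; apply: dnbhs0_lt; rewrite divr_gt0// ltr_wpDl//.
    rewrite /= /shift /= /flat ltxx subr0 addr0 -![_ *: _]/(_ * _) mulr1.
    case: ifPn => h0; last by rewrite mulr0 normr0.
    have s0 : 0 <= h^-1 by rewrite invr_ge0 ltW.
    have := HC _ s0; rewrite !hornerE normrM [`|_ ^+ 2|]ger0_norm ?exprn_ge0//.
    move=> H; rewrite !normrM (ger0_norm s0) (ger0_norm (expR_ge0 _)).
    rewrite gtr0_norm// in he.
    have -> : h^-1 * `|P.[h^-1]| * expR (- h^-1) = h * (h^-1 ^+ 2 * `|P.[h^-1]| * expR (- h^-1)).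
      by field.
    apply: (@le_lt_trans _ _ (h * C)); first by rewrite ler_wpM2l// ltW.
    rewrite ltr_pdivlMr in he; last by rewrite ltr_wpDl.
    apply: le_lt_trans he; rewrite ler_wpM2l ?(ltW h0)// lerDl//.
  apply: DeriveDef.
    by apply/cvg_ex; exists 0.
  exact: (cvg_lim _ cv).
Unshelve. all: by end_near. Qed.

End FlatExponential.

Section Smooth.
Variable R : realType.
Implicit Types (f g : 'rV[R]_3 -> R).

Definition smooth f := forall m, Cn m f.

Lemma Cn_continuous m f : Cn m f -> continuous f.
Proof.
case: m => [//|m] [df _] x.
exact: differentiable_continuous.
Qed.

Lemma Cn_pred m f : Cn m.+1 f -> Cn m f.
Proof.
elim: m f => [|m IH] f; first by move=> H; exact: (Cn_continuous H).
by move=> [df Cf]; split => // i; apply: IH; exact: Cf.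
Qed.

Lemma Cn_cst m (c : R) : Cn m (fun=> c).
Proof.
elim: m c => [|m IH] c; first exact: cst_continuous.
split; first by move=> x; exact: differentiable_cst.
by move=> i; rewrite (_ : partial i _ = fun=> 0)//; apply/funext => x; exact: derive_cst.
Qed.

Lemma CnD m f g : Cn m f -> Cn m g -> Cn m (fun x => f x + g x).
Proof.
elim: m f g => [|m IH] f g; first by move=> cf cg x; apply: continuousD; [exact: cf|exact: cg].
move=> [df Cf] [dg Cg]; split; first by move=> x; exact: differentiableD.
move=> i; rewrite (_ : partial i _ = fun x => partial i f x + partial i g x).
  by apply: IH; [exact: Cf|exact: Cg].
by apply/funext => x; exact: derive_add.
Qed.

Lemma CnM m f g : Cn m f -> Cn m g -> Cn m (fun x => f x * g x).
Proof.
elim: m f g => [|m IH] f g; first by move=> cf cg x; apply: continuousM; [exact: cf|exact: cg].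
move=> /[dup] /Cn_pred Cmf [df Cf] /[dup] /Cn_pred Cmg [dg Cg].
split; first by move=> x; exact: differentiableM.
move=> i; rewrite (_ : partial i _ = fun x => f x * partial i g x + partial i f x * g x).
  by apply: CnD; apply: IH => //; [exact: Cg|exact: Cf].
by apply/funext => x; exact: derive_mul.
Qed.

Lemma partial_coord (i j : 'I_3) (x : 'rV[R]_3) :
  partial i (fun y : 'rV[R]_3 => y 0 j) x = (i == j)%:R.
Proof.
rewrite /partial deriveE; last exact: differentiable_coord.
have @f : {linear 'rV[R]_3 -> R}.
  by exists (fun N : 'rV[R]_3 => N 0 j); do 2![eexists]; do ?[constructor];
     rewrite ?mxE// => ? *; rewrite ?mxE//; move=> ?; rewrite !mxE.
rewrite (_ : (fun _ => _) = f) //; rewrite diff_lin; last exact: coord_continuous.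
by rewrite /f /= mxE eqxx eq_sym.
Qed.

Lemma Cn_coord m (j : 'I_3) : Cn m (fun y : 'rV[R]_3 => y 0 j).
Proof.
case: m => [|m]; first exact: coord_continuous.
split; first by move=> x; exact: differentiable_coord.
move=> i; rewrite (_ : partial i _ = fun=> (i == j)%:R); first exact: Cn_cst.
by apply/funext => x; exact: partial_coord.
Qed.

(** Each function of the chain F is the derivative of the previous one; the
    exponential and the flat functions start such chains. *)
Lemma Cn_comp (F : nat -> R -> R) : (forall k t, is_derive t (1 : R) (F k) (F k.+1 t)) ->
  forall m k f, Cn m f -> Cn m (F k \o f).
Proof.
move=> dF; have cF k : continuous (F k).
  move=> t; apply: differentiable_continuous; apply/derivable1_diffP.
  by have [] := dF k t.
elim=> [|m IH] k f; first by move=> cf x; apply: continuous_comp; [exact: cf|exact: cF].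
move=> /[dup] /Cn_pred Cmf [df Cf]; split.
  by move=> x; exact: (differentiable_comp1 (df x) (dF k (f x))).
move=> i; rewrite (_ : partial i _ = fun x => (F k.+1 \o f) x * partial i f x).
  by apply: CnM; [exact: IH|exact: Cf].
by apply/funext => x; exact: (derive_comp1 _ (df x) (dF k (f x))).
Qed.

Lemma smooth_expR f : smooth f -> smooth (fun x => expR (f x)).
Proof.
by move=> sf m; apply: (@Cn_comp (fun=> expR) _ m 0%N f (sf m)).
Qed.

Lemma smooth_flat f : smooth f -> smooth (fun x => flat 1 (f x)).
Proof.
move=> sf m; apply: (@Cn_comp (fun k => flat (iter k (@flat_deriv R) 1)) _ m 0%N f (sf m)).
by move=> k t; exact: is_derive_flat.
Qed.

Lemma flat1_gt0 (t : R) : (0 < flat 1 t) = (0 < t).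
Proof. by rewrite /flat; case: ifPn => // _; rewrite ?ltxx// hornerE mul1r expR_gt0. Qed.

Lemma flat1_ge0 (t : R) : 0 <= flat 1 t.
Proof. by rewrite /flat; case: ifPn => // _; rewrite hornerE mul1r expR_ge0. Qed.

Lemma smooth_cst (c : R) : smooth (fun=> c).
Proof. by move=> m; exact: Cn_cst. Qed.

Lemma smoothD f g : smooth f -> smooth g -> smooth (fun x => f x + g x).
Proof. by move=> sf sg m; exact: CnD. Qed.

Lemma smoothM f g : smooth f -> smooth g -> smooth (fun x => f x * g x).
Proof. by move=> sf sg m; exact: CnM. Qed.

Lemma smooth_coord (i : 'I_3) : smooth (fun x : 'rV[R]_3 => x 0 i).
Proof. by move=> m; exact: Cn_coord. Qed.

Lemma smooth_prod (F : 'I_3 -> 'rV[R]_3 -> R) :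
  (forall i, smooth (F i)) -> smooth (fun x => \prod_i F i x).
Proof.
move=> sF; rewrite (_ : (fun _ => _) = fun x => F ord0 x * (F (lift ord0 ord0) x * F (lift ord0 (lift ord0 ord0)) x)).
  by do 2 (apply: smoothM => //).
by apply/funext => x; rewrite !big_ord_recl big_ord0 mulr1.
Qed.

(** A smooth function that is positive exactly on the open cube of radius r
    around a. *)
Definition cube_bump (a : 'rV[R]_3) (r : R) (x : 'rV[R]_3) : R :=
  \prod_i (flat 1 (x 0 i + (r - a 0 i)) * flat 1 (- 1 * x 0 i + (r + a 0 i))).

Lemma smooth_cube_bump a r : smooth (cube_bump a r).
Proof.
apply: smooth_prod => i; apply: smoothM; apply: smooth_flat; apply: smoothD;
  try exact: smooth_cst; first exact: smooth_coord.
by apply: smoothM; [exact: smooth_cst|exact: smooth_coord].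
Qed.

Lemma cube_bump_gt0 (a : 'rV[R]_3) (r : R) (x : 'rV[R]_3) : (forall i, `|x 0 i - a 0 i| < r) -> 0 < cube_bump a r x.
Proof.
move=> H; apply: prodr_gt0 => i _; have := H i; rewrite ltr_norml => /andP[h1 h2].
by rewrite mulr_gt0// flat1_gt0; lra.
Qed.

Lemma cube_bump_eq0 a r x : ~ cbox a r x -> cube_bump a r x = 0.
Proof.
move=> /existsNP[i /negP]; rewrite -ltNge => H.
rewrite /cube_bump (bigD1 i)//=.
have -> : flat 1 (x 0 i + (r - a 0 i)) * flat 1 (- 1 * x 0 i + (r + a 0 i)) = 0; last by rewrite mul0r.
apply/eqP; rewrite mulf_eq0; apply/orP.
have H' (t : R) : t <= 0 -> flat 1 t = 0 by rewrite /flat leNgt => /negbTE ->.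
move: H; rewrite ltNge ler_norml negb_and -!ltNge => /orP[h|h].
  by left; apply/eqP/H'; lra.
by right; apply/eqP/H'; lra.
Qed.

End Smooth.

(** * The fundamental lemma of the calculus of variations *)

(** The sets on which h has integral zero form a Dynkin system. *)
Lemma ae_eq0_pi_system d (T : measurableType d) (R : realType)
    (mu : {measure set T -> \bar R}) (h : T -> \bar R) (G : set (set T)) :
  mu.-integrable setT h -> setI_closed G -> G setT ->
  (forall A, G A -> measurable A) -> (forall A, measurable A -> <<s G >> A) ->
  (forall A, G A -> (\int[mu]_(x in A) h x = 0)%E) ->
  ae_eq mu setT h (cst 0%E).
Proof.
move=> ih GI GT Gm mG hG.
have /integrableP[mh _] := ih.
have key A : measurable A -> measurable A /\ (\int[mu]_(x in A) h x = 0)%E.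
  move=> /mG; apply: (@lambda_system_subset _ _ GI setT
    [set A | measurable A /\ (\int[mu]_(x in A) h x = 0)%E]) => //.
  - apply/dynkin_lambda_system; split.
    + by split => //; exact: hG.
    + move=> B [mB B0]; split; first exact: measurableC.
      have : (\int[mu]_(x in B `|` ~` B) h x = 0)%E by rewrite setUv; exact: hG.
      rewrite integral_setU ?B0 ?add0e//; first exact: measurableC.
        by rewrite setUv.
      by apply/disj_setPCl.
    + move=> F tF HF; split; first by apply: bigcup_measurable => i _; have [] := HF i.
      rewrite integral_bigcup//.
      * by apply: eseries0 => i _ _; have [] := HF i.
      * by move=> k; have [] := HF k.
      * apply: integrableS ih => //.
        by apply: bigcup_measurable => i _; have [] := HF i.
  - by move=> B GB; split; [exact: Gm|exact: hG].
apply: integral_ae_eq => //.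
by move=> E _ mE; rewrite integral0; have [] := key E mE.
Qed.

Section FundamentalLemma.
Variable R : realType.
Implicit Types (x : 'rV[R]_3) (W : set 'rV[R]_3).
Notation vec3 := (@vec3 R).
Notation mu3 := (@mu3 R).

(** A pi-system that generates the Borel sets and whose indicators are limits of
    smooth functions, namely of 1 - exp(- n b). *)
Definition positivity_sets : set (set (T3 R)) :=
  [set A | exists b : 'rV[R]_3 -> R, [/\ smooth b, (forall x, 0 <= b x)
    & A = [set p | 0 < b (vec3 p)]]].

Lemma positivity_setsI : setI_closed positivity_sets.
Proof.
move=> _ _ [b [sb b0 ->]] [c [sc c0 ->]]; exists (fun x => b x * c x); split.
- exact: smoothM.
- by move=> x; exact: mulr_ge0.
apply/seteqP; split => p /=; first by move=> [? ?]; exact: mulr_gt0.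
move=> bc; split; rewrite lt_neqAle ?b0 ?c0 andbT eq_sym; apply/negP => /eqP e;
  by move: bc; rewrite e ?mul0r ?mulr0 ltxx.
Qed.

Lemma smooth_continuous (b : 'rV[R]_3 -> R) : smooth b -> continuous b.
Proof. by move=> /(_ 0%N). Qed.

Lemma positivity_sets_measurable A : positivity_sets A -> measurable A.
Proof.
move=> [b [/smooth_continuous cb _ ->]].
rewrite (_ : [set p | _] = vec3 @^-1` (setT `&` b @^-1` [set t | 0 < t])); last by rewrite setTI.
apply: measurable_open3; apply: continuous_open_preimage.
- exact: openT.
- by move=> x _; exact: cb.
- exact: open_gt.
Qed.

Lemma positivity_sets_generate A : measurable A -> <<s positivity_sets >> A.
Proof.
apply: halfspaces_generate_borel; first exact: smallest_sigma_algebra.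
move=> i a; apply: sub_sigma_algebra.
exists (fun x => flat 1 (-1 * x 0 i + a)); split.
- apply: smooth_flat; apply: smoothD; last exact: smooth_cst.
  by apply: smoothM; [exact: smooth_cst|exact: smooth_coord].
- by move=> x; exact: flat1_ge0.
- by apply/seteqP; split => p /=; rewrite flat1_gt0; lra.
Qed.

Lemma test_fun_bump W (a : 'rV[R]_3) (r : R) (c : 'rV[R]_3 -> R) :
  cbox a r `<=` W -> smooth c -> test_fun W (fun x => cube_bump a r x * c x).
Proof.
move=> aW sc; split; first by apply: smoothM => //; exact: smooth_cube_bump.
exists (cbox a r); split => //; last by move=> x /cube_bump_eq0 ->; rewrite mul0r.
exact: compact_cbox.
Qed.

(** On a small cube in W, the product of d with a bump is integrable and
    orthogonal to the smooth functions, hence by dominated convergence to the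
    indicators of a generating pi-system. *)
Lemma du_bois_reymond W (d : 'rV[R]_3 -> R) : open W ->
  (forall psi, test_fun W psi ->
     mu3.-integrable setT (fun p => (d (vec3 p) * psi (vec3 p))%:E)) ->
  (forall psi, test_fun W psi ->
     (\int[mu3]_p (d (vec3 p) * psi (vec3 p))%:E = 0)%E) ->
  null3 [set x : 'rV[R]_3 | W x /\ d x <> 0].
Proof.
move=> oW id0 d0.
have local (a : 'rV[R]_3) r : cbox a r `<=` W ->
    null3 [set x : 'rV[R]_3 | (forall i, `|x 0 i - a 0 i| < r) /\ d x <> 0].
  move=> aW; pose h (p : T3 R) := (d (vec3 p) * cube_bump a r (vec3 p))%:E.
  have T1 : test_fun W (cube_bump a r).
    have := test_fun_bump aW (smooth_cst 1).
    by rewrite (_ : (fun x => _ * 1) = cube_bump a r)//; apply/funext => x; rewrite mulr1.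
  have ih : mu3.-integrable setT h := id0 _ T1.
  have [||||A [mA muA HA]] := ae_eq0_pi_system ih positivity_setsI.
  - exists (fun=> 1); split => //; first exact: smooth_cst.
    by apply/seteqP; split => p //= _; rewrite ltr01.
  - exact: positivity_sets_measurable.
  - exact: positivity_sets_generate.
  - move=> _ [b [sb b0 ->]].
    pose e (n : nat) x := 1 + -1 * expR (n%:R * (-1 * b x)).
    have se n : smooth (e n).
      apply: smoothD; first exact: smooth_cst.
      apply: smoothM; first exact: smooth_cst.
      apply: smooth_expR; apply: smoothM; first exact: smooth_cst.
      by apply: smoothM => //; exact: smooth_cst.
    have e01 n x : 0 <= e n x <= 1.
      rewrite /e mulN1r subr_ge0 gerBl expR_ge0 andbT -[leRHS]expR0 ler_expR.
      by rewrite ?mulN1r mulrN oppr_le0 mulr_ge0.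
    pose hn n (p : T3 R) := (d (vec3 p) * (cube_bump a r (vec3 p) * e n (vec3 p)))%:E.
    have hn0 n : (\int[mu3]_p hn n p = 0)%E by exact: (d0 _ (test_fun_bump aW (se n))).
    have ihn n : mu3.-integrable setT (hn n) by exact: (id0 _ (test_fun_bump aW (se n))).
    have mB : measurable [set p : T3 R | 0 < b (vec3 p)].
      by apply: positivity_sets_measurable; exists b.
    have cv p : hn n p @[n --> \oo] --> (h \_ [set p | 0 < b (vec3 p)]) p.
      rewrite patchE; case: ifPn => [|/negP] bp.
        rewrite inE/= in bp.
        apply: cvg_EFin; first by near=> n.
        rewrite (_ : fine \o _ = fun n => d (vec3 p) * (cube_bump a r (vec3 p) * (1 + -1 * expR (-1 * b (vec3 p)) ^+ n))); last first.
          by apply/funext => n; rewrite /= /e expRM_natl.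
        rewrite -[X in _ --> d _ * X]mulr1.
        apply: cvgMr; apply: cvgMr.
        rewrite -[X in _ --> X]addr0; apply: cvgD; first exact: cvg_cst.
        rewrite -[X in _ --> X](mulr0 (-1)); apply: cvgMr.
        apply: cvg_expr; rewrite ger0_norm ?expR_ge0//.
        by rewrite -[ltRHS]expR0 ltr_expR mulN1r oppr_lt0.
      have bp0 : b (vec3 p) = 0.
        apply/eqP; rewrite eq_le b0 andbT leNgt; apply/negP => H; apply: bp.
        by rewrite inE.
      rewrite (_ : (fun n => hn n p) = cst 0%E); first exact: cvg_cst.
      by apply/funext => n; rewrite /hn /e bp0 !mulr0 expR0 mulr1 subrr !mulr0.
    have ihB : mu3.-integrable [set p : T3 R | 0 < b (vec3 p)] h by apply: integrableS ih.
    have /integrableP[mlim _] := (integrable_mkcond h mB).1 ihB.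
    have iabs : mu3.-integrable setT (fun p => `|h p|%E) by exact: integrable_abse.
    have [|||||_ _ lim] := @dominated_convergence _ _ _ mu3 setT measurableT hn
      (h \_ [set p | 0 < b (vec3 p)]) (fun p => `|h p|%E).
    + by move=> n; have /integrableP[] := ihn n.
    + exact: mlim.
    + by apply: aeW => p _; exact: cv.
    + exact: iabs.
    + apply: aeW => p n _; rewrite /hn /h !abse_EFin lee_fin mulrA normrM.
      have /andP[e0 e1] := e01 n (vec3 p).
      by rewrite (ger0_norm e0) ler_piMr.
    rewrite integral_mkcond.
    have lim0 : (fun n => \int[mu3]_x hn n x)%E @ \oo --> 0%E.
      by rewrite (_ : (fun n => _) = cst 0%E); [exact: cvg_cst|apply/funext].
    by apply: (cvg_unique _ lim lim0).
  exists A; split => // p [/= pa dp]; apply: HA => /= /(_ I) /eqP.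
  by rewrite eqe mulf_eq0 (gt_eqF (cube_bump_gt0 pa)) orbF => /eqP.
(* W is covered by countably many such cubes: those centred at one point of each
   dyadic cube, with half-side twice the dyadic side *)
pose E (i : nat * (int * int * int)) : set 'rV[R]_3 :=
  let a := get (dcube i.1 i.2) in let r := 2 * (2 ^+ i.1)^-1 in
  if `[< cbox a r `<=` W >] then [set x : 'rV[R]_3 | (forall i, `|x 0 i - a 0 i| < r) /\ d x <> 0]
  else set0.
apply: (@null3_sub _ (\bigcup_i E i)).
  apply: null3_bigcup => i; rewrite /E; case: asboolP => [/local//|_].
  by rewrite /null3 preimage_set0; exact: negligible_set0.
move=> x [Wx dx].
have /nbhs_ballP[e /= e0 eW] := open_nbhs_nbhs (conj oW Wx).
have [n ne] := exists_expn2 (divr_gt0 e0 (ltr0Sn R 2)).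
exists (n, address n x) => //; rewrite /E /=.
set a := get _; have an : address n a = address n x.
  by apply: (@getI _ (dcube n (address n x)) x).
have xa i : `|x 0 i - a 0 i| <= (2 ^+ n)^-1 by apply: dist_address.
have p0 : 0 < (2 ^+ n)^-1 :> R by rewrite invr_gt0 exprn_gt0.
rewrite asboolT; last first.
  move=> y ya; apply: eW; apply/ball3P => // i.
  have := ya i; have := xa i; rewrite (distrC (y 0 i)) => h1 h2.
  rewrite -(subrKA (a 0 i)) (le_lt_trans (ler_normD _ _))//; lra.
by split => // i; rewrite (le_lt_trans (xa i))//; lra.
Unshelve. all: by end_near. Qed.

End FundamentalLemma.

(** * C1 functions on open sets *)

Section C1Functions.
Variable R : realType.
Implicit Types (f g : 'rV[R]_3 -> R) (H : 'rV[R]_3 -> 'rV[R]_3) (U : set 'rV[R]_3).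

Definition C1_fun U f : Prop := forall x, U x ->
  differentiable f x /\ forall i, {for x, continuous (partial i f)}.

Lemma open_near_continuous U f g x : open U -> U x ->
  (forall y, U y -> f y = g y) -> {for x, continuous g} -> {for x, continuous f}.
Proof.
move=> oU Ux fg cg A; rewrite fg// => /cg nA.
have nU := open_nbhs_nbhs (conj oU Ux).
by apply: filterS2 nU nA => y Uy; rewrite /preimage /= fg.
Qed.

Lemma open_near_partial U f g x i : open U -> U x ->
  (forall y, U y -> f y = g y) -> partial i f x = partial i g x.
Proof.
move=> oU Ux fg; apply: near_eq_derive.
by apply: filterS fg _; exact: (open_nbhs_nbhs (conj oU Ux)).
Qed.

Lemma open_near_differentiable (V : normedModType R) U (f g : 'rV[R]_3 -> V) x :
  open U -> U x -> (forall y, U y -> f y = g y) -> differentiable f x ->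
  differentiable g x /\ 'd g x = 'd f x :> ('rV[R]_3 -> V).
Proof.
move=> oU Ux fg df; have nU := open_nbhs_nbhs (conj oU Ux).
have cf : continuous ('d f x) by have /diff_locallyP[] := df.
have tac (e : R) : 0 < e -> \forall h \near (0 : 'rV[R]_3),
    `|g (h + x) - (g x + 'd f x h)| <= e * `|h|.
  move=> e0; have /diff_locallyP[_ /eqaddoP/(_ e e0)] := df.
  have nU0 : \forall h \near (0 : 'rV[R]_3), U (h + x).
    have /nbhs_ballP[d /= d0 dU] := nU; apply/nbhs_ballP; exists d => //= h.
    rewrite -ball_normE /= sub0r => hd; apply: dU.
    by rewrite -ball_normE /= opprD addrCA subrr addr0.
  by apply: filterS2 nU0 => h Uh; rewrite !fctE /= !fg.
have dg : 'd g x = 'd f x :> ('rV[R]_3 -> V).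
  apply: (@diff_unique R _ _ g ('d f x) x cf).
  by apply/eqaddoP => e e0; exact: tac.
split; last exact: dg.
apply/diff_locallyP; rewrite dg; split; first exact: cf.
by apply/eqaddoP => e e0; exact: tac.
Qed.

Lemma C1_fun_continuous U f x : C1_fun U f -> U x -> {for x, continuous f}.
Proof. by move=> Cf /Cf[df _]; exact: differentiable_continuous. Qed.

Lemma C1_fun_eq U f g : open U -> (forall y, U y -> f y = g y) ->
  C1_fun U f -> C1_fun U g.
Proof.
move=> oU fg Cf x Ux; have [df cf] := Cf x Ux; split.
  by have [] := open_near_differentiable oU Ux fg df.
move=> i; apply: (open_near_continuous oU Ux _ (cf i)) => y Uy.
by apply/esym; exact: (open_near_partial i oU Uy fg).
Qed.

Lemma C1_fun_sub U U' f : U' `<=` U -> C1_fun U f -> C1_fun U' f.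
Proof. by move=> UU Cf x /UU /Cf. Qed.

Lemma smooth_C1 U f : smooth f -> C1_fun U f.
Proof.
move=> sf x _; have [df Cf] := sf 2%N; split; first exact: df.
by move=> i; exact: (@Cn_continuous R 1%N (partial i f) (Cf i) x).
Qed.

Lemma C1_funM U f g : open U -> C1_fun U f -> C1_fun U g -> C1_fun U (fun x => f x * g x).
Proof.
move=> oU Cf Cg x Ux; have [df cf] := Cf x Ux; have [dg cg] := Cg x Ux; split.
  exact: differentiableM.
move=> i; apply: (@open_near_continuous U _ (fun y => f y * partial i g y + partial i f y * g y)) => //.
  move=> y Uy; apply: derive_mul; [exact: (Cf y Uy).1|exact: (Cg y Uy).1].
apply: continuousD; apply: continuousM.
- exact: differentiable_continuous df.
- exact: (cg i).
- exact: (cf i).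
- exact: differentiable_continuous dg.
Qed.

Lemma partialV f x i : differentiable f x -> f x != 0 ->
  partial i (fun y => (f y)^-1) x = - (f x) ^- 2 * partial i f x.
Proof.
move=> df f0; rewrite /partial.
have dV : is_derive (f x) (1 : R) (fun s : R => s^-1) (- (f x) ^- 2).
  have := @is_deriveV R id (f x) 1 1 f0 (is_derive_id _ _).
  by rewrite /= -[X in is_derive _ _ _ X]/(_ * _) mulr1.
exact: (derive_comp1 _ df dV).
Qed.

Lemma C1_funV U f : open U -> (forall x, U x -> f x != 0) -> C1_fun U f ->
  C1_fun U (fun x => (f x)^-1).
Proof.
move=> oU f0 Cf x Ux; have [df cf] := Cf x Ux; have fx0 := f0 x Ux; split.
  exact: differentiableV.
move=> i; apply: (@open_near_continuous U _ (fun y => - ((f y)^-1 * (f y)^-1) * partial i f y)) => //.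
  move=> y Uy; have dfy := (Cf y Uy).1.
  by rewrite (partialV i dfy (f0 y Uy)) -exprVn expr2.
have cV : {for x, continuous (fun y => (f y)^-1)}.
  by apply: differentiable_continuous; exact: differentiableV.
apply: continuousM; last exact: cf.
by apply: continuousN; apply: continuousM.
Qed.

Lemma derive_entry H x v (j : 'I_3) : differentiable H x ->
  'D_v (comp3 H j) x = ('D_v H x) 0 j.
Proof.
move=> dH; have dv := diff_derivable (v := v) dH.
by rewrite derive_mx// mxE.
Qed.

Lemma differentiable_comp3 H x (j : 'I_3) : differentiable H x ->
  differentiable (comp3 H j) x.
Proof.
move=> dH; apply: (@differentiable_comp _ _ _ _ H (fun y : 'rV[R]_3 => y 0 j)) => //.
exact: differentiable_coord.
Qed.

Lemma jacobianE H x (i j : 'I_3) : differentiable H x ->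
  'J H x i j = partial i (comp3 H j) x.
Proof.
by move=> dH; rewrite /partial derive_entry// deriveEjacobian// -rowE [RHS]mxE.
Qed.

Lemma partial_comp f H x i : differentiable H x -> differentiable f (H x) ->
  partial i (f \o H) x = \sum_l 'J H x i l * partial l f (H x).
Proof.
move=> dH df; have dfH : differentiable (f \o H) x by exact: differentiable_comp.
rewrite /partial (deriveE _ dfH) diff_comp//= -(deriveE _ dH).
rewrite [X in 'd f _ X]row_sum_delta linear_sum; apply: eq_bigr => l _.
rewrite linearZ /= -(deriveE _ df); congr (_ * _).
by rewrite jacobianE// /partial derive_entry.
Qed.

Lemma C1_fun_comp U U' f H : open U -> (forall j, C1_fun U (comp3 H j)) ->
  (forall x, U x -> differentiable H x) ->
  (forall x, U x -> U' (H x)) -> C1_fun U' f -> C1_fun U (f \o H).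
Proof.
move=> oU CH dH UU Cf x Ux; have [df cf] := Cf _ (UU x Ux).
have dHx := dH x Ux; split; first exact: differentiable_comp.
move=> i; apply: (@open_near_continuous U _ (fun y => \sum_l partial i (comp3 H l) y * partial l f (H y))) => //.
  move=> y Uy; rewrite partial_comp; [|exact: dH|exact: (Cf _ (UU y Uy)).1].
  by apply: eq_bigr => l _; rewrite jacobianE//; exact: dH.
have term l : {for x, continuous (fun y => partial i (comp3 H l) y * partial l f (H y))}.
  apply: continuousM; first exact: (CH l x Ux).2.
  apply: (@continuous_comp _ _ _ H (partial l f)); last exact: cf.
  exact: differentiable_continuous.
apply: (@open_near_continuous U _ (fun y => partial i (comp3 H 0) y * partial 0 f (H y)
   + partial i (comp3 H 1) y * partial 1 f (H y)
   + partial i (comp3 H 2%:R) y * partial 2%:R f (H y))) => //.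
  by move=> y Uy; rewrite sum3E.
by apply: continuousD; [apply: continuousD|]; exact: term.
Qed.

Lemma C1_on_fun U H (j : 'I_3) : open U -> C1_on U H -> C1_fun U (comp3 H j).
Proof.
move=> oU CH x Ux; have [dH cH] := CH x Ux; split; first exact: differentiable_comp3.
move=> i; apply: (@open_near_continuous U _ (fun y => 'J H y i j)) => //.
  by move=> y Uy; rewrite jacobianE//; exact: (CH y Uy).1.
apply: (@continuous_comp _ _ _ (jacobian H) (fun A : 'M[R]_3 => A i j)) => //.
exact: coord_continuous.
Qed.

End C1Functions.

(** * Polynomials in three variables *)

Section Polynomials.
Variable R : realType.
Implicit Types (f g : 'rV[R]_3 -> R) (H P q : 'rV[R]_3 -> 'rV[R]_3).

(** Sums of functions occur here pointwise, not as sums in a space of functions. *)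
Lemma sum_fun_ind (Q : ('rV[R]_3 -> R) -> Prop) (I : Type) (s : seq I) (B : pred I)
    (F : I -> 'rV[R]_3 -> R) :
  Q (fun=> 0) -> (forall f g, Q f -> Q g -> Q (fun x => f x + g x)) ->
  (forall i, B i -> Q (F i)) -> Q (fun x => \sum_(i <- s | B i) F i x).
Proof.
move=> Q0 QD QF; elim: s => [|i s IH].
  by rewrite (_ : (fun _ => _) = fun=> 0)//; apply/funext => x; rewrite big_nil.
case Bi: (B i).
  rewrite (_ : (fun _ => _) = fun x => F i x + \sum_(i <- s | B i) F i x).
    by apply: QD => //; exact: QF.
  by apply/funext => x; rewrite big_cons Bi.
rewrite (_ : (fun _ => _) = fun x => \sum_(i <- s | B i) F i x)//.
by apply/funext => x; rewrite big_cons Bi.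
Qed.

Lemma smooth_partial f i : smooth f -> smooth (partial i f).
Proof. by move=> sf m; have [_] := sf m.+1; exact. Qed.

Lemma smooth_differentiable f x : smooth f -> differentiable f x.
Proof. by move=> /(_ 1%N)[]. Qed.

Lemma partialD f g i x : smooth f -> smooth g ->
  partial i (fun y => f y + g y) x = partial i f x + partial i g x.
Proof. by move=> sf sg; apply: derive_add; exact: smooth_differentiable. Qed.

Lemma partialM f g i x : smooth f -> smooth g ->
  partial i (fun y => f y * g y) x = f x * partial i g x + partial i f x * g x.
Proof. by move=> sf sg; apply: derive_mul; exact: smooth_differentiable. Qed.

Lemma partial_cst i (c : R) x : partial i (fun=> c) x = 0.
Proof. exact: derive_cst. Qed.

Definition monomial (c : R) (a b d : nat) (x : 'rV[R]_3) : R :=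
  c * x 0 0 ^+ a * x 0 1 ^+ b * x 0 2%:R ^+ d.

Lemma is_poly0 r : is_poly r (fun=> 0 : R).
Proof.
exists (fun _ _ _ => 0) => x; rewrite big1// => a _; rewrite big1// => b _.
by rewrite big1// => d _; rewrite !mul0r.
Qed.

Lemma is_polyD r f g : is_poly r f -> is_poly r g -> is_poly r (fun x => f x + g x).
Proof.
move=> [c cE] [c' cE']; exists (fun a b d => c a b d + c' a b d) => x.
rewrite cE cE' -big_split; apply: eq_bigr => a _.
rewrite -big_split; apply: eq_bigr => b _.
by rewrite -big_split; apply: eq_bigr => d _ /=; rewrite !mulrDl.
Qed.

Lemma is_poly_monomial r (c : R) (a b d : nat) : (a + b + d <= r)%N ->
  is_poly r (monomial c a b d).
Proof.
move=> abd.
have ar : (a < r.+1)%N by rewrite ltnS (leq_trans _ abd)// -addnA leq_addr.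
have br : (b < r.+1)%N by rewrite ltnS (leq_trans _ abd)// addnAC leq_addl.
have dr : (d < r.+1)%N by rewrite ltnS (leq_trans _ abd)// leq_addl.
exists (fun a' b' d' => if [&& a' == a, b' == b & d' == d] then c else 0) => x.
rewrite (bigD1 (Ordinal ar))//= [X in _ + X]big1 ?addr0; last first.
  move=> i ia; apply: big1 => j _; apply: big1 => l _.
  by rewrite -[_ == a]/(i == Ordinal ar) (negbTE ia) !mul0r.
rewrite (bigD1 (Ordinal br))//= [X in _ + X]big1 ?addr0; last first.
  move=> i ia; apply: big1 => l _.
  by rewrite -[_ == b]/(i == Ordinal br) (negbTE ia) andbF !mul0r.
rewrite (bigD1 (Ordinal dr))//= [X in _ + X]big1 ?addr0; last first.
  move=> i /andP[_ ia].
  by rewrite -[_ == d]/(i == Ordinal dr) (negbTE ia) !andbF !mul0r.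
by rewrite !eqxx.
Qed.

Lemma is_poly_ind r f (Q : ('rV[R]_3 -> R) -> Prop) : is_poly r f ->
  Q (fun=> 0) -> (forall f g, Q f -> Q g -> Q (fun x => f x + g x)) ->
  (forall c a b d, (a + b + d <= r)%N -> Q (monomial c a b d)) -> Q f.
Proof.
move=> [c cE] Q0 QD QM.
rewrite (_ : f = fun x => \sum_(a < r.+1) \sum_(b < r.+1) \sum_(d < r.+1 | (a + b + d <= r)%N)
            monomial (c a b d) a b d x); last by apply/funext.
by do 3 (apply: sum_fun_ind => // ? ?); exact: QM.
Qed.

Lemma smooth_exp f n : smooth f -> smooth (fun x => f x ^+ n).
Proof.
move=> sf; elim: n => [|n IH].
  by rewrite (_ : (fun _ => _) = fun=> 1); [exact: smooth_cst|apply/funext => x; rewrite expr0].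
rewrite (_ : (fun _ => _) = fun x => f x * f x ^+ n); first exact: smoothM.
by apply/funext => x; rewrite exprS.
Qed.

Lemma smooth_monomial c a b d : smooth (monomial c a b d).
Proof.
have sX j n := smooth_exp n (@smooth_coord R j).
exact: (smoothM (smoothM (smoothM (smooth_cst c) (sX 0 a)) (sX 1 b)) (sX 2%:R d)).
Qed.

Lemma is_poly_smooth r f : is_poly r f -> smooth f.
Proof.
move=> /is_poly_ind; apply; first exact: smooth_cst.
  exact: smoothD.
by move=> c a b d _; exact: smooth_monomial.
Qed.

Lemma partial_coord_exp i j n x :
  partial i (fun y : 'rV[R]_3 => y 0 j ^+ n) x = n%:R * x 0 j ^+ n.-1 * (i == j)%:R.
Proof.
rewrite -(partial_coord i j x) /partial.
apply: (@derive_comp1 _ _ (fun s : R => s ^+ n) (fun y : 'rV[R]_3 => y 0 j)).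
  exact: differentiable_coord.
apply: DeriveDef; first exact: exprn_derivable.
by rewrite exp_derive -![_ *: _]/(_ * _) mulr1.
Qed.

Lemma partial_monomial c a b d i x : partial i (monomial c a b d) x =
  monomial (c * a%:R * (i == 0)%:R) a.-1 b d x +
  (monomial (c * b%:R * (i == 1)%:R) a b.-1 d x +
   monomial (c * d%:R * (i == 2%:R)%:R) a b d.-1 x).
Proof.
rewrite /monomial; have sX j n := smooth_exp n (@smooth_coord R j).
have sc := smooth_cst c.
have s1 := smoothM sc (sX 0 a). have s2 := smoothM s1 (sX 1 b).
rewrite (partialM _ _ s2 (sX _ _)) (partialM _ _ s1 (sX _ _)) (partialM _ _ sc (sX _ _)).
by rewrite partial_cst !partial_coord_exp; ring.
Qed.

Lemma is_poly_partial r f i : is_poly r f -> is_poly r.-1 (partial i f).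
Proof.
move=> fr; have sf := is_poly_smooth fr.
suff [] : smooth f /\ is_poly r.-1 (partial i f) by [].
apply: (is_poly_ind fr (Q := fun g => smooth g /\ is_poly r.-1 (partial i g))).
- split; first exact: smooth_cst.
  rewrite (_ : partial i _ = fun=> 0); first exact: is_poly0.
  by apply/funext => x; rewrite partial_cst.
- move=> g h [sg pg] [sh ph]; split; first exact: smoothD.
  rewrite (_ : partial i _ = fun x => partial i g x + partial i h x); first exact: is_polyD.
  by apply/funext => x; rewrite partialD.
- move=> c a b d abd; split; first exact: smooth_monomial.
  rewrite (_ : partial i _ = fun x =>
    monomial (c * a%:R * (i == 0)%:R) a.-1 b d x +
    (monomial (c * b%:R * (i == 1)%:R) a b.-1 d x +
     monomial (c * d%:R * (i == 2%:R)%:R) a b d.-1 x)); last first.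
    by apply/funext => x; exact: partial_monomial.
  have z a' b' d' : monomial 0 a' b' d' = fun=> 0.
    by apply/funext => x; rewrite /monomial !mul0r.
  (* where an exponent is 0, its truncated predecessor comes with the
     coefficient 0 *)
  apply: is_polyD; [|apply: is_polyD].
  + case: a abd => [|a] abd; first by rewrite mulr0 mul0r z; exact: is_poly0.
    by apply: is_poly_monomial; move: abd; clear; lia.
  + case: b abd => [|b] abd; first by rewrite mulr0 mul0r z; exact: is_poly0.
    by apply: is_poly_monomial; move: abd; clear; lia.
  + case: d abd => [|d] abd; first by rewrite mulr0 mul0r z; exact: is_poly0.
    by apply: is_poly_monomial; move: abd; clear; lia.
Qed.

(** The symmetry of second derivatives holds for constants and coordinates and
    passes to sums and products. *)
Lemma is_poly_partialC r f i j x : is_poly r f ->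
  partial i (partial j f) x = partial j (partial i f) x.
Proof.
move=> fr; pose sym g := smooth g /\
  forall i j x, partial i (partial j g) x = partial j (partial i g) x.
have symD g h : sym g -> sym h -> sym (fun x => g x + h x).
  move=> [sg eg] [sh eh]; split; first exact: smoothD.
  have e k : partial k (fun x => g x + h x) = fun x => partial k g x + partial k h x.
    by apply/funext => z; rewrite partialD.
  move=> k l z; rewrite !e (partialD _ _ (smooth_partial l sg) (smooth_partial l sh)).
  by rewrite (partialD _ _ (smooth_partial k sg) (smooth_partial k sh)) (eg k l) (eh k l).
have symM g h : sym g -> sym h -> sym (fun x => g x * h x).
  move=> [sg eg] [sh eh]; split; first exact: smoothM.
  have sp k f' : smooth f' -> smooth (partial k f') by exact: smooth_partial.
  have e k : partial k (fun x => g x * h x) = fun x => g x * partial k h x + partial k g x * h x.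
    by apply/funext => z; exact: partialM.
  have e2 k l z : partial k (fun x => g x * partial l h x + partial l g x * h x) z =
      g z * partial k (partial l h) z + partial k g z * partial l h z +
      (partial l g z * partial k h z + partial k (partial l g) z * h z).
    rewrite (partialD _ _ (smoothM sg (sp l _ sh)) (smoothM (sp l _ sg) sh)).
    by rewrite (partialM _ _ sg (sp l _ sh)) (partialM _ _ (sp l _ sg) sh).
  by move=> k l z; rewrite (e k) (e l) (e2 k l) (e2 l k) (eg k l) (eh k l) addrACA.
have symc (c : R) : sym (fun=> c).
  split; first exact: smooth_cst.
  have e k : partial k (fun=> c) = fun=> 0 by apply/funext => z; rewrite partial_cst.
  by move=> k l z; rewrite (e k) (e l) !partial_cst.
have symx k n : sym (fun x : 'rV[R]_3 => x 0 k ^+ n).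
  elim: n => [|n IH].
    by rewrite (_ : (fun _ => _) = fun=> 1); [exact: symc|apply/funext => z; rewrite expr0].
  rewrite (_ : (fun _ => _) = fun x : 'rV[R]_3 => x 0 k * x 0 k ^+ n); last first.
    by apply/funext => z; rewrite exprS.
  apply: (symM (fun x : 'rV[R]_3 => x 0 k) _ _ IH).
  split; first exact: smooth_coord.
  have e l : partial l (fun x : 'rV[R]_3 => x 0 k) = fun=> (l == k)%:R.
    by apply/funext => z; rewrite partial_coord.
  by move=> l m z; rewrite (e m) (e l) !partial_cst.
suff [_ ->] : sym f by [].
apply: (is_poly_ind fr); [exact: symc|exact: symD|].
move=> c a b d _; exact: (symM _ _ (symM _ _ (symM _ _ (symc c) (symx 0 a)) (symx 1 b)) (symx 2%:R d)).
Qed.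

End Polynomials.

(** * The Piola identity *)

Section Det3.
Variable R : comNzRingType.
Implicit Types (a : 'I_3 -> 'I_3 -> R).

(** Only sums and products occur, with -1 as a factor, so that the determinant is
    differentiated by the sum and product rules alone. *)
Definition minor2 (a b c d : R) : R := a * b + -1 * (c * d).

Definition det3_fun a : R :=
  a 0 0 * minor2 (a 1 1) (a 2%:R 2%:R) (a 1 2%:R) (a 2%:R 1)
  + (-1 * (a 0 1 * minor2 (a 1 0) (a 2%:R 2%:R) (a 1 2%:R) (a 2%:R 0))
  + a 0 2%:R * minor2 (a 1 0) (a 2%:R 1) (a 1 1) (a 2%:R 0)).

Lemma det3E (A : 'M[R]_3) : \det A = det3_fun A.
Proof.
pose f m n := A (inord m) (inord n).
have E (i j : 'I_3) : A i j = f i j by rewrite /f !inord_val.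
rewrite (expand_det_row _ 0) sum3E /cofactor.
rewrite !(expand_det_row _ ord0) !big_ord_recl !big_ord0 /cofactor !det_mx11 !mxE /=.
rewrite /det3_fun /minor2 !E /= /bump /=; ring.
Qed.

(** The adjugate: the cyclic shift of the indices accounts for the signs of the
    cofactors. *)
Definition adj3 a (j l : 'I_3) : R :=
  a (l + 1) (j + 1) * a (l + 2%:R) (j + 2%:R)
  - a (l + 1) (j + 2%:R) * a (l + 2%:R) (j + 1).

Lemma ord3D : ((1 : 'I_3) + 1 = 2%:R) * ((1 : 'I_3) + 2%:R = 0) *
  ((2%:R : 'I_3) + 1 = 0) * ((2%:R : 'I_3) + 2%:R = 1) * ((0 : 'I_3) + 1 = 1) *
  ((0 : 'I_3) + 2%:R = 2%:R).
Proof. by do !split; exact: val_inj. Qed.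

Lemma mul_adj3 a (j n : 'I_3) :
  \sum_l adj3 a j l * a l n = det3_fun a * (j == n)%:R.
Proof.
rewrite sum3E /adj3 /det3_fun /minor2.
by move: j n; apply: ord3P; apply: ord3P; rewrite !ord3D /=; ring.
Qed.

End Det3.

(** At a point, a is the Jacobian matrix of the chart and D its determinant, I
    the inverse matrix, b the second derivatives of the chart, dD the gradient of
    its Jacobian determinant in the form of Jacobi's formula; q and dq are the
    reference field and its derivatives. *)
Section PiolaAlgebra.
Variable F : fieldType.
Variables (a I : 'I_3 -> 'I_3 -> F) (b : 'I_3 -> 'I_3 -> 'I_3 -> F).
Variables (q dD : 'I_3 -> F) (dq : 'I_3 -> 'I_3 -> F).
Hypothesis bC : forall l m j, b l m j = b m l j.
Hypothesis aI : forall m l, \sum_j a m j * I j l = (m == l)%:R.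
Hypothesis dDE : forall m, dD m = \sum_l \sum_j adj3 a j l * b m l j.
Let D := det3_fun a.
Hypothesis D0 : D != 0.

Let adjE j l : adj3 a j l = D * I j l.
Proof.
transitivity (\sum_n (\sum_m adj3 a j m * a m n) * I n l).
  under eq_bigr do rewrite mulr_suml.
  rewrite exchange_big/= (bigD1 l)//= [X in _ + X]big1 ?addr0.
    by under eq_bigr do rewrite -mulrA; rewrite -mulr_sumr aI eqxx mulr1.
  move=> m ml; under eq_bigr do rewrite -mulrA.
  by rewrite -mulr_sumr aI (negbTE ml) mulr0.
under eq_bigr do rewrite mul_adj3.
rewrite (bigD1 j)//= [X in _ + X]big1 ?addr0 ?eqxx ?mulr1// => n nj.
by rewrite eq_sym (negbTE nj) mulr0 mul0r.
Qed.

(** The terms without a derivative of q cancel: by Jacobi's formula and the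
    symmetry of second derivatives, the gradient of 1 / D and the derivative of a
    contribute the same sum with opposite signs. *)
Lemma piola_algebra :
  \sum_j \sum_l I j l * ((\sum_m q m * a m j) * (- D ^- 2 * dD l)
     + (\sum_m (q m * b l m j + dq l m * a m j)) * D^-1)
  = (\sum_l dq l l) * D^-1.
Proof.
rewrite exchange_big /=.
have El l : \sum_j I j l * ((\sum_m q m * a m j) * (- D ^- 2 * dD l)
     + (\sum_m (q m * b l m j + dq l m * a m j)) * D^-1) =
  dq l l * D^-1 + (\sum_m q m * \sum_j I j l * b m l j) * D^-1 - D ^- 2 * dD l * q l.
  have aI0 := aI 0 l; have aI1 := aI 1 l; have aI2 := aI 2%:R l.
  rewrite !sum3E in aI0 aI1 aI2; rewrite !sum3E !(bC l).
  have ql : q l = q 0 * (0 == l)%:R + q 1 * (1 == l)%:R + q 2%:R * (2%:R == l)%:R.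
    by move: (l); apply: ord3P; rewrite ?mulr1 ?mulr0 ?addr0 ?add0r.
  have dql : dq l l = dq l 0 * (0 == l)%:R + dq l 1 * (1 == l)%:R + dq l 2%:R * (2%:R == l)%:R.
    by move: (l); apply: ord3P; rewrite ?mulr1 ?mulr0 ?addr0 ?add0r.
  rewrite ql dql -aI0 -aI1 -aI2.
  move: (D ^- 2) (D^-1) (dD l) => D2 D1 dDl.
  ring.
rewrite (eq_bigr _ (fun l _ => El l)) big_split big_split /= -!mulr_suml.
rewrite -addrA -[RHS]addr0; congr (_ + _).
have -> : \sum_l \sum_m q m * \sum_j I j l * b m l j = D^-1 * \sum_m dD m * q m.
  rewrite exchange_big mulr_sumr; apply: eq_bigr => m _ /=.
  have -> : dD m = D * \sum_l \sum_j I j l * b m l j.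
    rewrite dDE mulr_sumr; apply: eq_bigr => l _.
    by rewrite mulr_sumr; apply: eq_bigr => j _; rewrite adjE mulrA.
  by rewrite -mulr_sumr !mulrA mulVf// mul1r mulrC.
rewrite sumrN -mulrA [X in _ - X](_ : _ = D ^- 2 * \sum_m dD m * q m).
  by rewrite -exprVn; ring.
by rewrite mulr_sumr; apply: eq_bigr => l _; rewrite mulrA.
Qed.

End PiolaAlgebra.

Section Piola.
Variable R : realType.
Implicit Types (f g h k : 'rV[R]_3 -> R) (P q H : 'rV[R]_3 -> 'rV[R]_3).

Lemma smooth_minor2 f g h k : smooth f -> smooth g -> smooth h -> smooth k ->
  smooth (fun x => minor2 (f x) (g x) (h x) (k x)).
Proof.
move=> sf sg sh sk; apply: smoothD; first exact: smoothM.
by apply: smoothM; [exact: smooth_cst|exact: smoothM].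
Qed.

Lemma partialNM (c : R) f i x : smooth f ->
  partial i (fun y => c * f y) x = c * partial i f x.
Proof.
by move=> sf; rewrite (partialM _ _ (smooth_cst c) sf) partial_cst mul0r addr0.
Qed.

Lemma partial_minor2 f g h k i x : smooth f -> smooth g -> smooth h -> smooth k ->
  partial i (fun y => minor2 (f y) (g y) (h y) (k y)) x =
  f x * partial i g x + partial i f x * g x
  - (h x * partial i k x + partial i h x * k x).
Proof.
move=> sf sg sh sk; have sn := smoothM (smooth_cst (-1)) (smoothM sh sk).
rewrite (partialD _ _ (smoothM sf sg) sn) (partialM _ _ sf sg).
by rewrite (partialNM _ _ _ (smoothM sh sk)) (partialM _ _ sh sk) mulN1r.
Qed.

Lemma smooth_det3 (a : 'I_3 -> 'I_3 -> 'rV[R]_3 -> R) :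
  (forall l j, smooth (a l j)) -> smooth (fun x => det3_fun (fun l j => a l j x)).
Proof.
move=> sa; apply: smoothD.
  by apply: smoothM => //; exact: smooth_minor2.
apply: smoothD; last by apply: smoothM => //; exact: smooth_minor2.
apply: smoothM; first exact: smooth_cst.
by apply: smoothM => //; exact: smooth_minor2.
Qed.

(** Jacobi's formula in dimension 3. *)
Lemma partial_det3 (a : 'I_3 -> 'I_3 -> 'rV[R]_3 -> R) i x :
  (forall l j, smooth (a l j)) ->
  partial i (fun y => det3_fun (fun l j => a l j y)) x =
  \sum_l \sum_j adj3 (fun l j => a l j x) j l * partial i (a l j) x.
Proof.
move=> sa; rewrite /det3_fun.
have sm l j l' j' m n m' n' := smooth_minor2 (sa l j) (sa l' j') (sa m n) (sa m' n').
have s1 := smoothM (sa 0 0) (sm 1 1 2%:R 2%:R 1 2%:R 2%:R 1).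
have s2 := smoothM (sa 0 1) (sm 1 0 2%:R 2%:R 1 2%:R 2%:R 0).
have s3 := smoothM (sa 0 2%:R) (sm 1 0 2%:R 1 1 1 2%:R 0).
have s2' := smoothM (smooth_cst (-1)) s2.
rewrite (partialD _ _ s1 (smoothD s2' s3)) (partialD _ _ s2' s3) (partialNM _ _ _ s2).
rewrite (partialM _ _ (sa 0 0) (sm _ _ _ _ _ _ _ _)).
rewrite (partialM _ _ (sa 0 1) (sm _ _ _ _ _ _ _ _)).
rewrite (partialM _ _ (sa 0 2%:R) (sm _ _ _ _ _ _ _ _)).
rewrite !(partial_minor2 _ _ (sa _ _) (sa _ _) (sa _ _) (sa _ _)).
rewrite /adj3 !sum3E !ord3D /minor2.
have [pa paE] : exists pa, forall l j, partial i (a l j) x = pa l j.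
  by exists (fun l j => partial i (a l j) x).
have [b bE] : exists b, forall l j, a l j x = b l j by exists (fun l j => a l j x).
rewrite !paE !bE; ring.
Qed.

End Piola.

(** * Transport of polynomial fields *)

Section Transport.
Variable R : realType.
Implicit Types (f g : 'rV[R]_3 -> R) (P q H : 'rV[R]_3 -> 'rV[R]_3).

Lemma differentiable_row P x : (forall j, differentiable (comp3 P j) x) ->
  differentiable P x.
Proof.
move=> dP.
have -> : P = \sum_(j < 3) (fun y => comp3 P j y *: (delta_mx 0 j : 'rV[R]_3)).
  by apply/funext => y; rewrite fct_sumE [LHS]row_sum_delta.
by apply: differentiable_sum => j; exact: differentiableZl.
Qed.

Lemma is_poly_vec_differentiable r P x : is_poly_vec r P -> differentiable P x.
Proof.
move=> pP; apply: differentiable_row => j.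
exact: smooth_differentiable (is_poly_smooth (pP j)).
Qed.

Definition jac P x (l j : 'I_3) : R := partial l (comp3 P j) x.

Lemma det_jac P x : differentiable P x -> \det ('J P x) = det3_fun (jac P x).
Proof.
move=> dP; rewrite det3E; congr det3_fun; apply/funext => l; apply/funext => j.
by rewrite jacobianE.
Qed.

Definition divergence q x : R := \sum_l partial l (comp3 q l) x.

(** The components of the Piola transform, with the determinant expanded so that
    they can be differentiated. *)
Definition piola_component P q (j : 'I_3) x : R :=
  (\sum_m q x 0 m * jac P x m j) * (det3_fun (jac P x))^-1.

Lemma piolaE P q x j : differentiable P x ->
  piola P x (q x) 0 j = piola_component P q j x.
Proof.
move=> dP; rewrite /piola /piola_component mxE det_jac// mulrC; congr (_ * _).
by rewrite mxE; apply: eq_bigr => m _; rewrite jacobianE.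
Qed.

Lemma smooth_sum (F : 'I_3 -> 'rV[R]_3 -> R) : (forall i, smooth (F i)) ->
  smooth (fun x => \sum_i F i x).
Proof.
move=> sF; apply: (@sum_fun_ind _ (fun g => smooth g)) => //.
  exact: smooth_cst.
exact: smoothD.
Qed.

Lemma partial_sum (F : 'I_3 -> 'rV[R]_3 -> R) l x : (forall i, smooth (F i)) ->
  partial l (fun y => \sum_i F i y) x = \sum_i partial l (F i) x.
Proof.
move=> sF; rewrite (_ : (fun y => _) = fun y => F 0 y + F 1 y + F 2%:R y); last first.
  by apply/funext => y; rewrite sum3E.
by rewrite (partialD _ _ (smoothD (sF _) (sF _)) (sF _)) partialD// sum3E.
Qed.

Lemma mul_eq1_neq0 (a b : R) : a * b = 1 -> b != 0.
Proof. by move=> ab; apply/eqP => b0; move/eqP: ab; rewrite b0 mulr0 eq_sym oner_eq0. Qed.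

Section Fields.
Variables (r s : nat) (P q : 'rV[R]_3 -> 'rV[R]_3).
Hypotheses (pP : is_poly_vec r P) (pq : is_poly_vec s q).

Let sP l j : smooth (fun x => jac P x l j).
Proof. exact: smooth_partial (is_poly_smooth (pP j)). Qed.

Let sq m : smooth (comp3 q m).
Proof. exact: is_poly_smooth (pq m). Qed.

Let sD : smooth (fun x => det3_fun (jac P x)).
Proof. exact: (smooth_det3 sP). Qed.

Let sN j : smooth (fun x => \sum_m q x 0 m * jac P x m j).
Proof. by apply: smooth_sum => m; apply: smoothM; [exact: sq|exact: sP]. Qed.

Definition regular_points : set 'rV[R]_3 := [set x | det3_fun (jac P x) != 0].

Lemma open_regular_points : open regular_points.
Proof.
have -> : regular_points = setT `&` (fun x => det3_fun (jac P x)) @^-1` [set t | t != 0].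
  by rewrite setTI.
apply: continuous_open_preimage; first exact: openT.
  by move=> x _; exact: smooth_continuous sD x.
exact: open_neq.
Qed.

Lemma C1_piola_component j : C1_fun regular_points (piola_component P q j).
Proof.
apply: C1_funM; first exact: open_regular_points.
  exact: smooth_C1.
apply: C1_funV => //; first exact: open_regular_points.
exact: smooth_C1.
Qed.

Lemma partial_piola_component j l x : regular_points x ->
  partial l (piola_component P q j) x =
  (\sum_m q x 0 m * jac P x m j) *
     (- (det3_fun (jac P x)) ^- 2 * partial l (fun y => det3_fun (jac P y)) x)
  + (\sum_m (q x 0 m * partial l (partial m (comp3 P j)) x
     + partial l (comp3 q m) x * jac P x m j)) * (det3_fun (jac P x))^-1.
Proof.
move=> Dx; have dD := smooth_differentiable x sD.
rewrite /piola_component {1}/partial derive_mul; last 2 first.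
- exact: smooth_differentiable (sN j).
- exact: differentiableV.
rewrite -/(partial _ _ _) -/(partial _ _ _) partialV//; congr (_ + _ * _).
rewrite partial_sum; last by move=> m; apply: smoothM; [exact: sq|exact: sP].
by apply: eq_bigr => m _; rewrite (partialM _ _ (sq m) (sP m j)).
Qed.

Variables (W : set 'rV[R]_3) (H : 'rV[R]_3 -> 'rV[R]_3).
Hypotheses (oW : open W) (dH : forall y, W y -> differentiable H y)
  (CH : forall j, C1_fun W (comp3 H j)) (PH : forall y, W y -> P (H y) = y).

Lemma jacobian_inverse y : W y -> 'J H y *m 'J P (H y) = 1%:M.
Proof.
move=> Wy; have dP := is_poly_vec_differentiable (H y) pP.
have dHy := dH Wy.
have dPH : differentiable (P \o H) y by exact: differentiable_comp.
apply/matrixP => i j; rewrite [RHS]mxE.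
rewrite [LHS]mxE -[RHS](partial_coord i j y).
transitivity (partial i (comp3 P j \o H) y); last first.
  apply: (open_near_partial i oW Wy) => z Wz /=.
  by rewrite /comp3 PH.
rewrite partial_comp//; last exact: differentiable_comp3.
by apply: eq_bigr => l _; rewrite [in RHS]/partial -/(partial _ _ _) -jacobianE.
Qed.

Lemma inverse_regular y : W y -> regular_points (H y).
Proof.
move=> Wy; have dP := is_poly_vec_differentiable (H y) pP.
have e : \det ('J H y) * \det ('J P (H y)) = 1.
  by rewrite -det_mulmx jacobian_inverse// det1.
rewrite /regular_points /mkset -det_jac//.
exact: mul_eq1_neq0 e.
Qed.

Lemma C1_transported j : C1_fun W (piola_component P q j \o H).
Proof.
apply: (C1_fun_comp oW CH dH) (@C1_piola_component j).
exact: inverse_regular.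
Qed.

(** The chain rule brings in the Jacobian matrix of H, which is inverse to that of
    P; the rest is the Piola identity. *)
Lemma divergence_transported y : W y ->
  \sum_j partial j (piola_component P q j \o H) y =
  divergence q (H y) * (det3_fun (jac P (H y)))^-1.
Proof.
move=> Wy; have reg := inverse_regular Wy; have dHy := dH Wy.
have dP := is_poly_vec_differentiable (H y) pP.
rewrite /divergence.
rewrite -(@piola_algebra R (jac P (H y)) (fun j l => 'J H y j l)
  (fun l m j => partial l (partial m (comp3 P j)) (H y)) (fun m => q (H y) 0 m)
  (fun l => partial l (fun x => det3_fun (jac P x)) (H y))
  (fun l m => partial l (comp3 q m) (H y))).
- apply: eq_bigr => j _; rewrite partial_comp//; last exact: (C1_piola_component j reg).1.
  by apply: eq_bigr => l _; rewrite partial_piola_component.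
- by move=> l m j; exact: is_poly_partialC (pP j).
- move=> m l; have /mulmx1C e := jacobian_inverse Wy.
  move/matrixP/(_ m l): e; rewrite [LHS]mxE [RHS]mxE => <-.
  move: ('J H y) => JH; apply: eq_bigr => j _; congr (_ * _).
  by rewrite (jacobianE m j dP).
- by move=> m; exact: (partial_det3 _ _ sP).
- exact: reg.
Qed.

End Fields.
End Transport.

(** * Weak and classical divergence *)

Section WeakDivergence.
Variable R : realType.
Implicit Types (f g psi : 'rV[R]_3 -> R) (A W : set 'rV[R]_3).
Notation vec3 := (@vec3 R).
Notation mu3 := (@mu3 R).

Lemma test_fun_support W psi : test_fun W psi ->
  exists K, [/\ open (~` K), K `<=` W, (exists2 N, 0 <= N & K `<=` cbox 0 N)
    & forall x, ~ K x -> psi x = 0 /\ forall i, partial i psi x = 0].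
Proof.
move=> [spsi [K [cK KW K0]]]; have oK : open (~` K).
  by apply: closed_openC; exact: compact_closed.
exists K; split => //; first exact: compact_sub_cbox0.
move=> x nK; split; first exact: K0.
move=> i; rewrite -[RHS](partial_cst i (0 : R) x).
exact: (open_near_partial i oK nK K0).
Qed.

Lemma open_cover_C1 W (K : set 'rV[R]_3) f : open W -> open (~` K) -> K `<=` W ->
  C1_fun W f -> (forall x, ~ K x -> f x = 0) -> C1_fun setT f.
Proof.
move=> oW oK KW Cf f0 x _; have [Wx|nWx] := pselect (W x); first exact: Cf.
have nKx : (~` K) x by move=> /KW.
have C0 : C1_fun (~` K) (fun=> 0 : R) by apply: smooth_C1; exact: smooth_cst.
by apply: (C1_fun_eq oK _ C0) nKx => y nKy; rewrite f0.
Qed.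

Lemma open_cover_continuous W (K : set 'rV[R]_3) f : open W -> open (~` K) -> K `<=` W ->
  (forall x, W x -> {for x, continuous f}) -> (forall x, ~ K x -> f x = 0) ->
  continuous f.
Proof.
move=> oW oK KW cf f0 x; have [Wx|nWx] := pselect (W x); first exact: cf.
have nKx : (~` K) x by move=> /KW.
apply: (@open_near_continuous _ (~` K) f (fun=> 0)) => //.
exact: cst_continuous.
Qed.

Section IntegrationByParts.
Variables (W : set 'rV[R]_3) (F : 'I_3 -> 'rV[R]_3 -> R) (psi : 'rV[R]_3 -> R).
Hypotheses (oW : open W) (CF : forall j, C1_fun W (F j)) (tpsi : test_fun W psi).

Let spsi : smooth psi. Proof. by have [] := tpsi. Qed.

Lemma ibp_div_continuous :
  continuous (fun x => (\sum_j partial j (F j) x) * psi x).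
Proof.
have [K [oK KW _ K0]] := test_fun_support tpsi.
apply: (open_cover_continuous oW oK KW) => [x Wx|x nK]; last first.
  by have [-> _] := K0 x nK; rewrite mulr0.
apply: continuousM; last exact: smooth_continuous spsi x.
apply: (@open_near_continuous _ W _ (fun y => partial 0 (F 0) y + partial 1 (F 1) y + partial 2%:R (F 2%:R) y)) => //.
  by move=> y _; rewrite sum3E.
have c j : {for x, continuous (partial j (F j))} by exact: ((@CF j x Wx).2 j).
by apply: continuousD; [apply: continuousD|].
Qed.

Lemma ibp_grad_continuous :
  continuous (fun x => \sum_j F j x * partial j psi x).
Proof.
have [K [oK KW _ K0]] := test_fun_support tpsi.
apply: (open_cover_continuous oW oK KW) => [x Wx|x nK]; last first.
  by apply: big1 => j _; have [_ ->] := K0 x nK; rewrite mulr0.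
apply: (@open_near_continuous _ W _ (fun y => F 0 y * partial 0 psi y + F 1 y * partial 1 psi y + F 2%:R y * partial 2%:R psi y)) => //.
  by move=> y _; rewrite sum3E.
have c j : {for x, continuous (fun y => F j y * partial j psi y)}.
  apply: continuousM; first exact: (C1_fun_continuous (@CF j) Wx).
  exact: smooth_continuous (smooth_partial j spsi) x.
by apply: continuousD; [apply: continuousD|].
Qed.

Lemma integrable_ibp_div :
  mu3.-integrable setT (fun p => ((\sum_j partial j (F j) (vec3 p)) * psi (vec3 p))%:E).
Proof.
have [K [_ _ [N N0 KN] K0]] := test_fun_support tpsi.
apply: (integrable_continuous_support N0 ibp_div_continuous) => x xN.
have [|-> _] := K0 x; last by rewrite mulr0.
by move=> /KN.
Qed.

Lemma integrable_ibp_grad :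
  mu3.-integrable setT (fun p => (\sum_j F j (vec3 p) * partial j psi (vec3 p))%:E).
Proof.
have [K [_ _ [N N0 KN] K0]] := test_fun_support tpsi.
apply: (integrable_continuous_support N0 ibp_grad_continuous) => x xN.
by apply: big1 => j _; have [|_ ->] := K0 x; [move=> /KN|rewrite mulr0].
Qed.

(** The field psi F is C1 on the whole space, since the support of psi is a
    compact subset of W. *)
Lemma compact_integration_by_parts :
  (\int[mu3]_p ((\sum_j partial j (F j) (vec3 p)) * psi (vec3 p))%:E
   + \int[mu3]_p (\sum_j F j (vec3 p) * partial j psi (vec3 p))%:E = 0)%E.
Proof.
rewrite -integralD//; [|exact: integrable_ibp_div|exact: integrable_ibp_grad].
have [K [oK KW [N N0 KN] K0]] := test_fun_support tpsi.
pose Phi j x := F j x * psi x.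
have Phi0 j x : ~ K x -> Phi j x = 0 by move=> /K0[p0 _]; rewrite /Phi p0 mulr0.
have CPhi j : C1_fun setT (Phi j).
  apply: (open_cover_C1 oW oK KW) (@Phi0 j).
  by apply: C1_funM => //; exact: smooth_C1.
have iPhi j : (\int[mu3]_p (partial j (Phi j) (vec3 p))%:E = 0)%E.
  apply: (integral_partial_eq0 N0).
  - by move=> x; apply: diff_derivable; exact: (CPhi j x I).1.
  - by move=> x; exact: (CPhi j x I).2.
  - by move=> x xN; apply: Phi0 => /KN.
have cPhi j : mu3.-integrable setT (EFin \o (partial j (Phi j) \o vec3)).
  apply: (integrable_continuous_support N0).
    by move=> x; exact: (CPhi j x I).2.
  move=> x xN; rewrite -[RHS](partial_cst j (0 : R) x).
  by apply: (open_near_partial j oK _ (@Phi0 j)) => /KN.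
have pointwise x : (\sum_j partial j (F j) x) * psi x + \sum_j F j x * partial j psi x =
    partial 0 (Phi 0) x + (partial 1 (Phi 1) x + partial 2%:R (Phi 2%:R) x).
  rewrite !sum3E; have [Wx|nWx] := pselect (W x).
    have e j : partial j (Phi j) x = F j x * partial j psi x + partial j (F j) x * psi x.
      apply: derive_mul; first exact: (@CF j x Wx).1.
      exact: smooth_differentiable.
    rewrite !e !mulrDl addrACA [X in X + _ = _]addrC; rewrite -!addrA; congr (_ + _).
    by rewrite [X in _ = _ + X]addrC; ring.
  have nKx : (~` K) x by move=> /KW.
  have [-> dpsi] := K0 x nKx.
  have e j : partial j (Phi j) x = 0.
    by rewrite -[RHS](partial_cst j (0 : R) x); exact: (open_near_partial j oK nKx (@Phi0 j)).
  by rewrite !e !dpsi !mulr0 !addr0.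
transitivity (\int[mu3]_p ((partial 0 (Phi 0) (vec3 p))%:E + ((partial 1 (Phi 1) (vec3 p))%:E
     + (partial 2%:R (Phi 2%:R) (vec3 p))%:E)))%E.
  by apply: eq_integral => p _; rewrite -!EFinD pointwise.
rewrite integralD//; [|exact: cPhi|apply: integrableD => //; exact: cPhi].
by rewrite integralD//; [rewrite !iPhi !adde0|exact: cPhi|exact: cPhi].
Qed.

End IntegrationByParts.
End WeakDivergence.

Section WeakDivergenceAE.
Variable R : realType.
Implicit Types (f g psi : 'rV[R]_3 -> R) (A W E : set 'rV[R]_3).
Notation vec3 := (@vec3 R).
Notation mu3 := (@mu3 R).

Lemma measurable_continuous3 f : continuous f ->
  measurable_fun setT (f \o vec3 : T3 R -> measurableTypeR R).
Proof.
move=> cf; rewrite -[setT]/(vec3 @^-1` setT); apply: continuous_measurable3.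
  exact: openT.
by move=> x _; exact: cf.
Qed.

Lemma L2_mul_integrable A f g : open A -> L2 A f -> L2 A g ->
  mu3.-integrable (vec3 @^-1` A) (fun p => (f (vec3 p) * g (vec3 p))%:E).
Proof.
move=> oA [mf if2] [mg ig2]; have mA := measurable_open3 oA.
have i2 := integrableD mA if2 ig2.
apply: (le_integrable mA _ _ i2).
  by apply/measurable_EFinP; exact: measurable_funM.
move=> p _; rewrite /= lee_fin.
set a := f _; set b := g _; rewrite [leRHS]ger0_norm ?addr_ge0 ?sqr_ge0//.
rewrite normrM -(real_normK (num_real a)) -(real_normK (num_real b)).
move: (normr_ge0 a) (normr_ge0 b); move: `|a| `|b| => u v u0 v0; nra.
Qed.

Lemma L2_continuous_support A f (N : R) : 0 <= N -> open A -> continuous f ->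
  (forall x, ~ cbox 0 N x -> f x = 0) -> L2 A f.
Proof.
move=> N0 oA cf f0; have mA := measurable_open3 oA; split.
  apply: measurable_funTS; exact: measurable_continuous3.
apply: (integrableS measurableT) => //.
apply: (integrable_continuous_support (g := fun x => f x ^+ 2) N0).
  by move=> x; rewrite (_ : (fun x => _) = fun x => f x * f x); [apply: continuousM; exact: cf|apply/funext => z; rewrite expr2].
by move=> x /f0 ->; rewrite expr0n.
Qed.

Lemma L2_patch A E f (N K : R) : open A -> open E -> E `<=` cbox 0 N -> 0 <= N ->
  (forall x, E x -> {for x, continuous f}) -> (forall x, E x -> `|f x| <= K) ->
  L2 A (fun x => if `[< E x >] then f x else 0).
Proof.
move=> oA oE EN N0 cf fK; have mA := measurable_open3 oA; have mE := measurable_open3 oE.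
pose h x := if `[< E x >] then f x else 0.
have mh : measurable_fun setT (h \o vec3 : T3 R -> measurableTypeR R).
  rewrite (_ : h \o vec3 = (f \o vec3) \_ (vec3 @^-1` E)).
    by apply/(measurable_restrictT _ mE); exact: continuous_measurable3.
  by apply/funext => p; rewrite patchE /h /=; case: asboolP => Ep; [rewrite mem_set|rewrite memNset].
split; first exact: measurable_funTS.
apply: (integrableS measurableT) => //.
apply: (@integrable_bounded_support R _ (T3 R) mu3 (fun p => h (vec3 p) ^+ 2) (vec3 @^-1` cbox 0 N) (K ^+ 2)).
- exact: measurable_cbox.
- by rewrite [X in (X < _)%E](mu3_cbox 0 N0) ltry.
- exact: measurable_funX.
- move=> p; rewrite normrX /h; case: asboolP => Ep.
    by rewrite lerXn2r ?nnegrE ?(le_trans _ (fK _ Ep))// fK.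
  by rewrite normr0 expr0n exprn_even_ge0.
- by move=> p pN; rewrite /h asboolF ?expr0n// => /EN.
Qed.

Lemma integral_support A f : measurable (vec3 @^-1` A : set (T3 R)) ->
  (forall x, ~ A x -> f x = 0) ->
  (\int[mu3]_(p in vec3 @^-1` A) (f (vec3 p))%:E = \int[mu3]_p (f (vec3 p))%:E)%E.
Proof.
move=> mA f0; rewrite integral_mkcond; apply: eq_integral => p _.
rewrite patchE; case: ifPn => //; rewrite notin_setE => /f0.
by rewrite /= => ->.
Qed.

Lemma integrable_support A f : measurable (vec3 @^-1` A : set (T3 R)) ->
  (forall x, ~ A x -> f x = 0) ->
  mu3.-integrable (vec3 @^-1` A) (fun p => (f (vec3 p))%:E) ->
  mu3.-integrable setT (fun p => (f (vec3 p))%:E).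
Proof.
move=> mA f0 /(integrable_mkcond _ mA).
rewrite (_ : _ \_ _ = fun p => (f (vec3 p))%:E)//; apply/funext => p.
rewrite patchE; case: ifPn => //; rewrite notin_setE => /f0.
by rewrite /= => ->.
Qed.

(** Integration by parts turns the definition of the weak divergence into the
    orthogonality of g - div F to all test functions on W, to which the
    fundamental lemma applies. *)
Lemma weak_div_classical A W (v : 'rV[R]_3 -> 'rV[R]_3) g (F : 'I_3 -> 'rV[R]_3 -> R) :
  open A -> open W -> W `<=` A ->
  (forall i, L2 A (comp3 v i)) -> L2 A g -> is_weak_div A v g ->
  (forall j, C1_fun W (F j)) ->
  null3 [set x | W x /\ ~ forall j, v x 0 j = F j x] ->
  null3 [set x | W x /\ g x <> \sum_j partial j (F j) x].
Proof.
move=> oA oW WA Lv Lg wg CF nvF; have mA := measurable_open3 oA.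
pose div x := \sum_j partial j (F j) x.
have L2psi psi : test_fun W psi -> L2 A psi.
  move=> tpsi; have [K [_ _ [N N0 KN] K0]] := test_fun_support tpsi.
  apply: (L2_continuous_support N0 oA); first by apply: smooth_continuous; have [] := tpsi.
  by move=> x xN; have [|-> //] := K0 x; move=> /KN.
have psiA psi : test_fun W psi -> forall x, ~ A x -> psi x = 0 /\ forall i, partial i psi x = 0.
  move=> tpsi x nA; have [K [_ KW _ K0]] := test_fun_support tpsi.
  by apply: K0 => /KW/WA.
have igpsi psi : test_fun W psi -> mu3.-integrable setT (fun p => (g (vec3 p) * psi (vec3 p))%:E).
  move=> tpsi; apply: (integrable_support (A := A) (f := fun x => g x * psi x)) => //.
    by move=> x /(psiA _ tpsi)[-> _]; rewrite mulr0.
  by apply: L2_mul_integrable => //; exact: L2psi.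
suff H : null3 [set x | W x /\ g x - div x <> 0].
  by apply: null3_sub H _ => x [Wx gx]; split => // /eqP; rewrite subr_eq0 => /eqP.
apply: du_bois_reymond => // psi tpsi.
  have := integrableB measurableT (igpsi _ tpsi) (integrable_ibp_div oW CF tpsi).
  apply: eq_integrable => // p _ /=.
  by rewrite -EFinB mulrBl.
transitivity (\int[mu3]_p ((g (vec3 p) * psi (vec3 p))%:E - (div (vec3 p) * psi (vec3 p))%:E))%E.
  by apply: eq_integral => p _; rewrite -EFinB mulrBl.
have ig := igpsi _ tpsi; have id := integrable_ibp_div oW CF tpsi.
have igr := integrable_ibp_grad oW CF tpsi.
rewrite integralB//.
have ibp := compact_integration_by_parts oW CF tpsi.
have tA : test_fun A psi.
  by have [sp [K [cK KW K0]]] := tpsi; split => //; exists K; split => // x /KW/WA.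
have vF : (\int[mu3]_(p in vec3 @^-1` A) (\sum_i v (vec3 p) 0 i * partial i psi (vec3 p))%:E
   = \int[mu3]_p (\sum_j F j (vec3 p) * partial j psi (vec3 p))%:E)%E.
  rewrite -(@integral_support A (fun x => \sum_j F j x * partial j psi x))//; last first.
    by move=> x /(psiA _ tpsi)[_ d0]; apply: big1 => j _; rewrite d0 mulr0.
  have spsi : smooth psi by have [] := tpsi.
  apply: ae_eq_integral => //.
  - apply/measurable_EFinP.
    rewrite (_ : (fun p => _) = (fun p => v (vec3 p) 0 0 * partial 0 psi (vec3 p)
      + v (vec3 p) 0 1 * partial 1 psi (vec3 p) + v (vec3 p) 0 2%:R * partial 2%:R psi (vec3 p))); last first.
      by apply/funext => p; rewrite sum3E.
    have m j : measurable_fun (vec3 @^-1` A) (fun p : T3 R => v (vec3 p) 0 j * partial j psi (vec3 p) : measurableTypeR R).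
      apply: measurable_funM; first exact: (Lv j).1.
      apply: measurable_funTS; apply: (measurable_continuous3 (f := partial j psi)).
      by apply: smooth_continuous; exact: smooth_partial.
    by apply: measurable_funD; [apply: measurable_funD|]; exact: m.
  - have /integrableP[m _] := igr; exact: measurable_funTS m.
  - apply: (negligibleS _ nvF) => p /= /not_implyP[Ap H].
    have [K [oK KW _ K0]] := test_fun_support tpsi.
    have [Kp|nKp] := pselect (K (vec3 p)).
      split; first exact: KW.
      by move=> e; apply: H; congr EFin; apply: eq_bigr => j _; rewrite e.
    exfalso; apply: H; congr EFin; apply: eq_bigr => j _.
    by have [_ ->] := K0 _ nKp; rewrite !mulr0.
have gv : (\int[mu3]_p (g (vec3 p) * psi (vec3 p))%:E =
    - \int[mu3]_p (\sum_j F j (vec3 p) * partial j psi (vec3 p))%:E)%E.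
  have := wg psi tA; rewrite /int3 /Rintegral vF.
  rewrite (@integral_support A (fun x => g x * psi x))//; last first.
    by move=> x /(psiA _ tpsi)[-> _]; rewrite mulr0.
  have f1 := integrable_fin_num measurableT ig.
  have f2 := integrable_fin_num measurableT igr.
  move=> e; rewrite -(fineK f1) -(fineK f2) -EFinN; congr EFin.
  by move/eqP: e; rewrite -eqr_oppLR => /eqP ->.
rewrite gv; move: ibp.
have f2 := integrable_fin_num measurableT igr.
have f3 := integrable_fin_num measurableT id.
rewrite -(fineK f2) -(fineK f3) -EFinD -EFinN -EFinB => -[e].
by congr EFin; rewrite -opprD addrC e oppr0.
Qed.

End WeakDivergenceAE.

(** * The reference tetrahedron and diffeomorphisms *)

Section Geometry.
Variable R : realType.
Implicit Types (x y : 'rV[R]_3) (f g h : 'rV[R]_3 -> 'rV[R]_3) (U V B : set 'rV[R]_3).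
Notation vec3 := (@vec3 R).
Notation mu3 := (@mu3 R).

Definition int_tet : set 'rV[R]_3 := [set x | (forall i, 0 < x 0 i) /\ \sum_i x 0 i < 1].

Lemma int_tet_sub : int_tet `<=` ref_tet (R := R).
Proof. by move=> x [x0 x1]; split => [i|]; [exact: ltW|exact: ltW]. Qed.

Lemma ref_tet_cbox : ref_tet (R := R) `<=` cbox 0 1.
Proof.
move=> x [x0]; rewrite sum3E => x1 i; rewrite mxE subr0 ger0_norm//.
have := x0 0; have := x0 1; have := x0 2%:R; move: (x1).
by move: i; apply: ord3P; lra.
Qed.

Lemma smooth_sum_coord : smooth (fun x : 'rV[R]_3 => \sum_i x 0 i).
Proof. by apply: smooth_sum => i; exact: smooth_coord. Qed.

Lemma open_int_tet : open int_tet.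
Proof.
have -> : int_tet = (\bigcap_(i in [set: 'I_3]) [set x : 'rV[R]_3 | 0 < x 0 i])
    `&` (setT `&` (fun x : 'rV[R]_3 => \sum_i x 0 i) @^-1` [set t | t < 1]).
  apply/seteqP; split => [x [x0 x1]|x [x0 [_ x1]]].
    by split; [move=> i _; exact: x0|split].
  by split; [move=> i; exact: (x0 i I)|].
apply: openI.
  rewrite (_ : \bigcap_(_ in _) _ = [set x : 'rV[R]_3 | 0 < x 0 0] `&` [set x : 'rV[R]_3 | 0 < x 0 1] `&` [set x : 'rV[R]_3 | 0 < x 0 2%:R]); last first.
    apply/seteqP; split => x; first by move=> H; split; [split|]; exact: H.
    by move=> [[h0 h1] h2] i _; move: i; exact: ord3P.
  have o i : open [set x : 'rV[R]_3 | 0 < x 0 i].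
    exact: (open_comp (fun x _ => @coord3_continuous R i x) (@open_gt R _)).
  by apply: openI; [apply: openI|].
apply: continuous_open_preimage; [exact: openT| |exact: open_lt].
by move=> x _; exact: smooth_continuous smooth_sum_coord x.
Qed.

Lemma null3_coordinate_plane i : null3 [set x : 'rV[R]_3 | x 0 i = 0].
Proof.
have m0 : measurable ([set 0] : set (measurableTypeR R)) by exact: measurable_set1.
have mT : measurable (setT : set (measurableTypeR R)) by exact: measurableT.
have l0 : lebesgue_measure ([set 0] : set (measurableTypeR R)) = 0%E by exact: lebesgue_measure_set1.
have key (A B C : set (measurableTypeR R)) : measurable A -> measurable B -> measurable C ->
    [\/ A = [set 0], B = [set 0] | C = [set 0]] ->
    vec3 @^-1` [set x : 'rV[R]_3 | x 0 i = 0] `<=` (A `*` B) `*` C ->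
    null3 [set x : 'rV[R]_3 | x 0 i = 0].
  move=> mA mB mC ABC sub; exists ((A `*` B) `*` C); split => //.
    by apply: measurableX => //; exact: measurableX.
  rewrite [LHS](mu3_box mA mB mC).
  by case: ABC => ->; rewrite l0 ?mule0 ?mul0e.
move: key; move: i; apply: ord3P => key.
- apply: (key [set 0] setT setT) => //; first by constructor 1.
  by move=> p; rewrite /= vec3E => ->.
- apply: (key setT [set 0] setT) => //; first by constructor 2.
  by move=> p; rewrite /= vec3E => ->.
- apply: (key setT setT [set 0]) => //; first by constructor 3.
  by move=> p; rewrite /= vec3E => ->.
Qed.

Lemma null3_sum_plane : null3 [set x : 'rV[R]_3 | \sum_i x 0 i = 1].
Proof.
(* an affine map that sends the plane x_0 = 0 onto the plane in question *)
pose f x : 'rV[R]_3 := x + (1 - \sum_i x 0 i) *: delta_mx 0 0.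
apply: (@null3_sub _ (f @` [set x : 'rV[R]_3 | x 0 0 = 0])).
  apply: null3_image; last exact: null3_coordinate_plane.
  move=> x _; apply: differentiable_row => j.
  rewrite (_ : comp3 f j = fun x => x 0 j + (1 + -1 * \sum_i x 0 i) * (delta_mx 0 0 : 'rV[R]_3) 0 j); last first.
    by apply/funext => z; rewrite /comp3 /f !mxE mulN1r.
  apply: smooth_differentiable; apply: smoothD; first exact: smooth_coord.
  apply: smoothM; last exact: smooth_cst.
  apply: smoothD; first exact: smooth_cst.
  by apply: smoothM; [exact: smooth_cst|exact: smooth_sum_coord].
move=> y /= y1; pose x : 'rV[R]_3 := y - y 0 0 *: delta_mx 0 0.
exists x; first by rewrite /= !mxE !eqxx mulr1 subrr.
rewrite /f; have -> : \sum_i x 0 i = 1 - y 0 0.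
  by move: y1; rewrite !sum3E /x !mxE /= !mulr0 !subr0 mulr1 subrr add0r => <-; ring.
by rewrite opprB addrCA subrr addr0 /x subrK.
Qed.

Lemma null3_tet_boundary : null3 [set x : 'rV[R]_3 | ref_tet x /\ ~ int_tet x].
Proof.
apply: (@null3_sub _ ((\bigcup_(i : 'I_3) [set x : 'rV[R]_3 | x 0 i = 0]) `|` [set x : 'rV[R]_3 | \sum_i x 0 i = 1])).
  apply: null3U; last exact: null3_sum_plane.
  by apply: null3_bigcup => i; exact: null3_coordinate_plane.
move=> x [[x0 x1] nx]; have [Sx|Sx] := eqVneq (\sum_i x 0 i) 1; first by right.
left; apply: contrapT => H; apply: nx; split; last by rewrite lt_neqAle Sx.
move=> i; rewrite lt_neqAle x0 andbT eq_sym; apply/negP => /eqP xi; apply: H.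
by exists i.
Qed.

Lemma int_tet_bary x a : int_tet x -> 0 < bary x a.
Proof.
move=> [x0 x1]; rewrite /bary; case: unliftP => [j _|_]; first exact: x0.
by rewrite subr_gt0.
Qed.

Lemma diffeo_image U V g h B :
  (forall x, U x -> V (g x) /\ h (g x) = x) ->
  (forall y, V y -> U (h y) /\ g (h y) = y) -> B `<=` U ->
  g @` B = V `&` h @^-1` B.
Proof.
move=> gh hg BU; apply/seteqP; split => [_ [x Bx <-]|y [Vy hy]].
  by have [Vg hgx] := gh x (BU x Bx); split => //=; rewrite hgx.
by exists (h y) => //; have [] := hg y Vy.
Qed.

Lemma diffeo_open_image U V g h B : open V -> C1_on V h ->
  (forall x, U x -> V (g x) /\ h (g x) = x) ->
  (forall y, V y -> U (h y) /\ g (h y) = y) -> B `<=` U -> open B ->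
  open (g @` B).
Proof.
move=> oV Ch gh hg BU oB; rewrite (diffeo_image gh hg BU) openE => y [Vy By].
apply: filterI; first exact: (open_nbhs_nbhs (conj oV Vy)).
have ch : {for y, continuous h} by apply: differentiable_continuous; exact: (Ch y Vy).1.
by apply: ch; exact: (open_nbhs_nbhs (conj oB By)).
Qed.

Lemma jacobian_comp f g x : differentiable f x -> differentiable g (f x) ->
  'J (g \o f) x = 'J f x *m 'J g (f x).
Proof.
move=> df dg; have dgf : differentiable (g \o f) x by exact: differentiable_comp.
apply/matrixP => i j; rewrite (jacobianE _ _ dgf).
have dgj := differentiable_comp3 j dg.
rewrite [LHS](partial_comp (f := comp3 g j) i df dgj) [RHS]mxE.
move: ('J f x) => Jf; apply: eq_bigr => l _; congr (_ * _).
by rewrite (jacobianE l j dg).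
Qed.

Lemma open_near_jacobian U f g x : open U -> U x -> (forall y, U y -> f y = g y) ->
  differentiable f x -> differentiable g x /\ 'J g x = 'J f x.
Proof.
move=> oU Ux fg df; have [dg _] := open_near_differentiable oU Ux fg df.
split; first exact: dg.
apply/matrixP => i j; rewrite [LHS](jacobianE i j dg) [RHS](jacobianE i j df).
have fgj y : U y -> comp3 g j y = comp3 f j y by move=> Uy; rewrite /comp3 (fg y Uy).
exact: (open_near_partial i oU Ux fgj).
Qed.

Lemma piola_comp f g x (v : 'rV[R]_3) : differentiable f x -> differentiable g (f x) ->
  piola g (f x) (piola f x v) = piola (g \o f) x v.
Proof.
move=> df dg; rewrite /piola (jacobian_comp df dg).
move: ('J f x) ('J g (f x)) => A B.
by rewrite det_mulmx invfM -scalemxAl scalerA mulmxA [in LHS]mulrC.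
Qed.

Lemma poly_image_bounded (P : 'rV[R]_3 -> 'rV[R]_3) (r : nat) : is_poly_vec r P ->
  exists2 N : R, 0 <= N & P @` ref_tet (R := R) `<=` cbox 0 N.
Proof.
move=> pP; have cP : continuous P.
  by move=> x; apply: differentiable_continuous; exact: is_poly_vec_differentiable pP.
have : compact (P @` cbox 0 1).
  by apply: continuous_compact (@compact_cbox R 0 1); exact: continuous_subspaceT.
move=> /compact_sub_cbox0[N N0 PN]; exists N => // _ [x Tx <-]; apply: PN.
by exists x => //; exact: ref_tet_cbox.
Qed.

(** The set where f and g differ is open, and a nonempty open set is not null. *)
Lemma ae_eq_continuous U (f g : 'rV[R]_3 -> R) : open U ->
  (forall x, U x -> {for x, continuous f}) -> (forall x, U x -> {for x, continuous g}) ->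
  null3 [set x | U x /\ f x <> g x] -> forall x, U x -> f x = g x.
Proof.
move=> oU cf cg nfg x Ux; apply: contrapT => fgx.
pose D := U `&` (fun x => f x - g x) @^-1` [set t | t != 0].
have oD : open D.
  apply: continuous_open_preimage; [exact: oU| |exact: open_neq].
  by move=> y Uy; apply: continuousB; [exact: (cf y Uy)|exact: (cg y Uy)].
have DE : D = [set x | U x /\ f x <> g x].
  apply/seteqP; split => y [Uy h]; split => //=.
    by move=> e; move/negP: h; apply; rewrite e subrr.
  by rewrite subr_eq0; apply/eqP.
have Dx : D !=set0 by exists x; rewrite DE.
have := mu3_open_gt0 oD Dx.
have mD := measurable_open3 oD.
move: nfg; rewrite -DE /null3 negligibleP// => e.
by rewrite [X in (_ < X)%E]e ltxx.
Qed.

Lemma L2_eq (A : set 'rV[R]_3) (f g : 'rV[R]_3 -> R) : open A ->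
  (forall x, A x -> f x = g x) -> L2 A f -> L2 A g.
Proof.
move=> oA fg [mf if2]; have mA := measurable_open3 oA; split.
  by apply: eq_measurable_fun mf => p; rewrite inE => Ap; exact: fg.
by apply: eq_integrable if2 => // p; rewrite inE => Ap; rewrite fg.
Qed.

End Geometry.

(** * Charts of the moved cells *)

Lemma eq_image (T U : Type) (B : set T) (f g : T -> U) :
  (forall x, B x -> f x = g x) -> f @` B = g @` B.
Proof.
by move=> fg; apply/seteqP; split => _ [x Bx <-]; exists x => //; rewrite fg.
Qed.

Section Diffeo.
Variable R : realType.
Implicit Types (x y z : 'rV[R]_3) (B : set 'rV[R]_3).

(** What is used of an orientation-preserving diffeomorphism of a set B that
    need not be open. *)
Lemma orient_diffeo_facts B (f : 'rV[R]_3 -> 'rV[R]_3) : orient_diffeo_on B f ->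
  exists V h, [/\ open V, C1_on V h, forall x, B x -> V (f x) /\ h (f x) = x,
    forall O, O `<=` B -> open O -> open (f @` O) /\
      forall x, O x -> differentiable f x /\ 0 < \det ('J f x)
    & forall E, E `<=` B -> null3 E -> null3 (f @` E)].
Proof.
move=> [U [V [g [h [[oU oV BU] [Cg Ch] [gh hg] gf dg]]]]]; exists V, h; split => //.
- by move=> x Bx; rewrite -gf//; exact: gh (BU x Bx).
- move=> O OB oO; have OU := subset_trans OB BU.
  have gfO x : O x -> g x = f x by move=> /OB/gf.
  split.
    rewrite -(eq_image gfO).
    exact: (diffeo_open_image oV Ch gh hg OU oO).
  move=> x Ox; have [df ->] := open_near_jacobian oO Ox gfO (Cg x (OU x Ox)).1.
  by split => //; apply: dg; exact: OB.
- move=> E EB nE; rewrite -(@eq_image _ _ E g f); last by move=> x /EB/gf.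
  by apply: null3_image nE => x /EB/BU/Cg[].
Qed.

End Diffeo.

Section Cells.
Variables (R : realType) (k : nat) (Omega : set 'rV[R]_3) (I : finType)
  (F : I -> 'rV[R]_3 -> 'rV[R]_3).
Hypothesis mesh : curved_mesh k Omega F.
Variable M : 'rV[R]_3 -> 'rV[R]_3.
Hypothesis flow : flow_map k Omega F M.
Notation T := (ref_tet (R := R)).
Notation T0 := (@int_tet R).
Notation A := (M @` Omega).
Implicit Types (x y z : 'rV[R]_3).

Lemma flow_inj x y : closure Omega x -> closure Omega y -> M x = M y -> x = y.
Proof.
move=> cx cy e; have [L [_ H]] := flow_bilip flow.
have := H x y cx cy; rewrite e subrr normr0 mulr0 normr_le0 subr_eq0.
by move/eqP.
Qed.

Lemma cell_closure i x : T x -> closure Omega (F i x).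
Proof. by move=> Tx; rewrite (mesh_cover mesh); exists i => //; exists x. Qed.

Lemma cell_inj i x y : T x -> T y -> F i x = F i y -> x = y.
Proof.
have [V [h [_ _ H _ _]]] := orient_diffeo_facts (mesh_diffeo mesh i).
by move=> /H[_ ex] /H[_ ey] e; rewrite -ex -ey e.
Qed.

(** By conformity, two cells meet in the image of a proper face, and no proper
    face contains an interior point of the tetrahedron. *)
Lemma cell_disjoint i j x z : i != j -> T0 z -> T x -> F j x <> F i z.
Proof.
move=> ij T0z Tx e; have [s [pi [sT cap _]]] := mesh_conforming mesh ij.
have : (F i @` T `&` F j @` T) (F i z).
  by split; [exists z => //; exact: int_tet_sub|exists x].
rewrite cap => -[w [Tw ws] Fw].
have wz : w = z by apply: cell_inj Fw => //; exact: int_tet_sub.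
have /subsetPn[a _ as_] : ~~ ([set: 'I_4] \subset s)%SET by rewrite finset.subTset.
by have := int_tet_bary a T0z; rewrite -wz ws// ltxx.
Qed.

Section OneCell.
Variable i : I.
Notation O := (F i @` T0).
Notation E := (M @` (F i @` T0)).

Lemma image_int_cell_sub : O `<=` F i @` T.
Proof. by move=> _ [x Tx <-]; exists x => //; exact: int_tet_sub. Qed.

Lemma open_int_cell : open O.
Proof.
have [V [h [_ _ _ H _]]] := orient_diffeo_facts (mesh_diffeo mesh i).
exact: (H _ (@int_tet_sub R) (@open_int_tet R)).1.
Qed.

(** In the reference coordinates of a cell, the moving mesh is described by a
    polynomial map P with a C1 inverse H. The last two fields are all that is
    kept of the change of variables. *)
Record cell_chart (P H : 'rV[R]_3 -> 'rV[R]_3) : Prop := {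
  chart_poly : is_poly_vec k.+1 P;
  chart_eq : forall x, T0 x -> M (F i x) = P x;
  chart_open : forall U, U `<=` O -> open U -> open (M @` U);
  chart_inv : forall x, T x -> H (M (F i x)) = x;
  chart_diff : forall x, T0 x -> differentiable M (F i x);
  chart_inv_diff : forall y, E y -> differentiable H y;
  chart_inv_C1 : forall j, C1_fun E (comp3 H j);
  chart_det : forall x, T0 x -> 0 < det3_fun (jac P x);
  chart_piola : forall x v, T0 x -> piola M (F i x) (piola (F i) x v) = piola P x v;
  chart_null_cell : forall N, N `<=` T -> null3 N -> null3 (F i @` N);
  chart_null_flow : forall N, N `<=` F i @` T -> null3 N -> null3 (M @` N) }.

(** The definition of the flow map makes it a polynomial in reference
    coordinates almost everywhere only; continuity extends this to every interior
    point. *)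
Lemma exists_cell_chart : exists P H, cell_chart P H.
Proof.
have [VF [hF [oVF CF FK FO Fnull]]] := orient_diffeo_facts (mesh_diffeo mesh i).
have [VM [hM [oVM CM MK MO Mnull]]] := orient_diffeo_facts (flow_diffeo flow i).
have [oO dF] := FO _ (@int_tet_sub R) (@open_int_tet R).
have [oE dM] := MO _ image_int_cell_sub oO.
have [P pP PE] : exists2 P, is_poly_vec k.+1 P & ae3 T (fun x => M (F i x) = P x).
  exact: (flow_Vt0 flow).2.
have dMx x : T0 x -> differentiable M (F i x) /\ 0 < \det ('J M (F i x)).
  by move=> Tx; apply: dM; exists x.
have dMF x : T0 x -> differentiable (M \o F i) x.
  by move=> Tx; apply: differentiable_comp; [exact: (dF x Tx).1|exact: (dMx x Tx).1].
have MP x : T0 x -> M (F i x) = P x.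
  move=> Tx; apply/rowP => j.
  apply: (@ae_eq_continuous R T0 (comp3 (M \o F i) j) (comp3 P j)) => //.
  - exact: open_int_tet.
  - by move=> z Tz; apply: differentiable_continuous; apply: differentiable_comp3; exact: dMF.
  - move=> z Tz; apply: differentiable_continuous; apply: differentiable_comp3.
    exact: is_poly_vec_differentiable pP.
  - move/ae3P: PE => /null3_sub; apply => z [Tz ne]; split; first exact: int_tet_sub.
    by move=> e; apply: ne; rewrite /comp3 /= e.
have JP x : T0 x -> 'J P x = 'J (M \o F i) x.
  by move=> Tx; exact: (open_near_jacobian (@open_int_tet R) Tx MP (dMF x Tx)).2.
have EV y : E y -> VM y /\ VF (hM y).
  move=> [_ [x T0x <-] <-]; have Tx := int_tet_sub T0x.
  have FTx : (F i @` T) (F i x) by exists x.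
  by have [? ->] := MK _ FTx; have [] := FK _ Tx.
exists P, (hF \o hM); split.
- exact: pP.
- exact: MP.
- by move=> U UO oU; apply: (MO U _ oU).1; exact: subset_trans UO image_int_cell_sub.
- move=> x Tx; have FTx : (F i @` T) (F i x) by exists x.
  by have [_ e] := MK _ FTx; have [_ e'] := FK _ Tx; rewrite /comp e.
- by move=> x Tx; exact: (dMx x Tx).1.
- move=> y /EV[Vy Vhy]; apply: differentiable_comp; first exact: (CM _ Vy).1.
  exact: (CF _ Vhy).1.
- move=> j; apply: (@C1_fun_comp _ E VF (comp3 hF j) hM oE).
  + move=> l; apply: C1_fun_sub (C1_on_fun l oVM CM).
    by move=> y /EV[].
  + by move=> y /EV[Vy _]; exact: (CM _ Vy).1.
  + by move=> y /EV[].
  + exact: C1_on_fun.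
- move=> x Tx; have [dFx JF] := dF x Tx; have [dMFx JM] := dMx x Tx.
  rewrite -det_jac; last exact: is_poly_vec_differentiable pP.
  rewrite (JP x Tx) (jacobian_comp dFx dMFx).
  move: JF JM; move: ('J (F i) x) ('J M (F i x)) => JF' JM' ? ?.
  by rewrite det_mulmx; exact: mulr_gt0.
- move=> x v Tx; rewrite (piola_comp v (dF x Tx).1 (dMx x Tx).1).
  by rewrite /piola (JP x Tx).
- exact: Fnull.
- exact: Mnull.
Qed.

End OneCell.

End Cells.

(** * Vanishing of the divergence *)

Section Vanishing.
Variable R : realType.
Implicit Types (A : set 'rV[R]_3).
Notation vec3 := (@vec3 R).
Notation mu3 := (@mu3 R).

Lemma wdiv_spec A v : Hdiv A v -> L2 A (wdiv A v) /\ is_weak_div A v (wdiv A v).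
Proof. by move=> [_ ex]; exact: xgetPex ex. Qed.

Lemma null3_neq0_of_int3_eq0 A (f : 'rV[R]_3 -> R) : open A ->
  mu3.-integrable (vec3 @^-1` A) (fun p => (f (vec3 p))%:E) ->
  null3 [set x | A x /\ f x < 0] -> int3 A f = 0 ->
  null3 [set x | A x /\ f x <> 0].
Proof.
move=> oA fi f0 intf; have mA := measurable_open3 oA.
have /integrableP[mf _] := fi.
have int0 : (\int[mu3]_(p in vec3 @^-1` A) (f (vec3 p))%:E = 0)%E.
  by rewrite -(fineK (integrable_fin_num mA fi)); congr EFin; exact: intf.
have abs0 : (\int[mu3]_(p in vec3 @^-1` A) `|(f (vec3 p))%:E| = 0)%E.
  rewrite -[RHS]int0; apply: ae_eq_integral => //; first exact: measurableT_comp.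
  apply: (negligibleS _ f0) => p /= /not_implyP[Ap ne]; split => //.
  rewrite ltNge; apply/negP => fp; apply: ne.
  by rewrite ger0_norm.
have /(ae_eq_integral_abs _ mA mf) := abs0.
apply: negligibleS => p [Ap fp] /= /(_ Ap) [].
by move=> e; apply: fp.
Qed.

Lemma is_poly_divergence r (q : 'rV[R]_3 -> 'rV[R]_3) :
  is_poly_vec r q -> is_poly r.-1 (divergence q).
Proof.
move=> pq; apply: (@sum_fun_ind _ (is_poly r.-1)); first exact: is_poly0.
  by move=> f g; exact: is_polyD.
by move=> l _; exact: is_poly_partial (pq l).
Qed.

End Vanishing.

Section CellDivergence.
Variables (R : realType) (k : nat) (Omega : set 'rV[R]_3) (I : finType)
  (F : I -> 'rV[R]_3 -> 'rV[R]_3).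
Hypothesis mesh : curved_mesh k Omega F.
Variable M : 'rV[R]_3 -> 'rV[R]_3.
Hypothesis flow : flow_map k Omega F M.
Notation T := (ref_tet (R := R)).
Notation T0 := (@int_tet R).
Notation A := (M @` Omega).
Implicit Types (x y z : 'rV[R]_3).

Let oOmega : open Omega. Proof. by have [] := mesh_domain mesh. Qed.
Let oA : open A. Proof. by have [] := flow_domain flow. Qed.

Lemma int_cell_closure i x : (F i @` T0) x -> closure Omega x.
Proof. by move=> [z Tz <-]; apply: (cell_closure mesh); exact: int_tet_sub. Qed.

Section OneCell.
Variables (i : I) (P H : 'rV[R]_3 -> 'rV[R]_3).
Hypothesis chart : cell_chart k F M i P H.
Notation O := (F i @` T0).
Notation E := (M @` O).

Lemma chart_right_inv y : E y -> P (H y) = y /\ T0 (H y).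
Proof.
move=> [_ [x Tx <-] <-].
by rewrite (chart_inv chart (int_tet_sub Tx)) -(chart_eq chart Tx).
Qed.

Lemma moved_cell_inv x : closure Omega x -> E (M x) -> O x.
Proof.
move=> cx [x' Ox' e]; have := flow_inj flow (int_cell_closure Ox') cx e.
by move=> <-.
Qed.

Definition cell_extension (s : 'rV[R]_3 -> R) y : R :=
  if `[< E y >] then s (H y) else 0.

(** In reference coordinates the extension is s on the interior of the given
    cell, and it vanishes on every other cell, because M is injective and cells
    do not overlap. *)
Lemma cell_extension_SM s : is_poly k.-1 s -> SM k Omega F M (cell_extension s).
Proof.
move=> ps; have ss := is_poly_smooth ps.
have cs x : {for x, continuous s} by exact: smooth_continuous ss x.
have [K sK] := continuous_bounded_cbox 1 (smooth_continuous ss).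
have oO := @open_int_cell _ _ _ _ _ mesh i.
have oE : open E by exact: (chart_open chart (subset_refl (A := O)) oO).
have TH y : E y -> cbox 0 1 (H y).
  by move=> /chart_right_inv[_ /int_tet_sub]; exact: ref_tet_cbox.
have cH y : E y -> {for y, continuous (s \o H)}.
  move=> Ey; apply: continuous_comp; last exact: cs.
  by apply: differentiable_continuous; exact: (chart_inv_diff chart).
split; last split.
- have [N N0 PN] := poly_image_bounded (chart_poly chart).
  apply: (@L2_patch R A E (s \o H) N K oA oE _ N0 cH).
    move=> _ [_ [x Tx <-] <-]; apply: PN; exists x; first exact: int_tet_sub.
    by rewrite (chart_eq chart Tx).
  by move=> y /TH; exact: sK.
- have [N N0 FN] := poly_image_bounded (mesh_poly mesh i).
  apply: (@L2_eq R Omega (fun x => if `[< O x >] then (s \o H \o M) x else 0)).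
  + exact: oOmega.
  + move=> x Ox; rewrite /cell_extension /=; congr (if _ then _ else _).
    apply: asbool_equiv_eq; split => [Oi|]; first by exists x.
    by apply: moved_cell_inv; exact: subset_closure.
  + apply: (@L2_patch R Omega O _ N K oOmega oO _ N0).
    * by move=> _ [x Tx <-]; apply: FN; exists x => //; exact: int_tet_sub.
    * move=> _ [x Tx <-].
      apply: (@continuous_comp _ _ _ M (s \o H)); last by apply: cH; exists (F i x) => //; exists x.
      by apply: differentiable_continuous; exact: (chart_diff chart).
    * by move=> x Ox; apply: sK; apply: TH; exists x.
- move=> j; have [ji|ij] := eqVneq j i.
    exists s => //; apply/ae3P; apply: null3_sub (null3_tet_boundary R) _ => x [Tx ne].
    split => // T0x; apply: ne; rewrite ji /cell_extension /= asboolT.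
      by rewrite (chart_inv chart).
    by exists (F i x) => //; exists x.
  exists (fun=> 0); first exact: is_poly0.
  apply/ae3P; apply: null3_sub (null3_tet_boundary R) _ => x [Tx ne].
  exfalso; apply: ne; rewrite /cell_extension /= asboolF// => /moved_cell_inv.
  move=> /(_ (@cell_closure _ _ _ _ _ mesh j _ Tx))[z Tz e].
  by apply: (cell_disjoint mesh _ Tz Tx (esym e)); rewrite eq_sym.
Qed.

(** The two identities of the definition of the discrete space hold outside null
    sets of the reference tetrahedron and of the initial domain; these are carried
    to the moved cell, where the two Piola transforms compose. *)
Lemma WM_cell J : WM k Omega F M J -> exists2 q, is_poly_vec k q &
  null3 [set y | (M @` (O `&` Omega)) y /\
    ~ forall j, J y 0 j = piola_component P q j (H y)].
Proof.
move=> [_ [w0 [_ /(_ i) [q pq /ae3P N2]] /ae3P N1]]; exists q => //.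
set B1 := [set x | _] in N1; set B2 := [set x | _] in N2.
have nB1 : null3 (M @` (B1 `&` O)).
  apply: (chart_null_flow chart); last by apply: null3_sub N1 _; exact: subIsetl.
  by move=> x [_ Ox]; exact: (@image_int_cell_sub R I F i).
have nB2 : null3 (M @` (F i @` B2)).
  apply: (chart_null_flow chart); first by move=> _ [x [Tx _] <-]; exists x.
  by apply: (chart_null_cell chart) => // x [].
apply: null3_sub (null3U nB1 nB2) _ => _ [[_ [[x Tx <-] Ox] <-] ne].
have [n1|n1] := pselect (B1 (F i x)).
  by left; exists (F i x) => //; split => //; exists x.
have [n2|n2] := pselect (B2 x); first by right; exists (F i x) => //; exists x.
exfalso; apply: ne => j.
have e1 : J (M (F i x)) = piola M (F i x) (w0 (F i x)).
  by apply: contrapT => e; apply: n1; split; [exact: Ox|exact: e].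
have e2 : w0 (F i x) = piola (F i) x (q x).
  by apply: contrapT => e; apply: n2; split; [exact: int_tet_sub|exact: e].
rewrite [in LHS]e1 [in LHS]e2 [in LHS](chart_piola chart _ Tx) [in RHS](chart_inv chart (int_tet_sub Tx)).
by apply: piolaE; exact: is_poly_vec_differentiable (chart_poly chart).
Qed.

(** The test function is the extension of div q; with it the integrand is
    (div q)^2 / det DP in reference coordinates, hence nonnegative. *)
Lemma wdiv_cell_eq0 J : WM k Omega F M J ->
  div_free_eq A J (SM k Omega F M) ->
  null3 [set y | (M @` (O `&` Omega)) y /\ wdiv A J y <> 0].
Proof.
move=> WJ dJ; have [q pq nJ] := WM_cell WJ.
have [[LJ exg] _] := WJ; have [Lg wg] := wdiv_spec (conj LJ exg).
set W := M @` (O `&` Omega); set g := wdiv A J.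
have oO := @open_int_cell _ _ _ _ _ mesh i.
have oW : open W.
  by apply: (chart_open chart) => [x []//|]; exact: openI.
have WA : W `<=` A by move=> _ [x [_ Ox] <-]; exists x.
have WE : W `<=` E by move=> _ [x [Ox _] <-]; exists x.
have dH y : W y -> differentiable H y by move=> /WE; exact: (chart_inv_diff chart).
have CH j : C1_fun W (comp3 H j) by exact: (C1_fun_sub WE (chart_inv_C1 chart j)).
have PH y : W y -> P (H y) = y by move=> /WE/chart_right_inv[].
pose D y := divergence q (H y); pose d y := (det3_fun (jac P (H y)))^-1.
have dpos y : E y -> 0 < d y.
  by move=> /chart_right_inv[_ T0H]; rewrite invr_gt0; exact: (chart_det chart).
have nD : null3 [set y | W y /\ g y <> D y * d y].
  have := weak_div_classical oA oW WA LJ Lg wg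
    (C1_transported (chart_poly chart) pq oW dH CH PH) nJ.
  move=> /null3_sub; apply => y [Wy ne]; split; first exact: Wy.
  by rewrite (divergence_transported (chart_poly chart) pq oW dH PH Wy).
pose r := cell_extension (divergence q).
have Sr : SM k Omega F M r by apply: cell_extension_SM; exact: is_poly_divergence.
have rE y : E y -> r y = D y by move=> Ey; rewrite /r /cell_extension asboolT.
have nr : null3 [set y | A y /\ g y * r y <> 0].
  apply: null3_neq0_of_int3_eq0 => //.
  - by apply: (L2_mul_integrable (f := g) (g := r)) => //; exact: Sr.1.
  - apply: null3_sub nD _ => y [[x Ox xy] neg].
    have [Ey|nE] := pselect (E y); last first.
      by move: neg; rewrite /r /cell_extension asboolF// mulr0 ltxx.
    split.
      by exists x => //; split => //; apply: moved_cell_inv; [exact: subset_closure|rewrite xy].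
    move=> e; move: neg; rewrite e rE// ltNge; apply/negP/negPn.
    by rewrite mulrAC mulr_ge0 ?sqr_ge0// -?expr2 ?sqr_ge0// ltW// dpos.
  - by have /eqP := dJ r Sr; rewrite oppr_eq0 => /eqP.
apply: null3_sub (null3U nD nr) _ => y [Wy gy].
have [e|ne] := pselect (g y = D y * d y); last by left.
right; split; first exact: WA.
rewrite rE; last exact: WE.
move=> /eqP; rewrite mulf_eq0 => /orP[/eqP//|/eqP Dy].
by apply: gy; rewrite -/g e Dy mul0r.
Qed.

End OneCell.

(** The points of the domain that lie in the interior of no moved cell form a
    null set, the image of the boundary of the tetrahedron under the charts. *)
Lemma wdiv_eq0 J : WM k Omega F M J -> div_free_eq A J (SM k Omega F M) ->
  ae3 A (fun y => wdiv A J y = 0).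
Proof.
move=> WJ dJ; apply/ae3P.
have nW : null3 (\bigcup_i [set y | (M @` (F i @` T0 `&` Omega)) y /\ wdiv A J y <> 0]).
  apply: null3_bigcup => i; have [P [H chart]] := exists_cell_chart mesh flow i.
  exact: (wdiv_cell_eq0 chart WJ dJ).
have nS : null3 (\bigcup_i (M @` (F i @` [set x | T x /\ ~ T0 x]))).
  apply: null3_bigcup => i; have [P [H chart]] := exists_cell_chart mesh flow i.
  apply: (chart_null_flow chart); first by move=> _ [x [Tx _] <-]; exists x.
  by apply: (chart_null_cell chart) (null3_tet_boundary R) => x [].
apply: null3_sub (null3U nW nS) _ => y [[x Ox xy] gy].
have : closure Omega x by exact: subset_closure.
rewrite (mesh_cover mesh) => -[i _ [z Tz zx]].
have [T0z|nT0] := pselect (T0 z); last by right; exists i => //; exists x => //; exists z.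
by left; exists i => //; split => //; exists x => //; split => //; exists z.
Qed.

End CellDivergence.

Theorem lemma3p1 (R : realType) (k : nat) (hk : (1 <= k)%N)
  (Omega0 : set 'rV[R]_3) (I : finType) (F : I -> 'rV[R]_3 -> 'rV[R]_3)
  (hmesh : curved_mesh k Omega0 F)
  (T : R) (hT : 0 < T) (N : nat) (hN : (1 <= N)%N)
  (dt : R) (hdt : dt = T / N%:R)
  (M : nat -> 'rV[R]_3 -> 'rV[R]_3)
  (hM : forall n, (n <= N)%N -> flow_map k Omega0 F (M n))
  (hM0 : forall x, closure Omega0 x -> M 0%N x = x)
  (rho sigma nu : nat -> 'rV[R]_3 -> R)
  (hrho0 : coefficient Omega0 (rho 0%N))
  (hsigma0 : coefficient Omega0 (sigma 0%N))
  (hnu0 : coefficient Omega0 (nu 0%N))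
  (hrho : forall n, (n <= N)%N -> ae3 Omega0
     (fun x => rho n (M n x) = rho 0%N x / \det ('J (M n) x)))
  (hsigma : forall n, (n <= N)%N -> ae3 Omega0
     (fun x => sigma n (M n x) = sigma 0%N x))
  (hnu : forall n, (n <= N)%N -> ae3 Omega0
     (fun x => nu n (M n x) = nu 0%N x))
  (Re alpha beta : R) (hRe : 0 < Re) (halpha : 0 <= alpha) (hbeta : 0 < beta)
  (B : 'rV[R]_3 -> 'rV[R]_3) (hB : bounded_field B)
  (fu : R -> 'rV[R]_3 -> 'rV[R]_3)
  (hfu : forall n, (1 <= n < N)%N -> forall i,
     L2 (M n.+1 @` Omega0) (comp3 (fu (n.+1%:R * dt)) i))
  (J u : nat -> 'rV[R]_3 -> 'rV[R]_3) (phi p : nat -> 'rV[R]_3 -> R)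
  (hu0 : V0 k Omega0 F (u 0%N))
  (hu1 : VM k Omega0 F (M 1%N) (u 1%N))
  (hflow : forall n, (1 <= n < N)%N -> flow_step Omega0 dt M u n)
  (hJ : forall n, (1 <= n < N)%N -> WM k Omega0 F (M n.+1) (J n.+1))
  (hu : forall n, (1 <= n < N)%N -> VM k Omega0 F (M n.+1) (u n.+1))
  (hphi : forall n, (1 <= n < N)%N -> SM k Omega0 F (M n.+1) (phi n.+1))
  (hp : forall n, (1 <= n < N)%N -> QM k Omega0 F (M n.+1) (p n.+1))
  (hohm : forall n, (1 <= n < N)%N ->
     ohm_eq (M n.+1 @` Omega0) (sigma n.+1) B (J n.+1) (u n.+1) (phi n.+1)
       (WM k Omega0 F (M n.+1)))
  (hmomentum : forall n, (1 <= n < N)%N ->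
     momentum_eq (M n.+1 @` Omega0) Re alpha beta (rho n.+1) (nu n.+1) B
       (fu (n.+1%:R * dt)) (J n.+1) (u n.+1) (bdf2 Omega0 dt M u n) (p n.+1)
       (VM k Omega0 F (M n.+1)))
  (hdivJ : forall n, (1 <= n < N)%N ->
     div_free_eq (M n.+1 @` Omega0) (J n.+1) (SM k Omega0 F (M n.+1)))
  (hdivu : forall n, (1 <= n < N)%N ->
     div_free_eq (M n.+1 @` Omega0) (u n.+1) (QM k Omega0 F (M n.+1))) :
  forall n, (1 <= n < N)%N ->
    ae3 (M n.+1 @` Omega0) (fun x => wdiv (M n.+1 @` Omega0) (J n.+1) x = 0).
Proof.
move=> n /andP[n1 nN].
by apply: (wdiv_eq0 hmesh (hM _ nN) (hJ _ _) (hdivJ _ _)); rewrite n1.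
Qed.
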